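(* Let $\Omega\subseteq\mathbb{C}^n$ be a bounded domain with $C^2$ boundary, let $0<p\le\infty$, and let $f\in H^p(\Omega)$ with boundary trace function $\widetilde{f}$. Suppose that $\widetilde{f}$ vanishes on a set $E\subseteq\partial\Omega$ of positive $\sigma$ measure. Then $f\equiv 0$ on $\Omega$.
   Context: A domain in $\mathbb{C}^n$ is a connected open set. $\sigma$ is the usual area measure on $\partial\Omega$, i.e. $(2n-1)$-dimensional Hausdorff measure restricted to $\partial\Omega$. Hardy spaces: write $\Omega=\{z\in\mathbb{C}^n:\rho(z)<0\}$ with $\rho$ a $C^2$ defining function satisfying $\nabla\rho\neq0$ on $\partial\Omega$. For $0<p<\infty$, $H^p(\Omega)$ is the set of holomorphic functions $f$ on $\Omega$ with $$\|f\|_{H^p(\Omega)}=\sup_{\epsilon>0}\left(\int_{\rho(\zeta)=-\epsilon}|f(\zeta)|^p\,d\sigma_\epsilon(\zeta)\right)^{1/p}<\infty,$$ where $\epsilon$ ranges over small positive numbers and $\sigma_\epsilon$ is area measure on $\{\rho=-\epsilon\}$; the space does not depend on the choice of $\rho$. $H^\infty(\Omega)$ is the space of bounded holomorphic functions on $\Omega$. A Hardy space function is an element of $H^p(\Omega)$ for some $0<p\le\infty$. Boundary trace: every Hardy space function $f$ has a nontangential limit at $\sigma$-almost every $P\in\partial\Omega$, i.e. a limit of $f(z)$ as $z\to P$ with $z\in\Gamma_\alpha(P)=\{z\in\Omega:|z-P|<(1+\alpha)\,\mathrm{dist}(z,\partial\Omega)\}$ for every $\alpha>0$. The $\sigma$-almost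 everywhere defined function of these limits is $\widetilde{f}$. *)

(* Defs.v *)
From HB Require Import structures.
From mathcomp Require Import all_boot all_order all_algebra complex.
From mathcomp Require Import all_classical all_reals all_analysis.

Set Implicit Arguments.
Unset Strict Implicit.
Unset Printing Implicit Defensive.
Import Order.TTheory GRing.Theory Num.Theory.
Import ComplexField.Normc numFieldNormedType.Exports.
Local Open Scope classical_set_scope.
Local Open Scope complex_scope.
Local Open Scope ring_scope.

(* The modulus topology on R[i], as a normed space over itself; the product
   topology on 'rV[R[i]]_n is then the usual one on C^n. *)
HB.instance Definition _ (R : rcfType) := NormedModule.copy R[i] R[i]^o.

Section complex_space.
Context {R : realType} {n : nat}.
Local Notation Cn := 'rV[R[i]]_n.

(* The norm that 'rV[R[i]]_n inherits from the library is the sup norm, which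
   gives the same topology but a different Hausdorff measure and different
   approach regions. *)
Definition enorm (z : Cn) : R := Num.sqrt (\sum_j normc (z 0 j) ^+ 2).

Definition dist_to (z : Cn) (A : set Cn) : R := inf [set enorm (z - w) | w in A].

Definition boundary (A : set Cn) : set Cn := closure A `\` A°.

Definition domain (Omega : set Cn) : Prop :=
  open Omega /\ connected Omega.

Definition holomorphic (Omega : set Cn) (f : Cn -> R[i]) : Prop :=
  forall z, Omega z -> differentiable (f : Cn -> R[i]^o) z.

(* The standard basis of C^n as a real vector space of dimension n + n, in the
   order x_1, ..., x_n, y_1, ..., y_n. *)
Definition real_basis (k : 'I_(n + n)) : Cn :=
  match fintype.split k with
  | inl j => delta_mx 0 j
  | inr j => 'i%C *: delta_mx 0 j
  end.

Definition real_line (z : Cn) (k : 'I_(n + n)) (t : R) : Cn :=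
  z + t%:C *: real_basis k.

Definition real_partial (k : 'I_(n + n)) (u : Cn -> R) (z : Cn) : R :=
  derive1 (u \o real_line z k) 0.

Definition real_gradient (u : Cn -> R) (z : Cn) : 'rV[R]_(n + n) :=
  \row_k real_partial k u z.

Fixpoint class_C (k : nat) (u : Cn -> R) : Prop :=
  continuous u /\
  if k is k'.+1 then
    forall i, (forall z, derivable (u \o real_line z i) 0 1) /\
              class_C k' (real_partial i u)
  else True.

Definition C2_defining_function (Omega : set Cn) (rho : Cn -> R) : Prop :=
  [/\ class_C 2 rho,
      Omega = [set z | rho z < 0] &
      forall z, boundary Omega z -> real_gradient rho z != 0].

Definition C2_boundary (Omega : set Cn) : Prop :=
  exists rho, C2_defining_function Omega rho.

Definition approach_region (Omega : set Cn) (alpha : R) (P : Cn) : set Cn :=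
  [set z | Omega z /\
           enorm (z - P) < (1 + alpha) * dist_to z (boundary Omega)].

(* The trace of f is a partial function on the boundary, given here by its
   graph: it is defined at P with value l when f has nontangential limit l
   at P. *)
Definition boundary_trace (Omega : set Cn) (f : Cn -> R[i]) (P : Cn)
    (l : R[i]) : Prop :=
  forall alpha : R, 0 < alpha ->
    f @ within (approach_region Omega alpha P) (nbhs P) --> l.

End complex_space.

(* Lebesgue volume of the unit ball of R^m, by the classical recursion
   v_0 = 1, v_1 = 2, v_(m+2) = 2 pi / (m + 2) v_m. *)
Fixpoint unit_ball_volume (R : realType) (m : nat) : R :=
  match m with
  | 0 => 1
  | 1 => 2
  | m'.+2 => 2 * pi / m'.+2%:R * unit_ball_volume R m'
  end.

Section hausdorff_measure.
Context {R : realType} {n : nat} (m : nat).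
Local Notation Cn := 'rV[R[i]]_n.
Local Open Scope ereal_scope.

(* The value is -oo on the empty set, hence the case split below. *)
Definition diameter (A : set Cn) : \bar R :=
  ereal_sup [set (enorm (x - y))%:E | x in A & y in A].

Definition hausdorff_gauge (A : set Cn) : \bar R :=
  if A == set0 then 0
  else (unit_ball_volume R m)%:E * (diameter A * (2^-1)%:E) ^+ m.

Definition hausdorff_cover (delta : R) (A : set Cn) : set ((set Cn)^nat) :=
  [set U | (forall k, diameter (U k) <= delta%:E) /\ A `<=` \bigcup_k U k].

Definition hausdorff_content (delta : R) (A : set Cn) : \bar R :=
  ereal_inf [set \sum_(k <oo) hausdorff_gauge (U k)
            | U in hausdorff_cover delta A].

(* m-dimensional Hausdorff (outer) measure, normalized so as to agree with
   m-dimensional area *)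
Definition hausdorff (A : set Cn) : \bar R :=
  ereal_sup [set hausdorff_content delta A | delta in [set d : R | (0 < d)%R]].

Lemma unit_ball_volume_ge0 k : (0 <= unit_ball_volume R k)%R.
Proof.
suff: (0 <= unit_ball_volume R k)%R /\ (0 <= unit_ball_volume R k.+1)%R by case.
elim: k => [|k [k0 k1]]; first by split; rewrite /= ?ler01 ?ler0n.
split=> //; rewrite [X in (_ <= X)%R]/=.
apply: mulr_ge0 => //; apply: divr_ge0 => //.
by apply: mulr_ge0 => //; exact: pi_ge0.
Qed.

Lemma hausdorff_gauge_ge0 A : 0 <= hausdorff_gauge A.
Proof.
rewrite /hausdorff_gauge; case: eqP => // /eqP/set0P[x Ax].
apply: mule_ge0; first by rewrite lee_fin unit_ball_volume_ge0.
apply: expe_ge0; apply: mule_ge0; last by rewrite lee_fin invr_ge0.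
apply: (@le_trans _ _ (enorm (x - x))%:E); first by rewrite lee_fin sqrtr_ge0.
by apply: ereal_sup_ubound; exists x => //; exists x.
Qed.

Lemma hausdorff_content_ge0 delta A : 0 <= hausdorff_content delta A.
Proof.
apply: le_ereal_inf_tmp => _ [U _ <-].
by apply: nneseries_ge0 => k _ _; exact: hausdorff_gauge_ge0.
Qed.

Lemma le_hausdorff_content delta :
  {homo hausdorff_content delta : A B / A `<=` B >-> A <= B}.
Proof.
move=> A B AB; apply/ereal_inf_le_tmp => _ [U [dU BU] <-].
by exists U => //; split => //; exact: subset_trans BU.
Qed.

Lemma hausdorff_content0 delta : (0 < delta)%R ->
  hausdorff_content delta set0 = 0.
Proof.
move=> d0; apply/eqP; rewrite eq_le hausdorff_content_ge0 andbT.
apply: ereal_inf_lbound; exists (fun=> set0).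
  split=> // k; apply: ge_ereal_sup => _ [x []].
by rewrite eseries0// => k _ _; rewrite /hausdorff_gauge eqxx.
Qed.

Lemma hausdorff_content_sigma_subadditive delta :
  sigma_subadditive (hausdorff_content delta).
Proof.
move=> A; have [[i ioo]|] := pselect (exists i, hausdorff_content delta (A i) = +oo).
  rewrite (eseries_pinfty _ _ ioo) ?leey// => k _.
  by rewrite -ltNye (lt_le_trans _ (hausdorff_content_ge0 _ _)).
rewrite -forallNE => Aoo.
suff add2e (e : {posnum R}) : hausdorff_content delta (\bigcup_k A k) <=
    \sum_(i <oo) hausdorff_content delta (A i) + e%:num%:E.
  by apply/lee_addgt0Pr => _/posnumP[].
rewrite (le_trans _ (epsilon_trick _ _ _))//; last first.
  by move=> k; exact: hausdorff_content_ge0.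
pose P k (B : (set Cn)^nat) := hausdorff_cover delta (A k) B /\
  \sum_(j <oo) hausdorff_gauge (B j)
    <= hausdorff_content delta (A k) + (e%:num / (2 ^ k.+1)%:R)%:E.
have [G PG] : {G : ((set Cn)^nat)^nat & forall k, P k (G k)}.
  apply: (@choice _ _ P) => k; rewrite /P /hausdorff_content.
  set S := (X in ereal_inf X); move infS : (ereal_inf S) => iS.
  case: iS infS => [r Sr|Soo|Soo].
  - have en1 : (0 < e%:num / (2 ^ k.+1)%:R)%R by [].
    have /(lb_ereal_inf_adherent en1) : ereal_inf S \is a fin_num by rewrite Sr.
    move=> [x [B BA muBx] xS].
    by exists B; split => //; rewrite muBx -Sr; exact/ltW.
  - by have := Aoo k; rewrite /hausdorff_content Soo.
  - suff : lbound S 0 by move/le_ereal_inf_tmp; rewrite Soo.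
    move=> /= _ [B _ <-]; apply: nneseries_ge0 => j _ _.
    exact: hausdorff_gauge_ge0.
have muG_ge0 x : 0 <= (hausdorff_gauge \o uncurry G) x.
  exact: hausdorff_gauge_ge0.
apply: (@le_trans _ _ (\esum_(i in setT) (hausdorff_gauge \o uncurry G) i)).
  rewrite /hausdorff_content; apply: ereal_inf_lbound => /=.
  have /card_esym/ppcard_eqP[f] := card_nat2.
  exists (uncurry G \o f).
    split => [i|].
      by rewrite /= /uncurry; case: (f i) => a b; exact: (PG a).1.1.
    apply: (@subset_trans _  (\bigcup_k \bigcup_j G k j)) => [t [i _]|].
      by move=> /((PG i).1.2) -[j _ ?]; exists i => //; exists j.
    move=> t [i _ [j _ Bijt]]; exists (f^-1%FUN (i, j)) => //=.
    by rewrite invK ?inE.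
  rewrite -(esum_pred_image (hausdorff_gauge \o uncurry G) _ xpredT) ?[fun=> _]set_true//.
  by rewrite image_eq.
rewrite (_ : esum _ _ = \sum_(i <oo) \sum_(j <oo) hausdorff_gauge (G i j)); last first.
  pose J : nat -> set (nat * nat) := fun i => [set (i, j) | j in setT].
  rewrite (_ : setT = \bigcup_k J k); last first.
    by rewrite predeqE => -[a b]; split => // _; exists a => //; exists b.
  rewrite esum_bigcupT /=; last 2 first.
    - apply/trivIsetP => i j _ _ ij.
      rewrite predeqE => -[k l] /=; split => //= -[] [_] _ [<-{k} _].
      by move=> [l' _] [] /esym/eqP; rewrite (negbTE ij).
    - by move=> /= [k l]; exact: hausdorff_gauge_ge0.
  rewrite -(image_id [set: nat]) -fun_true esum_pred_image//; last first.
    by move=> k _; apply: esum_ge0 => -[a b] _; exact: hausdorff_gauge_ge0.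
  apply: eq_eseriesr => /= j _.
  rewrite -(esum_pred_image (hausdorff_gauge \o uncurry G) (pair j) predT)//=; last 2 first.
  - by move=> k _; exact: hausdorff_gauge_ge0.
  - by move=> ? ? _ _; exact: (@can_inj _ _ _ snd).
  by congr esum; rewrite predeqE => -[a b]; split; move=> [i _ <-]; exists i.
apply: lee_nneseries => [k _ _|k _]; last exact: (PG k).2.
by apply: nneseries_ge0 => j _ _; exact: (muG_ge0 (k, j)).
Qed.

Lemma hausdorff_ge0 A : 0 <= hausdorff A.
Proof.
apply: (le_trans (hausdorff_content_ge0 1 A)).
by apply: ereal_sup_ubound; exists 1%R => /=.
Qed.

Lemma hausdorff0 : hausdorff set0 = 0.
Proof.
apply/eqP; rewrite eq_le hausdorff_ge0 andbT.
by apply: ge_ereal_sup => _ [d d0 <-]; rewrite hausdorff_content0.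
Qed.

Lemma le_hausdorff : {homo hausdorff : A B / A `<=` B >-> A <= B}.
Proof.
move=> A B AB; apply: ge_ereal_sup => _ [d d0 <-].
apply: (le_trans (le_hausdorff_content d AB)).
by apply: ereal_sup_ubound; exists d.
Qed.

Lemma hausdorff_sigma_subadditive : sigma_subadditive hausdorff.
Proof.
move=> A; apply: ge_ereal_sup => _ [d d0 <-].
apply: (le_trans (hausdorff_content_sigma_subadditive d A)).
apply: lee_nneseries => [k _ _|k _]; first exact: hausdorff_content_ge0.
by apply: ereal_sup_ubound; exists d.
Qed.

HB.instance Definition _ := isOuterMeasure.Build R Cn hausdorff
  hausdorff0 hausdorff_ge0 le_hausdorff hausdorff_sigma_subadditive.

End hausdorff_measure.

(* (2n-1)-dimensional Hausdorff measure as a measure on the sigma-algebra of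
   its Caratheodory measurable sets.  Area measure on a hypersurface S of C^n
   is its restriction to the subsets of S. *)
Definition area_outer (R : realType) (n : nat) :
    {outer_measure set 'rV[R[i]]_n -> \bar R} :=
  @hausdorff R n (2 * n).-1.

Definition area_space (R : realType) (n : nat) :=
  caratheodory_type (area_outer R n).

Definition area (R : realType) (n : nat) :
    {measure set (area_space R n) -> \bar R} :=
  (area_outer R n : set (caratheodory_type (area_outer R n)) -> \bar R).

Section hardy_space.
Context {R : realType} {n : nat}.
Local Notation Cn := 'rV[R[i]]_n.

Definition hardy_mean (rho : Cn -> R) (p : R) (f : Cn -> R[i]) (eps : R) :
    \bar R :=
  ((\int[area R n]_(z in [set z | rho z = (- eps)%R]) (normc (f z) `^ p)%:E)
     `^ p^-1)%E.

Definition hardy_norm (rho : Cn -> R) (p : R) (f : Cn -> R[i]) (eps0 : R) :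
    \bar R :=
  ereal_sup [set hardy_mean rho p f eps | eps in `]0, eps0[ ].

Definition hardy (p : \bar R) (Omega : set Cn) (f : Cn -> R[i]) : Prop :=
  holomorphic Omega f /\
  match p with
  | r%:E => exists2 rho, C2_defining_function Omega rho &
      exists2 eps0, 0 < eps0 & (hardy_norm rho r f eps0 < +oo)%E
  | +oo%E => exists M : R, forall z, Omega z -> normc (f z) <= M
  | -oo%E => False
  end.

End hardy_space.

(* Main.v *)
(* In a C^2 chart the boundary is a graph over dyadic cubes.  Coding nested cubes
   by adic intervals carries area to Lebesgue measure on the line, and Lebesgue
   density yields one cube Q such that, for every L, almost all of its subcubes
   at some fine level are good: they contain a point of E in whose approach
   region |f| <= exp (- L) at the scale of the subcube.

   On the union of the cones over the good subcubes log |f| is compared with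
   L (H / c + 2 h / lam^2 - 1), where lam is the size of Q.  Here H sums, over
   the bad subcubes, harmonic kernels with poles y on the boundary which are at
   least - rho z / |z - y|^(2n) in Omega; H exceeds c wherever no good cone
   reaches, and is small well inside Omega because bad subcubes are few.  The
   superharmonic quadratic h is at least lam^2 / 2 on the sphere of radius lam
   around Q.  Hence |f| <= exp (- L / 2) near a point of Omega that does not
   depend on L, so that f vanishes near this point, and then everywhere.

   The maximum principle for log |f| against a majorant is reduced to one
   variable: the second order expansion of the majorant along a complex line is
   a radial term plus the real part of a polynomial, whose exponential can be
   absorbed in f. *)
Require Import Defs.
From mathcomp Require Import all_boot all_order all_algebra complex.
From mathcomp Require Import all_classical all_reals all_analysis measurable_realfun.
From mathcomp Require Import zify ring lra.
Import Order.TTheory GRing.Theory Num.Theory numFieldNormedType.Exports.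
Import ComplexField.Normc.
Local Open Scope classical_set_scope.
Local Open Scope complex_scope.
Local Open Scope ring_scope.

(** A union of cones is only a Lipschitz region, whose harmonic measure is not explicit; the sum of
    kernels replaces it. On the lateral sides of the region nothing better than |f| <= 1 is known,
    so the majorant must be nonnegative there; on the bottom |f| <= exp (- L) and it may sink to -
    L. The proportion of bad subcubes is fixed before L and their level is chosen after L, so the
    inner point and its neighbourhood stay put while L grows.

    The points of E whose cones satisfy |f| <= 1 below a common scale are not known to form a
    measurable set. Hence only outer area occurs, and a single inequality links it to the line: a
    subcube of level k has diameter O (2^(- k)), so its outer area is at most a constant times 2^(-
    k (2n - 1)), the length of its adic interval. The set whose density is taken lives on the line
    and is measurable by construction. A cell of high density comes from the same comparison with a
    constant below 1: a bound valid on all fine cells would pass to the set itself. *)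

Local Notation Re := (@complex.Re _).
Local Notation Im := (@complex.Im _).

(** * Integrals over closed intervals *)

Section interval_integral.
Context {R : realType}.
Implicit Types (f g : R -> R) (a b c : R).
Local Notation mu := (@lebesgue_measure R).

Implicit Types e k : R.
Definition itg f a b : R := (\int[mu]_(x in `[a, b]) f x)%R.

(** Continuity is two-sided even at the end points, so that it passes to subintervals without a
    change of topology. *)
Definition ctn f a b := forall x, a <= x <= b -> {for x, continuous f}.

Lemma ctn_integrable f a b : ctn f a b -> mu.-integrable `[a, b] (EFin \o f).
Proof.
move=> cf; apply: continuous_compact_integrable; first exact: segment_compact.
apply: continuous_in_subspaceT => x; rewrite inE/= in_itv/= => /cf; exact.
Qed.

Lemma itg_split f a b c : a <= c <= b -> ctn f a b ->
  itg f a b = itg f a c + itg f c b.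
Proof.
move=> /andP[ac cb] cf; have if_ := ctn_integrable f a b cf.
have := @Rintegral_itvB R f (BLeft a) (BRight b) c if_.
rewrite !bnd_simp => /(_ ac cb).
rewrite -/(itg f a b) -/(itg f a c) => E.
rewrite -[LHS](subrK (itg f a c)) E addrC; congr (_ + _).
rewrite /itg Rintegral_itv_obnd_cbnd//.
by apply: integrableS if_ => //; apply: subset_itvr; rewrite bnd_simp.
Qed.

Lemma itgD f g a b : ctn f a b -> ctn g a b ->
  itg (fun x => f x + g x) a b = itg f a b + itg g a b.
Proof. by move=> cf cg; rewrite /itg RintegralD//; exact: ctn_integrable. Qed.

(** The centre [k] is kept apart from the error [e] so that the main terms of several integrals can
    cancel. *)
Lemma itg_bound f a b k e : a <= b -> ctn f a b ->
  (forall x, a <= x <= b -> `|f x - k| <= e) ->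
  `|itg f a b - k * (b - a)| <= e * (b - a).
Proof.
move=> ab cf fe.
have itgc r : itg (cst r) a b = r * (b - a).
  rewrite /itg /cst Rintegral_cst//.
  have E : mu `[a, b]%classic = if a < b then (b - a)%:E else 0%E.
    by rewrite (lebesgue_measure_itv `[a, b]) /= lte_fin EFinB.
  congr (_ * _); rewrite [LHS](congr1 fine E).
  by case: (ltgtP a b) ab => //= -> _; rewrite subrr.
have cc r : ctn (cst r) a b by move=> x _; exact: cst_continuous.
have itg_le h1 h2 : ctn h1 a b -> ctn h2 a b ->
    (forall x, a <= x <= b -> h1 x <= h2 x) -> itg h1 a b <= itg h2 a b.
  move=> c1 c2 h; apply: le_Rintegral; try exact: ctn_integrable.
    exact: measurable_itv.
  by move=> x /=; rewrite in_itv/=; exact: h.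
have le1 : (k - e) * (b - a) <= itg f a b.
  rewrite -itgc; apply: itg_le => // x /fe; rewrite /cst/= ler_norml; lra.
have le2 : itg f a b <= (k + e) * (b - a).
  rewrite -itgc; apply: itg_le => // x /fe; rewrite /cst/= ler_norml; lra.
by rewrite ler_norml; apply/andP; split; move: le1 le2; rewrite mulrBl mulrDl; lra.
Qed.

End interval_integral.

(** * Subdivision of rectangles *)

Section bisection.
Context {R : realType}.

Lemma divr_exp2_small (x d : R) : 0 < d ->
  exists n, forall m, (n <= m)%N -> x / 2 ^+ m < d.
Proof.
move=> d0; exists (Num.bound (`|x| / d)) => m nm.
apply: (le_lt_trans (ler_wpM2r _ (ler_norm x))).
  by rewrite invr_ge0 exprn_ge0.
rewrite ltr_pdivrMr ?exprn_gt0// mulrC -ltr_pdivrMr//.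
have /archi_boundP/lt_le_trans : 0 <= `|x| / d by rewrite divr_ge0// ltW.
by apply; rewrite -natrX ler_nat (leq_trans nm)// ltnW// ltn_expl.
Qed.

(* J a h c k plays the role of an integral along the boundary of the rectangle
   [a, a + h] x [c, c + k] *)
Lemma bisection_eq0 (J : R -> R -> R -> R -> R) (a0 h0 c0 k0 : R) :
  0 <= h0 -> 0 <= k0 ->
  (forall a h c k : R, 0 <= h -> 0 <= k -> a0 <= a -> a + h + h <= a0 + h0 ->
     J a (h + h) c (k + k) =
     J a h c k + J (a + h) h c k + (J a h (c + k) k + J (a + h) h (c + k) k)) ->
  (forall x y e : R, a0 <= x <= a0 + h0 -> 0 < e ->
     exists2 d : R, 0 < d & forall a h c k : R,
       a0 <= a -> a + h <= a0 + h0 -> a <= x <= a + h -> c <= y <= c + k ->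
       h < d -> k < d -> `|J a h c k| <= e * (h + k) ^+ 2) ->
  J a0 h0 c0 k0 = 0.
Proof.
move=> h0_ge0 k0_ge0 Jadd Jsmall.
pose h n := h0 / 2 ^+ n; pose k n := k0 / 2 ^+ n.
have hge n : 0 <= h n by rewrite divr_ge0// exprn_ge0.
have kge n : 0 <= k n by rewrite divr_ge0// exprn_ge0.
have hS n : h n = h n.+1 + h n.+1.
  have : (2:R) ^+ n != 0 by rewrite expf_neq0.
  by rewrite /h exprS => ?; field.
have kS n : k n = k n.+1 + k n.+1.
  have : (2:R) ^+ n != 0 by rewrite expf_neq0.
  by rewrite /k exprS => ?; field.
(* A quarter is good if it carries at least a quarter of |J|. The last one is the default: when the
   other three fail, additivity forces it to be good. *)
pose step n (p : R * R) : R * R :=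
  let good q := `|J p.1 (h n) p.2 (k n)| <= 4 * `|J q.1 (h n.+1) q.2 (k n.+1)| in
  let q1 := (p.1, p.2) in let q2 := (p.1 + h n.+1, p.2) in
  let q3 := (p.1, p.2 + k n.+1) in let q4 := (p.1 + h n.+1, p.2 + k n.+1) in
  if good q1 then q1 else if good q2 then q2 else if good q3 then q3 else q4.
pose fix u n := if n is m.+1 then step m (u m) else (a0, c0).
have uS n : (u n.+1).1 = (u n).1 \/ (u n.+1).1 = (u n).1 + h n.+1.
  by rewrite /= /step; do 3 (case: ifP => _; first by [left|right]); right.
have vS n : (u n.+1).2 = (u n).2 \/ (u n.+1).2 = (u n).2 + k n.+1.
  by rewrite /= /step; do 3 (case: ifP => _; first by [left|right]); right.
have usub n : a0 <= (u n).1 /\ (u n).1 + h n <= a0 + h0.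
  elim: n => [|n [IH1 IH2]]; first by rewrite /= /h expr0 divr1.
  by move: IH2; rewrite hS; have := hge n.+1; case: (uS n) => ->; lra.
have step_big n : `|J (u n).1 (h n) (u n).2 (k n)| <=
    4 * `|J (u n.+1).1 (h n.+1) (u n.+1).2 (k n.+1)|.
  have [ua ub] := usub n.
  have := Jadd (u n).1 (h n.+1) (u n).2 (k n.+1) (hge _) (kge _) ua.
  rewrite -addrA -hS -kS => /(_ ub) E.
  have -> : u n.+1 = step n (u n) by [].
  move: (u n) E => p E; rewrite /step /=; do 3 (case: ifPn => [//|]).
  rewrite -!ltNge => n3 n2 n1; move: n1 n2 n3; rewrite E.
  set A := J _ _ _ _; set B := J _ _ _ _; set C := J _ _ _ _.
  set D := J _ _ _ _ => n1 n2 n3.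
  have := ler_normD (A + B) (C + D); have := ler_normD A B; have := ler_normD C D.
  lra.
have big n : `|J a0 h0 c0 k0| <= 4 ^+ n * `|J (u n).1 (h n) (u n).2 (k n)|.
  elim: n => [|n IH]; first by rewrite /= /h /k expr0 !divr1 mul1r.
  apply: (le_trans IH); rewrite exprSr -mulrA ler_wpM2l// exprn_ge0//.
have umon n m : (n <= m)%N ->
    (u n).1 <= (u m).1 /\ (u m).1 + h m <= (u n).1 + h n.
  move=> /subnKC <-; elim: (m - n)%N => [|i [IH1 IH2]]; first by rewrite addn0.
  rewrite addnS; move: IH2 (hge (n + i).+1); rewrite (hS (n + i)).
  by case: (uS (n + i)) => ->; lra.
have vmon n m : (n <= m)%N ->
    (u n).2 <= (u m).2 /\ (u m).2 + k m <= (u n).2 + k n.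
  move=> /subnKC <-; elim: (m - n)%N => [|i [IH1 IH2]]; first by rewrite addn0.
  rewrite addnS; move: IH2 (kge (n + i).+1); rewrite (kS (n + i)).
  by case: (vS (n + i)) => ->; lra.
have sup_in (w l : nat -> R) : (forall n, 0 <= l n) ->
    (forall n m, (n <= m)%N -> w n <= w m /\ w m + l m <= w n + l n) ->
    forall n, w n <= sup (range w) <= w n + l n.
  move=> l0 mon n.
  have ub m : w m <= w n + l n.
    have [A1 A2] := mon n (maxn n m) (leq_maxl _ _).
    have [B1 B2] := mon m (maxn n m) (leq_maxr _ _).
    have := l0 (maxn n m); lra.
  apply/andP; split.
    by apply: ub_le_sup; [exists (w n + l n) => _ [m _ <-] | exists n].
  by apply: ge_sup; [exists (w 0), 0%N | move=> _ [m _ <-]].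
pose x := sup (range (fun n => (u n).1)); pose y := sup (range (fun n => (u n).2)).
have xin : forall n, (u n).1 <= x <= (u n).1 + h n by exact: sup_in.
have yin : forall n, (u n).2 <= y <= (u n).2 + k n by exact: sup_in.
apply/eqP; rewrite -normr_le0; apply/ler_addgt0Pl => e e0; rewrite addr0.
have S0 : 0 <= (h0 + k0) ^+ 2 by rewrite sqr_ge0.
have xin0 : a0 <= x <= a0 + h0 by have := xin 0; rewrite /= /h expr0 divr1.
(* The summand 1 keeps the denominator positive when the rectangle degenerates to a point. *)
have e'0 : 0 < e / ((h0 + k0) ^+ 2 + 1) by rewrite divr_gt0//; lra.
have [d d0 dJ] := Jsmall x y _ xin0 e'0.
have [n /(_ n (leqnn n)) nd] := divr_exp2_small (h0 + k0) d d0.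
have [un1 un2] := usub n.
have hk : h n < d /\ k n < d.
  by move: nd; rewrite mulrDl -/(h n) -/(k n); have := hge n; have := kge n; lra.
have := dJ _ _ _ _ un1 un2 (xin n) (yin n) hk.1 hk.2.
have -> : (h n + k n) ^+ 2 = (h0 + k0) ^+ 2 / 4 ^+ n.
  by rewrite /h /k -mulrDl expr_div_n -!exprM mulnC exprM; congr (_ / _ ^+ _); ring.
move=> le; apply: (le_trans (big n)).
apply: (@le_trans _ _ (4 ^+ n * (e / ((h0 + k0) ^+ 2 + 1) * ((h0 + k0) ^+ 2 / 4 ^+ n)))).
  by rewrite ler_wpM2l// exprn_ge0.
have p4 : (4 : R) ^+ n != 0 by rewrite expf_neq0.
have -> : 4 ^+ n * (e / ((h0 + k0) ^+ 2 + 1) * ((h0 + k0) ^+ 2 / 4 ^+ n)) =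
   e * ((h0 + k0) ^+ 2 / ((h0 + k0) ^+ 2 + 1)).
  by field; rewrite p4 andbT; apply: lt0r_neq0; lra.
rewrite -[leRHS]mulr1 ler_pM2l// ler_pdivrMr; lra.
Qed.

End bisection.

(** * Complex derivatives *)

Section complex_derivative.
Context {R : realType}.
Implicit Types (F G H : R[i] -> R[i]) (w l z : R[i]) (x y : R).

Lemma normc_sqr z : normc z ^+ 2 = Re z ^+ 2 + Im z ^+ 2.
Proof. by case: z => x y /=; rewrite sqr_sqrtr// addr_ge0// sqr_ge0. Qed.

Lemma normc_ge0 z : 0 <= normc z.
Proof. by case: z => x y; exact: sqrtr_ge0. Qed.

Lemma ler_Re_normc z : `|Re z| <= normc z.
Proof.
rewrite -(@ler_pXn2r _ 2)// ?nnegrE ?normc_ge0// normc_sqr real_normK ?num_real//.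
by rewrite lerDl sqr_ge0.
Qed.

Lemma ler_Im_normc z : `|Im z| <= normc z.
Proof.
rewrite -(@ler_pXn2r _ 2)// ?nnegrE ?normc_ge0// normc_sqr real_normK ?num_real//.
by rewrite lerDr sqr_ge0.
Qed.

Lemma normc_le_ReIm z : normc z <= `|Re z| + `|Im z|.
Proof.
rewrite -(@ler_pXn2r _ 2)// ?nnegrE ?normc_ge0 ?addr_ge0// normc_sqr.
rewrite sqrrD !real_normK ?num_real// -addrA [_ *+ 2 + _]addrC addrA lerDl.
by rewrite mulrn_wge0// mulr_ge0.
Qed.

Lemma normcB z w : normc (z - w) = normc (w - z).
Proof. by rewrite -normcN opprB. Qed.

Lemma normc_triangle z w : normc z - normc w <= normc (z - w).
Proof. by rewrite lerBlDr -{1}(subrK w z); exact: le_normcD. Qed.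

(** Without a quotient and with real radii, the remainders in the product and chain rules are
    compared in R, and u = 0 is no exception. *)
Definition cdiff F w l := forall e : R, 0 < e -> exists2 d : R, 0 < d &
  forall u, normc u < d -> normc (F (w + u) - F w - l * u) <= e * normc u.

Lemma cdiff_lip F w l : cdiff F w l -> exists2 d : R, 0 < d &
  forall u, normc u < d -> normc (F (w + u) - F w) <= (normc l + 1) * normc u.
Proof.
move=> /(_ 1 ltr01)[d d0 dF]; exists d => // u /dF; rewrite mul1r => ub.
have := normc_triangle (F (w + u) - F w) (l * u).
rewrite normcM mulrDl mul1r; lra.
Qed.

Lemma cdiff_cst k w : cdiff (fun=> k) w 0.
Proof.
move=> e e0; exists 1 => // u _.
by rewrite subrr mul0r subrr normc0 mulr_ge0 ?normc_ge0// ltW.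
Qed.

Lemma cdiff_id w : cdiff id w 1.
Proof.
move=> e e0; exists 1 => // u _.
have -> : id (w + u) - id w - 1 * u = 0 by rewrite /=; ring.
by rewrite normc0 mulr_ge0 ?normc_ge0// ltW.
Qed.

Lemma cdiffD F G w l k : cdiff F w l -> cdiff G w k ->
  cdiff (fun u => F u + G u) w (l + k).
Proof.
move=> dF dG e e0; have e2 : 0 < e / 2 by rewrite divr_gt0.
have [d1 d10 h1] := dF _ e2; have [d2 d20 h2] := dG _ e2.
exists (Num.min d1 d2); first by rewrite lt_min d10.
move=> u; rewrite lt_min => /andP[/h1 u1 /h2 u2].
have -> : F (w + u) + G (w + u) - (F w + G w) - (l + k) * u =
  (F (w + u) - F w - l * u) + (G (w + u) - G w - k * u) by ring.
apply: (le_trans (le_normcD _ _)); lra.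
Qed.

Lemma cdiffM F G w l k : cdiff F w l -> cdiff G w k ->
  cdiff (fun u => F u * G u) w (l * G w + F w * k).
Proof.
move=> dF dG e e0; have [d3 d30 h3] := cdiff_lip _ _ _ dF.
(* [M] collects the factors of the three error terms: the two remainders and the product of the
   increments. *)
pose M := normc (G w) + normc (F w) + (normc l + 1) * (normc k + 1) + 1.
have lk0 : 0 <= (normc l + 1) * (normc k + 1).
  by rewrite mulr_ge0// addr_ge0// normc_ge0.
have M0 : 0 < M by rewrite /M; have := normc_ge0 (G w); have := normc_ge0 (F w); lra.
have eM : 0 < e / M by rewrite divr_gt0.
have [d1 d10 h1] := dF _ eM; have [d2 d20 h2] := dG _ eM.
have [d4 d40 h4] := cdiff_lip _ _ _ dG.
exists (Num.min (Num.min d1 d2) (Num.min (Num.min d3 d4) (e / M))).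
  by rewrite !lt_min d10 d20 d30 d40 eM.
move=> u; rewrite !lt_min => /andP[/andP[/h1 u1 /h2 u2] /andP[/andP[/h3 u3 /h4 u4] u5]].
have -> : F (w + u) * G (w + u) - F w * G w - (l * G w + F w * k) * u =
  (F (w + u) - F w - l * u) * G w + F w * (G (w + u) - G w - k * u) +
  (F (w + u) - F w) * (G (w + u) - G w) by ring.
apply: (le_trans (le_normcD _ _)); rewrite normcM.
apply: (@le_trans _ _ (e / M * normc u * normc (G w) + normc (F w) * (e / M * normc u) +
   (normc l + 1) * normc u * ((normc k + 1) * normc u))).
  apply: lerD.
    apply: (le_trans (le_normcD _ _)); rewrite !normcM.
    by apply: lerD; [apply: ler_wpM2r | apply: ler_wpM2l]; rewrite ?normc_ge0.
  by apply: ler_pM; rewrite ?normc_ge0.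
have : (normc l + 1) * (normc k + 1) * normc u * normc u <=
       (normc l + 1) * (normc k + 1) * normc u * (e / M).
  by rewrite ler_wpM2l ?mulr_ge0 ?normc_ge0 ?addr_ge0 ?normc_ge0// ltW.
have -> : e * normc u = e / M * normc u * M.
  by field; exact: lt0r_neq0.
have : 0 <= e / M * normc u by rewrite mulr_ge0 ?normc_ge0// ltW.
rewrite /M; nra.
Qed.

Lemma cdiff_comp F G w l k : cdiff G w k -> cdiff F (G w) l ->
  cdiff (F \o G) w (l * k).
Proof.
move=> dG dF e e0; have [d1 d10 h1] := cdiff_lip _ _ _ dG.
have k1 : 0 < normc k + 1 by have := normc_ge0 k; lra.
have l1 : 0 < normc l + 1 by have := normc_ge0 l; lra.
have e1 : 0 < e / 2 / (normc k + 1) by rewrite !divr_gt0.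
have e2 : 0 < e / 2 / (normc l + 1) by rewrite !divr_gt0.
have [d2 d20 h2] := dF _ e1; have [d3 d30 h3] := dG _ e2.
exists (Num.min (Num.min d1 d3) (d2 / (normc k + 1))).
  by rewrite !lt_min d10 d30 divr_gt0.
move=> u; rewrite !lt_min ltr_pdivlMr// => /andP[/andP[/h1 u1 /h3 u3] ud].
have := h2 (G (w + u) - G w); rewrite [G w + _]addrC subrK => /(_ _) u2.
have {}u2 := u2 (le_lt_trans u1 _).
have -> : (F \o G) (w + u) - (F \o G) w - l * k * u =
  (F (G (w + u)) - F (G w) - l * (G (w + u) - G w)) + l * (G (w + u) - G w - k * u).
  by rewrite /=; ring.
apply: (le_trans (le_normcD _ _)); rewrite normcM.
have -> : e * normc u = e / 2 / (normc k + 1) * ((normc k + 1) * normc u) +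
   (normc l + 1) * (e / 2 / (normc l + 1) * normc u).
  by field; rewrite !lt0r_neq0.
apply: lerD.
  apply: (le_trans (u2 _)); first by rewrite mulrC.
  by rewrite ler_wpM2l// ltW.
apply: ler_pM; rewrite ?normc_ge0//; lra.
Qed.

Lemma cdiff_Re_continuous H x y l : cdiff H (x +i* y) l ->
  [/\ {for x, continuous (fun t => Re (H (t +i* y)))},
      {for x, continuous (fun t => Im (H (t +i* y)))} &
      {for y, continuous (fun t => Re (H (x +i* t)))}].
Proof.
move=> /cdiff_lip[d d0 dH].
have key (s : R -> R[i]) (p : R[i] -> R) x0 : s x0 = x +i* y ->
    (forall t, normc (s t - s x0) <= `|t - x0|) ->
    (forall z w, `|p z - p w| <= normc (z - w)) ->
    {for x0, continuous (fun t => p (H (s t)))}.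
  move=> sE sl pl; apply/cvgrPdist_le => e e0.
  have l1 : 0 < normc l + 1 by have := normc_ge0 l; lra.
  near=> t; apply: (le_trans (pl _ _)); rewrite normcB sE.
  have tx : `|t - x0| < Num.min d (e / (normc l + 1)).
    rewrite distrC; near: t; apply: cvgr_dist_lt => //.
    by rewrite lt_min d0 divr_gt0.
  move: tx; rewrite lt_min => /andP[td te].
  have su : normc (s t - s x0) < d by exact: le_lt_trans (sl t) td.
  have := dH _ su; rewrite -sE [s x0 + _]addrC subrK => /le_trans; apply.
  rewrite mulrC -ler_pdivlMr//; exact: le_trans (sl t) (ltW te).
have hs1 t t' : normc ((t +i* y) - (t' +i* y)) <= `|t - t'|.
  by apply: (le_trans (normc_le_ReIm _)); rewrite /= subrr normr0 addr0.
have hs2 t t' : normc ((x +i* t) - (x +i* t')) <= `|t - t'|.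
  by apply: (le_trans (normc_le_ReIm _)); rewrite /= subrr normr0 add0r.
have hR (z w : R[i]) : `|Re z - Re w| <= normc (z - w).
  by apply: (le_trans _ (ler_Re_normc _)); case: z w => ? ? [? ?].
have hI (z w : R[i]) : `|Im z - Im w| <= normc (z - w).
  by apply: (le_trans _ (ler_Im_normc _)); case: z w => ? ? [? ?].
by split; [exact: (key (fun t => t +i* y))|exact: (key (fun t => t +i* y))
  |exact: (key (fun t => x +i* t))].
Unshelve. all: by end_near. Qed.

End complex_derivative.

(** * The complex exponential *)

Section complex_exponential.
Context {R : realType}.
Implicit Types (z w u : R[i]).

Definition cexp z : R[i] := (expR (Re z) * cos (Im z)) +i* (expR (Re z) * sin (Im z)).

Lemma cexpD z w : cexp (z + w) = cexp z * cexp w.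
Proof.
case: z w => [a b] [c d]; rewrite /cexp /= expRD cosD sinD.
by apply/eqP; rewrite eq_complex /=; apply/andP; split; apply/eqP; ring.
Qed.

Lemma normc_cexp z : normc (cexp z) = expR (Re z).
Proof.
rewrite /= !exprMn -mulrDr cos2Dsin2 mulr1 sqrtr_sqr ger0_norm// expR_ge0.
Qed.

Lemma cexp0 : cexp 0 = 1.
Proof. by rewrite /cexp /= expR0 cos0 sin0 mulr1 mulr0. Qed.

Let real_diff0 (f : R -> R) (a : R) : is_derive (0 : R) 1 f a ->
  forall e : R, 0 < e -> exists2 d : R, 0 < d &
    forall x, `|x| < d -> `|f x - f 0 - a * x| <= e * `|x|.
Proof.
move=> df e e0.
have H : (fun h => h^-1 *: ((f \o shift 0) (h *: 1) - f 0)) @ 0^' --> a.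
  by rewrite -(@derive_val _ _ _ _ _ _ _ df); exact: ex_derive.
move/cvgrPdist_le : H => /(_ e e0); rewrite near_withinE => /nbhs_ballP[d /= d0 dH].
exists d => // x xd; have [->|x0] := eqVneq x 0.
  by rewrite mulr0 !subrr normr0 mulr0.
have := dH x; rewrite /ball/= sub0r normrN => /(_ xd x0).
rewrite addr0 /GRing.scale/= mulr1 => le.
have -> : f x - f 0 - a * x = - (a - x^-1 * (f x - f 0)) * x by field.
by rewrite normrM normrN ler_wpM2r.
Qed.

(** [A], [c], [s] stand for exp x, cos y, sin y and [N] for |x + iy|. Quadratic errors such as (A -
    1) y are absorbed by N < d; all errors add up to at most 7 d N. *)
Let exp_bound (A c s x y N d e : R) : d <= 8^-1 -> 8 * d <= e -> 0 < d ->
  `|A - 1 - x| <= d * `|x| -> `|c - 1| <= d * `|y| -> `|s - y| <= d * `|y| ->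
  `|x| <= N -> `|y| <= N -> N < d -> `|A * c - 1 - x| + `|A * s - y| <= e * N.
Proof.
move=> d8 de d0 hA hc hs xN yN Nd.
have N0 : 0 <= N by exact: le_trans xN.
have dN (r : R) : `|r| <= N -> d * `|r| <= d * N by move=> rN; rewrite ler_wpM2l// ltW.
have dx := dN _ xN; have dy := dN _ yN.
have A1 : `|A - 1| <= 2 * N.
  have -> : A - 1 = (A - 1 - x) + x by ring.
  by apply: (le_trans (ler_normD _ _)); nra.
have A2 : `|A| <= 2.
  by have := ler_normD (A - 1) 1; rewrite subrK normr1; lra.
have -> : A * c - 1 - x = A * (c - 1) + (A - 1 - x) by ring.
have -> : A * s - y = A * (s - y) + (A - 1) * y by ring.
have := ler_normD (A * (c - 1)) (A - 1 - x); have := ler_normD (A * (s - y)) ((A - 1) * y).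
rewrite !normrM.
have : `|A| * `|c - 1| <= 2 * (d * N) by apply: ler_pM => //; exact: le_trans dy.
have : `|A| * `|s - y| <= 2 * (d * N) by apply: ler_pM => //; exact: le_trans dy.
have : `|A - 1| * `|y| <= 2 * N * N by apply: ler_pM.
nra.
Qed.

Lemma cdiff_cexp z : cdiff cexp z (cexp z).
Proof.
(* The functional equation moves the derivative at 0 to any point. *)
suff d0 : cdiff cexp 0 1.
  have d1 := cdiff_comp cexp (fun w => w + - z) z 1 (1 + 0).
  have : cdiff (fun w => cexp z * cexp (w + - z)) z (0 * cexp (z + - z) + cexp z * (1 * (1 + 0))).
    apply: cdiffM; first exact: cdiff_cst.
    apply: d1; first by apply: cdiffD; [exact: cdiff_id|exact: cdiff_cst].
    by rewrite subrr.
  rewrite addr0 mul0r add0r !mulr1.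
  by under eq_fun do rewrite -cexpD addrC subrK.
move=> e e0; pose d := Num.min e 1 / 8.
have d0 : 0 < d by rewrite divr_gt0// lt_min e0 ltr01.
have d8 : d <= 8^-1 by rewrite ler_pdivrMr// mulVf// ge_min lexx orbT.
have de : 8 * d <= e by rewrite /d mulrC divfK// ge_min lexx.
have [d1 d10 h1] := real_diff0 expR _ (is_derive_expR 0) _ d0.
have [d2 d20 h2] := real_diff0 cos _ (is_derive_cos 0) _ d0.
have [d3 d30 h3] := real_diff0 sin _ (is_derive_sin 0) _ d0.
exists (Num.min (Num.min d1 d2) (Num.min d3 d)).
  by rewrite !lt_min d10 d20 d30 d0.
move=> u; rewrite !lt_min => /andP[/andP[u1 u2] /andP[u3 u4]].
have ru := ler_Re_normc u; have iu := ler_Im_normc u.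
have := h1 _ (le_lt_trans ru u1); have := h2 _ (le_lt_trans iu u2).
have := h3 _ (le_lt_trans iu u3).
rewrite expR0 cos0 sin0 oppr0 !mul1r mul0r !subr0 => hs hc hA.
have := exp_bound _ _ _ _ _ _ _ _ d8 de d0 hA hc hs ru iu u4.
apply: le_trans; rewrite add0r cexp0; apply: (le_trans (normc_le_ReIm _)).
case: u {u1 u2 u3 u4 ru iu hs hc hA} => x y /=.
by rewrite !(mul0r, mul1r, subr0, addr0, add0r) lexx.
Qed.

Lemma cexp_period x y : cexp (x +i* (y + 2 * pi)) = cexp (x +i* y) :> R[i].
Proof.
rewrite /cexp /=; have -> : 2 * pi = pi *+ 2 :> R by rewrite mulr_natl.
by rewrite cosD2pi sinD2pi.
Qed.

End complex_exponential.

(** * Goursat's lemma *)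

Section goursat.
Context {R : realType}.
Implicit Types (H F : R[i] -> R[i]).

(** The left side is the imaginary part of the contour integral of H around the rectangle, the half
    that contains the means of Re H over vertical sides. H is taken on a whole vertical strip, so
    ordinates need no control. *)
Lemma goursat H (a b c d : R) : a <= b -> c <= d ->
  (forall x y, a <= x <= b -> exists l, cdiff H (x +i* y) l) ->
  itg (fun x => Im (H (x +i* c)) - Im (H (x +i* d))) a b +
  itg (fun y => Re (H (b +i* y)) - Re (H (a +i* y))) c d = 0.
Proof.
move=> ab cd dH.
pose P (x y : R) : R := Im (H (x +i* y)); pose Q (x y : R) : R := Re (H (x +i* y)).
have cP y x : a <= x <= b -> {for x, continuous (fun t => P t y)}.
  by move=> xab; have [l hl] := dH x y xab; have [] := cdiff_Re_continuous _ _ _ _ hl.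
have cQ x y : a <= x <= b -> {for y, continuous (fun t => Q x t)}.
  by move=> xab; have [l hl] := dH x y xab; have [] := cdiff_Re_continuous _ _ _ _ hl.
have cPP y1 y2 x1 x2 : a <= x1 -> x2 <= b -> ctn (fun t => P t y1 - P t y2) x1 x2.
  move=> ax xb t /andP[tx1 tx2]; have tab : a <= t <= b by lra.
  by apply: continuousB; exact: cP.
have cQQ x1 x2 y1 y2 : a <= x1 <= b -> a <= x2 <= b -> ctn (fun t => Q x1 t - Q x2 t) y1 y2.
  by move=> h1 h2 t _; apply: continuousB; exact: cQ.
pose J (a h c k : R) : R := itg (fun x => P x c - P x (c + k)) a (a + h) +
  itg (fun y => Q (a + h) y - Q a y) c (c + k).
have -> : itg (fun x => P x c - P x d) a b + itg (fun y => Q b y - Q a y) c d =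
   J a (b - a) c (d - c) by rewrite /J !subrKC.
apply: bisection_eq0; rewrite ?subr_ge0//.
- move=> x h y k h0 k0 ax xb0. have xb : x + h + h <= b by lra.
  rewrite /J !addrA.
  rewrite (itg_split _ x (x + h + h) (x + h)); [|lra|apply: cPP; lra].
  rewrite (itg_split _ y (y + k + k) (y + k)); [|lra|apply: cQQ; lra].
  have EP x1 x2 : a <= x1 -> x2 <= b -> itg (fun t => P t y - P t (y + k + k)) x1 x2 =
      itg (fun t => P t y - P t (y + k)) x1 x2 + itg (fun t => P t (y + k) - P t (y + k + k)) x1 x2.
    move=> h1 h2; rewrite -itgD; [|exact: cPP|exact: cPP].
    by congr itg; apply/funext => t; ring.
  have EQ y1 y2 : itg (fun t => Q (x + h + h) t - Q x t) y1 y2 =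
      itg (fun t => Q (x + h) t - Q x t) y1 y2 + itg (fun t => Q (x + h + h) t - Q (x + h) t) y1 y2.
    rewrite -itgD; [|apply: cQQ; lra|apply: cQQ; lra].
    by congr itg; apply/funext => t; ring.
  rewrite !EP ?EQ; [ring|lra|lra|lra|lra].
- move=> x y e xab0 e0; have xab : a <= x <= b by lra.
  have [l hl] := dH x y xab.
  have e2 : 0 < e / 2 by rewrite divr_gt0.
  have [r r0 hr] := hl _ e2; exists (r / 2); first by rewrite divr_gt0.
  move=> x1 h y1 k ax1 xb10; have xb1 : x1 + h <= b by lra.
  move=> xx1 yy1 hr2 kr2.
  have near x2 y2 : x1 <= x2 <= x1 + h -> y1 <= y2 <= y1 + k ->
      `|Q x2 y2 - Q x y - (Re l * (x2 - x) - Im l * (y2 - y))| <= e / 2 * (h + k) /\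
      `|P x2 y2 - P x y - (Re l * (y2 - y) + Im l * (x2 - x))| <= e / 2 * (h + k).
    move=> hx2 hy2; pose u : R[i] := (x2 - x) +i* (y2 - y).
    have un : normc u <= h + k.
      apply: (le_trans (normc_le_ReIm _)); rewrite /u /=; apply: lerD; rewrite ler_norml; lra.
    have ur : normc u < r by apply: (le_lt_trans un); lra.
    have E : (x +i* y) + u = x2 +i* y2.
      by apply/eqP; rewrite eq_complex /=; apply/andP; split; apply/eqP; ring.
    have := hr _ ur; rewrite E => le.
    have {}le := le_trans le (ler_wpM2l (ltW e2) un).
    have leR := le_trans (ler_Re_normc _) le; have leI := le_trans (ler_Im_normc _) le.
    split.
      apply: le_trans leR; rewrite /Q {le leI hl hr}.
      by case: (H (x2 +i* y2)) (H (x +i* y)) l => ? ? [? ?] [? ?] /=.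
    apply: le_trans leI; rewrite /P {le leR hl hr}.
    by case: (H (x2 +i* y2)) (H (x +i* y)) l => ? ? [? ?] [? ?] /=.
  have h0 : 0 <= h by lra. have k0 : 0 <= k by lra.
  (* The linear part of H at the limit point contributes - Re l * k * h on the horizontal sides and
     Re l * h * k on the vertical ones; only the remainders survive. *)
  have b1 : `|itg (fun t => P t y1 - P t (y1 + k)) x1 (x1 + h) - (- (Re l * k)) * (x1 + h - x1)|
       <= e * (h + k) * (x1 + h - x1).
    apply: itg_bound; [lra|apply: cPP; lra|move=> t ht].
    have [_ n1] := near t y1 ht ltac:(lra); have [_ n2] := near t (y1 + k) ht ltac:(lra).
    have := ler_normB (P t y1 - P x y - (Re l * (y1 - y) + Im l * (t - x)))
                      (P t (y1 + k) - P x y - (Re l * (y1 + k - y) + Im l * (t - x))).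
    set X := (X in `|X| <= _ -> _); set Y := (Y in _ -> `|Y| <= _).
    have -> : X = Y by rewrite /X /Y; ring.
    lra.
  have b2 : `|itg (fun t => Q (x1 + h) t - Q x1 t) y1 (y1 + k) - (Re l * h) * (y1 + k - y1)|
       <= e * (h + k) * (y1 + k - y1).
    apply: itg_bound; [lra|apply: cQQ; lra|move=> t ht].
    have [n1 _] := near (x1 + h) t ltac:(lra) ht; have [n2 _] := near x1 t ltac:(lra) ht.
    have := ler_normB (Q (x1 + h) t - Q x y - (Re l * (x1 + h - x) - Im l * (t - y)))
                      (Q x1 t - Q x y - (Re l * (x1 - x) - Im l * (t - y))).
    set X := (X in `|X| <= _ -> _); set Y := (Y in _ -> `|Y| <= _).
    have -> : X = Y by rewrite /X /Y; ring.
    lra.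
  rewrite /J; set A := itg _ _ _ in b1 *; set B := itg _ _ _ in b2 *.
  have := ler_normD (A - (- (Re l * k)) * (x1 + h - x1)) (B - (Re l * h) * (y1 + k - y1)).
  have -> : A - (- (Re l * k)) * (x1 + h - x1) + (B - (Re l * h) * (y1 + k - y1)) = A + B by ring.
  nra.
Qed.

End goursat.

(** * Strict local maxima of the modulus *)

Section maximum_modulus.
Context {R : realType}.

(* In the coordinate z = exp (x + iy), Goursat's lemma on a rectangle of height
   2 pi says that the mean of F over the circle of radius exp x does not depend
   on x; it tends to F 0 at -oo. *)
Lemma no_strict_local_max (F : R[i] -> R[i]) (r c : R) : 0 < r -> 0 < c ->
  (forall w, normc w < r -> exists l, cdiff F w l) -> F 0 != 0 ->
  ~ (forall w, normc w < r -> normc (F w) <= normc (F 0) * (1 - c * normc w ^+ 2)).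
Proof.
move=> r0 c0 dF F0 maxF.
have nF0 : 0 < normc (F 0).
  by rewrite lt_neqAle normc_ge0 andbT; apply: contra_neq F0 => /esym/eq0_normc.
pose G w := (F 0)^-1 * F w.
have dG w : normc w < r -> exists l, cdiff G w l.
  move=> /dF[l hl]; exists (0 * F w + (F 0)^-1 * l).
  by apply: cdiffM => //; exact: cdiff_cst.
have nG w : normc w < r -> normc (G w) <= 1 - c * normc w ^+ 2.
  move=> /maxF le; rewrite /G normcM normcV// mulrC ler_pdivrMr//.
  by rewrite mulrC.
have nG1 w : normc w < r -> `|Re (G w)| <= 1.
  move=> /nG; have := ler_Re_normc (G w); have : 0 <= c * normc w ^+ 2.
    by rewrite mulr_ge0 ?sqr_ge0// ltW.
  lra.
have [l hl] := dG 0 ltac:(by rewrite normc0).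
have [d d0 hd] := cdiff_lip _ _ _ hl.
(* [eta] is half the loss c rho^2 on the circle of radius rho; the radius s below is so small that
   Re G drops by at most eta from G 0 = 1 on its circle. *)
pose rho := r / 2; pose eta := c * rho ^+ 2 / 2.
have rho0 : 0 < rho by rewrite divr_gt0.
have eta0 : 0 < eta by rewrite divr_gt0// mulr_gt0// exprn_gt0.
have l1 : 0 < normc l + 1 by have := normc_ge0 l; lra.
pose s := Num.min (d / 2) (Num.min rho (eta / (normc l + 1))).
have s0 : 0 < s.
  by rewrite /s lt_min lt_min; apply/and3P; split => //; apply: divr_gt0.
have sd : s < d by rewrite gt_min; apply/orP; left; lra.
have srho : s <= rho by rewrite /s !ge_min lexx orbT.
have seta : (normc l + 1) * s <= eta.
  by rewrite mulrC -ler_pdivlMr// /s !ge_min lexx !orbT.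
have rhor : rho < r by rewrite /rho; lra.
pose H := G \o cexp.
have ncexp x y : normc (cexp (x +i* y)) = expR x :> R by rewrite normc_cexp.
have dH x y : ln s <= x <= ln rho -> exists l, cdiff H (x +i* y) l.
  move=> /andP[_ xrho]; have /dG[k hk] : normc (cexp (x +i* y)) < r.
    by rewrite ncexp (le_lt_trans _ rhor)// -(lnK rho0) ler_expR.
  by exists (k * cexp (x +i* y)); apply: cdiff_comp => //; exact: cdiff_cexp.
have pi0 := pi_gt0 R.
have sr : ln s <= ln rho by rewrite ler_ln // posrE.
have p2 : 0 <= 0 + 2 * pi :> R by rewrite lerDl mulr_ge0// ltW.
have := goursat H (ln s) (ln rho) 0 (0 + 2 * pi) sr p2 dH.
have -> : itg (fun x => Im (H (x +i* 0)) - Im (H (x +i* (0 + 2 * pi)))) (ln s) (ln rho) = 0.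
  under eq_fun do rewrite /H/= cexp_period subrr.
  have := @itg_bound R (fun=> 0) (ln s) (ln rho) 0 0 sr.
  rewrite !mul0r => E; rewrite -[LHS]subr0; apply/eqP; rewrite -normr_le0.
  by apply: E => x _; [exact: cst_continuous | rewrite subrr normr0].
rewrite add0r; set I := itg _ _ _ => I0.
have cI : ctn (fun y => Re (H (ln rho +i* y)) - Re (H (ln s +i* y))) 0 (0 + 2 * pi).
  move=> y _.
  have [k1 h1] := dH (ln rho) y ltac:(by rewrite lexx sr).
  have [k2 h2] := dH (ln s) y ltac:(by rewrite lexx sr).
  apply: continuousB; first by have [] := cdiff_Re_continuous _ _ _ _ h1.
  by have [] := cdiff_Re_continuous _ _ _ _ h2.
(* The difference of the real parts on the two circles lies in [- 2, - eta], the interval with this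
   centre and radius, so its integral cannot be 0. *)
have := itg_bound _ _ _ (- (2 + eta) / 2) ((2 - eta) / 2) p2 cI.
rewrite -/I I0 => bnd.
suff : `|0 - - (2 + eta) / 2 * (0 + 2 * pi - 0)| <= (2 - eta) / 2 * (0 + 2 * pi - 0).
  have -> : 0 - - (2 + eta) / 2 * (0 + 2 * pi - 0) = (2 + eta) * pi by field.
  have -> : (2 - eta) / 2 * (0 + 2 * pi - 0) = (2 - eta) * pi by field.
  by rewrite ler_norml => /andP[_]; rewrite ler_pM2r//; lra.
apply: bnd => y _.
have e1 : normc (cexp (ln rho +i* y)) = rho by rewrite ncexp lnK.
have e2 : normc (cexp (ln s +i* y)) = s by rewrite ncexp lnK.
have := nG (cexp (ln rho +i* y)); rewrite e1 => /(_ rhor) g1.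
have := nG1 (cexp (ln rho +i* y)); rewrite e1 => /(_ rhor) g2.
have := nG1 (cexp (ln s +i* y)); rewrite e2 => /(_ (le_lt_trans srho rhor)) g3.
have g1' := le_trans (ler_Re_normc _) g1.
have := hd (cexp (ln s +i* y)); rewrite e2 add0r => /(_ sd) g4.
have {}g4 := le_trans (le_trans (ler_Re_normc _) g4) seta.
have G0 : G 0 = 1 by rewrite /G mulVf.
rewrite G0 in g4; rewrite /H /= -/(cexp _).
have {}g4 : `|Re (G (cexp (ln s +i* y))) - 1| <= eta.
  by move: g4; case: (G _).
have ee : c * rho ^+ 2 = 2 * eta by rewrite /eta; field.
by move: g1' g2 g3 g4; rewrite ee !ler_norml => /andP[? ?] /andP[? ?] /andP[? ?] /andP[? ?];
  apply/andP; split; lra.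
Qed.

End maximum_modulus.

(** * Second order expansions in one complex variable *)

Section jets.
Context {R : realType}.
Implicit Types (psi r : R[i] -> R) (w a b : R[i]) (p c e d : R).

Definition osqr r := forall e, 0 < e -> exists2 d, 0 < d &
  forall w, normc w < d -> `|r w| <= e * normc w ^+ 2.

Lemma osqr0 : osqr (fun=> 0).
Proof. by move=> e e0; exists 1 => // w _; rewrite normr0 mulr_ge0 ?sqr_ge0// ltW. Qed.

Lemma osqrD r1 r2 : osqr r1 -> osqr r2 -> osqr (fun w => r1 w + r2 w).
Proof.
move=> h1 h2 e e0; have e2 : 0 < e / 2 by rewrite divr_gt0.
have [d1 d10 {}h1] := h1 _ e2; have [d2 d20 {}h2] := h2 _ e2.
exists (Num.min d1 d2); first by rewrite lt_min d10.
move=> w; rewrite lt_min => /andP[/h1 w1 /h2 w2].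
by apply: (le_trans (ler_normD _ _)); lra.
Qed.

Lemma osqrM r g K d : 0 < d -> (forall w, normc w < d -> `|g w| <= K) -> osqr r ->
  osqr (fun w => r w * g w).
Proof.
move=> d0 gK hr e e0.
have K1 : 0 < `|K| + 1 by have := normr_ge0 K; lra.
have eK : 0 < e / (`|K| + 1) by rewrite divr_gt0.
have [d1 d10 {}hr] := hr _ eK.
exists (Num.min d d1); first by rewrite lt_min d0.
move=> w; rewrite lt_min => /andP[/gK w1 /hr w2]; rewrite normrM.
apply: (@le_trans _ _ (e / (`|K| + 1) * normc w ^+ 2 * (`|K| + 1))).
  by apply: ler_pM => //; have := ler_norm K; lra.
by rewrite mulrAC divfK// lt0r_neq0.
Qed.

Lemma osqr_cubic r K : (forall w, normc w < 1 -> `|r w| <= K * normc w ^+ 3) -> osqr r.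
Proof.
move=> h e e0; have K1 : 0 < `|K| + 1 by have := normr_ge0 K; lra.
exists (Num.min 1 (e / (`|K| + 1))); first by rewrite lt_min ltr01 divr_gt0.
move=> w; rewrite lt_min ltr_pdivlMr// => /andP[/h w1 w2]; apply: (le_trans w1).
rewrite exprSr mulrA mulrAC ler_wpM2r ?sqr_ge0//.
have := ler_norm K; have := normc_ge0 w; nra.
Qed.

(** The general real quadratic polynomial on C, split into a harmonic part and the radial term,
    which carries the Laplacian. *)
Definition quad p a b c w := p + Re (a * w) + Re (b * w ^+ 2) + c * normc w ^+ 2.

(** The coefficient of w^2 is hidden because the rules for [p], [a] and [c] under products and
    inverses never involve it. *)
Definition jet psi p a c := exists b, osqr (fun w => psi w - quad p a b c w).

Lemma jet_eq psi psi' p p' a a' c c' : psi =1 psi' -> p = p' -> a = a' -> c = c' ->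
  jet psi p a c -> jet psi' p' a' c'.
Proof. by move=> /funext -> -> -> ->. Qed.

Lemma jet_quad p a b c : jet (quad p a b c) p a c.
Proof. by exists b; under eq_fun do rewrite subrr; exact: osqr0. Qed.

Lemma jetD psi1 psi2 p1 p2 a1 a2 c1 c2 : jet psi1 p1 a1 c1 -> jet psi2 p2 a2 c2 ->
  jet (fun w => psi1 w + psi2 w) (p1 + p2) (a1 + a2) (c1 + c2).
Proof.
move=> [b1 h1] [b2 h2]; exists (b1 + b2).
have -> : (fun w => psi1 w + psi2 w - quad (p1 + p2) (a1 + a2) (b1 + b2) (c1 + c2) w) =
  (fun w => (psi1 w - quad p1 a1 b1 c1 w) + (psi2 w - quad p2 a2 b2 c2 w)).
  by apply/funext => w; rewrite /quad !mulrDl !raddfD /=; ring.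
exact: osqrD.
Qed.

Lemma quad_bound p a b c : exists K, 0 <= K /\
  forall w, normc w < 1 -> `|quad p a b c w - p| <= K * normc w.
Proof.
exists (normc a + normc b + `|c|); split; first by rewrite !addr_ge0 ?normc_ge0.
move=> w w1; have w0 := normc_ge0 w.
have -> : quad p a b c w - p = Re (a * w) + Re (b * w ^+ 2) + c * normc w ^+ 2.
  by rewrite /quad; ring.
have h1 := ler_Re_normc (a * w); have h2 := ler_Re_normc (b * w ^+ 2).
move: h1 h2; rewrite expr2 !normcM => h1 h2.
have w2 : normc w * normc w <= normc w by rewrite ler_piMr// ltW.
have h3 : `|c * normc w ^+ 2| <= `|c| * normc w.
  by rewrite normrM ler_wpM2l// ger0_norm ?sqr_ge0// expr2.
have h4 : normc b * (normc w * normc w) <= normc b * normc w.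
  by rewrite ler_wpM2l ?normc_ge0.
have := ler_normD (Re (a * w) + Re (b * w ^+ 2)) (c * normc w ^+ 2).
have := ler_normD (Re (a * w)) (Re (b * w ^+ 2)).
rewrite !mulrDl; rewrite expr2; lra.
Qed.

Lemma jet_bound psi p a c : jet psi p a c -> forall e, 0 < e ->
  exists2 d, 0 < d & forall w, normc w < d -> `|psi w - p| <= e.
Proof.
move=> [b h] e e0; have [d d0 {}h] := h _ ltr01.
have [K [K0 hK]] := quad_bound p a b c.
exists (Num.min (Num.min d 1) (e / (K + 1))).
  by rewrite !lt_min d0 ltr01 divr_gt0//; lra.
move=> w; rewrite !lt_min ltr_pdivlMr; last by lra.
move=> /andP[/andP[/h w1 w3] w2]; have w0 := normc_ge0 w.
have := hK _ w3; rewrite mul1r in w1.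
have -> : psi w - p = psi w - quad p a b c w + (quad p a b c w - p) by ring.
have := ler_normD (psi w - quad p a b c w) (quad p a b c w - p).
have : normc w ^+ 2 <= normc w by rewrite expr2 ler_piMr// ltW.
nra.
Qed.

(** Re u Re v = (Re (u v) + Re (u conj v)) / 2 splits the product of the linear terms into its
    harmonic and radial parts; the other omitted terms are cubic. *)
Lemma quadM p1 a1 b1 c1 p2 a2 b2 c2 :
  osqr (fun w => quad p1 a1 b1 c1 w * quad p2 a2 b2 c2 w -
    quad (p1 * p2) (p1%:C * a2 + p2%:C * a1) (p1%:C * b2 + p2%:C * b1 + a1 * a2 * (2^-1)%:C)
      (p1 * c2 + p2 * c1 + Re (a1 * a2^*) / 2) w).
Proof.
pose l1 w := Re (a1 * w); pose l2 w := Re (a2 * w).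
pose q1 w := quad 0 0 b1 c1 w; pose q2 w := quad 0 0 b2 c2 w.
have -> : (fun w => quad p1 a1 b1 c1 w * quad p2 a2 b2 c2 w -
    quad (p1 * p2) (p1%:C * a2 + p2%:C * a1) (p1%:C * b2 + p2%:C * b1 + a1 * a2 * (2^-1)%:C)
      (p1 * c2 + p2 * c1 + Re (a1 * a2^*) / 2) w) =
  (fun w => l1 w * q2 w + q1 w * l2 w + q1 w * q2 w).
  apply/funext => w; rewrite /l1 /l2 /q1 /q2 /quad !normc_sqr {l1 l2 q1 q2}.
  case: a1 a2 b1 b2 w => [? ?] [? ?] [? ?] [? ?] [x y] /=.
  by rewrite expr2 /=; field.
have q_bnd b c w : `|quad 0 0 b c w| <= (normc b + `|c|) * normc w ^+ 2.
  rewrite /quad mul0r /= !add0r mulrDl; apply: (le_trans (ler_normD _ _)).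
  apply: lerD; last by rewrite normrM [X in _ * X]ger0_norm ?sqr_ge0.
  by apply: (le_trans (ler_Re_normc _)); rewrite expr2 !normcM -expr2.
have l_bnd a w : `|Re (a * w)| <= normc a * normc w.
  by apply: (le_trans (ler_Re_normc _)); rewrite normcM.
apply: (@osqr_cubic _ (normc a1 * (normc b2 + `|c2|) + (normc b1 + `|c1|) * normc a2 +
   (normc b1 + `|c1|) * (normc b2 + `|c2|))) => w w1.
have w0 := normc_ge0 w.
have prod_bnd (x y K L : R) i k : `|x| <= K * normc w ^+ i -> `|y| <= L * normc w ^+ k ->
    (3 <= i + k)%N -> 0 <= K -> 0 <= L -> `|x * y| <= K * L * normc w ^+ 3.
  move=> xK yL ik K0 L0; rewrite normrM; apply: (le_trans (ler_pM _ _ xK yL)) => //.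
  rewrite mulrACA -exprD ler_wpM2l ?mulr_ge0//.
  by rewrite ler_wiXn2l// ltW.
have K1 : 0 <= normc b1 + `|c1| by rewrite addr_ge0 ?normc_ge0.
have K2 : 0 <= normc b2 + `|c2| by rewrite addr_ge0 ?normc_ge0.
have hA := prod_bnd (l1 w) (q2 w) _ _ 1 2 (l_bnd a1 w) (q_bnd b2 c2 w) isT (normc_ge0 _) K2.
have hB := prod_bnd (q1 w) (l2 w) _ _ 2 1 (q_bnd b1 c1 w) (l_bnd a2 w) isT K1 (normc_ge0 _).
have hC := prod_bnd (q1 w) (q2 w) _ _ 2 2 (q_bnd b1 c1 w) (q_bnd b2 c2 w) isT K1 K2.
rewrite [leRHS]mulrDl [X in _ <= X + _]mulrDl.
have := ler_normD (l1 w * q2 w + q1 w * l2 w) (q1 w * q2 w).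
have := ler_normD (l1 w * q2 w) (q1 w * l2 w).
lra.
Qed.

Lemma jetM psi1 psi2 p1 p2 a1 a2 c1 c2 : jet psi1 p1 a1 c1 -> jet psi2 p2 a2 c2 ->
  jet (fun w => psi1 w * psi2 w) (p1 * p2) (p1%:C * a2 + p2%:C * a1)
    (p1 * c2 + p2 * c1 + Re (a1 * a2^*) / 2).
Proof.
move=> j1 j2; have [d2 d20 bd2] := jet_bound _ _ _ _ j2 _ ltr01.
case: j1 j2 => [b1 h1] [b2 h2].
exists (p1%:C * b2 + p2%:C * b1 + a1 * a2 * (2^-1)%:C).
have qj := jet_quad p1 a1 b1 c1.
have [d1 d10 bd1] := jet_bound _ _ _ _ qj _ ltr01.
have o1 : osqr (fun w => (psi1 w - quad p1 a1 b1 c1 w) * psi2 w).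
  apply: (osqrM _ _ (`|p2| + 1) d2 d20 _ h1) => w /bd2.
  by have := ler_normD (psi2 w - p2) p2; rewrite subrK; lra.
have o2 : osqr (fun w => (psi2 w - quad p2 a2 b2 c2 w) * quad p1 a1 b1 c1 w).
  apply: (osqrM _ _ (`|p1| + 1) d1 d10 _ h2) => w /bd1.
  by have := ler_normD (quad p1 a1 b1 c1 w - p1) p1; rewrite subrK; lra.
have := osqrD _ _ (osqrD _ _ o1 o2) (quadM p1 a1 b1 c1 p2 a2 b2 c2).
congr osqr; apply/funext => w; ring.
Qed.

Lemma jetZ psi p a c k : jet psi p a c -> jet (fun w => k * psi w) (k * p) (k%:C * a) (k * c).
Proof.
move=> j; have := jetM _ _ _ _ _ _ _ _ (jet_quad k 0 0 0) j.
apply: jet_eq => //; last 2 first.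
- by rewrite mulr0 addr0.
- by rewrite mulr0 mul0r /= mul0r !addr0.
by move=> w; rewrite /quad !mul0r /= !addr0.
Qed.

Lemma jetN psi p a c : jet psi p a c -> jet (fun w => - psi w) (- p) (- a) (- c).
Proof.
move=> j; have := jetZ _ _ _ _ (-1) j; apply: jet_eq; rewrite ?mulN1r//.
  by move=> w; rewrite mulN1r.
by rewrite rmorphN rmorph1 mulN1r.
Qed.

(** With Q the candidate expansion, psi Q - 1 = o (|w|^2) by the product rule, and the error of Q is
    this quantity divided by psi, which is bounded away from 0. *)
Lemma jetV psi p a c : jet psi p a c -> p != 0 ->
  jet (fun w => (psi w)^-1) p^-1 (- (p ^- 2)%:C * a) (- p ^- 2 * c + p ^- 3 * (Re (a * a^*) / 2)).
Proof.
move=> j p0; have np : 0 < `|p| by rewrite normr_gt0.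
have [d d0 bd] := jet_bound _ _ _ _ j (`|p| / 2) ltac:(by rewrite divr_gt0).
have big w : normc w < d -> `|p| / 2 <= `|psi w|.
  move=> /bd le; have := ler_normD (psi w - p) (- psi w).
  by rewrite addrAC subrr add0r !normrN; lra.
case: (j) => b hb.
pose Q := quad p^-1 (- (p ^- 2)%:C * a)
   (- (p ^- 2)%:C * b + (p ^- 3)%:C * (a * a * (2^-1)%:C))
   (- p ^- 2 * c + p ^- 3 * (Re (a * a^*) / 2)).
pose P := quad p a b c.
have oQ : osqr (fun w => P w * Q w - 1).
  have := quadM p a b c p^-1 (- (p ^- 2)%:C * a)
   (- (p ^- 2)%:C * b + (p ^- 3)%:C * (a * a * (2^-1)%:C))
   (- p ^- 2 * c + p ^- 3 * (Re (a * a^*) / 2)).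
  rewrite -/P -/Q; congr osqr; apply/funext => w; congr (_ - _).
  rewrite /quad normc_sqr; case: a b w {j hb Q P} => [? ?] [? ?] [x y] /=.
  by rewrite expr2 /=; field.
have [d2 d20 bd2] := jet_bound _ _ _ _ (jet_quad p^-1 (- (p ^- 2)%:C * a)
   (- (p ^- 2)%:C * b + (p ^- 3)%:C * (a * a * (2^-1)%:C))
   (- p ^- 2 * c + p ^- 3 * (Re (a * a^*) / 2))) 1 ltr01.
have oPQ : osqr (fun w => psi w * Q w - 1).
  have o1 : osqr (fun w => (psi w - quad p a b c w) * Q w).
    apply: (osqrM _ _ (`|p^-1| + 1) d2 d20 _ hb) => w /bd2.
    by have := ler_normD (Q w - p^-1) p^-1; rewrite subrK /Q; lra.
  have := osqrD _ _ o1 oQ; congr osqr; apply/funext => w; rewrite /P; ring.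
exists (- (p ^- 2)%:C * b + (p ^- 3)%:C * (a * a * (2^-1)%:C)); rewrite -/Q.
have o := osqrM _ (fun w => - (psi w)^-1) ((`|p| / 2)^-1) d d0 _ oPQ.
have {}o : osqr (fun w => (psi w * Q w - 1) * - (psi w)^-1).
  apply: o => w wd; have := big _ wd; have p2 : 0 < `|p| / 2 by rewrite divr_gt0.
  by move=> le; rewrite normrN normfV lef_pV2 ?posrE// (lt_le_trans p2).
move=> e e0; have [d3 d30 {}o] := o _ e0.
exists (Num.min d d3); first by rewrite lt_min d0.
move=> w; rewrite lt_min => /andP[/big wd /o].
have psi0 : psi w != 0 by rewrite -normr_gt0 (lt_le_trans _ wd)// divr_gt0.
by congr (`|_| <= _); field.
Qed.

End jets.

(** * Topology of C^n and the maximum principle *)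

Section complex_space_topology.
Context {R : realType}.

Lemma normCE (z : R[i]) : `|z| = (normc z)%:C.
Proof. by case: z. Qed.

(** Norms on [R[i]] take values in [R[i]], so radii of balls are complex numbers; positivity makes
    them real. *)
Lemma gtc0P (e : R[i]) : 0 < e -> e = (Re e)%:C /\ 0 < Re e.
Proof.
by case: e => x y; rewrite ltcE /= => /andP[/eqP -> x0].
Qed.

Context {n : nat}.
Local Notation Cn := 'rV[R[i]]_n.
Implicit Types (z y : Cn) (f : Cn -> R[i]).

Lemma nbhsCnP z (A : set Cn) : nbhs z A <->
  exists2 d : R, 0 < d & forall y, (forall j, normc (y 0 j - z 0 j) < d) -> A y.
Proof.
split.
  move=> /nbhs_ballP[e /= e00 eA]; have [eE e0] := gtc0P _ e00; exists (Re e) => // y yz; apply: eA.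
  split=> // i j; rewrite (ord1 i) /ball/= normCE eE ltcR normcB; exact: yz.
move=> [d d0 dA]; apply/nbhs_ballP; exists d%:C => /=; first by rewrite ltcR.
move=> y yz; apply: dA => j; case: yz => _ /(_ 0 j).
by rewrite /ball/= normCE ltcR normcB.
Qed.

Lemma holomorphic_cdiff f z (j : 'I_n) w0 : 
  differentiable (f : Cn -> R[i]^o) (z + w0 *: delta_mx 0 j) ->
  exists l, cdiff (fun w => f (z + w *: delta_mx 0 j)) w0 l.
Proof.
set x := z + _ => /(@diff_derivable _ _ _ _ _ (delta_mx 0 j)).
move=> /cvg_ex[l /cvgrPdist_le H]; exists l => e e0.
have := H (e%:C); rewrite ltcR => /(_ e0).
rewrite near_withinE => /nbhs_ballP[d /= /gtc0P[dE d0] dH]; exists (Re d) => // w wd.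
have [->|w0'] := eqVneq w 0.
  by rewrite addr0 subrr mulr0 subrr normc0 mulr0.
have := dH w; rewrite /ball/= sub0r normrN normCE dE ltcR => /(_ wd w0').
rewrite normCE lecR => le.
have -> : f (z + (w0 + w) *: delta_mx 0 j) - f (z + w0 *: delta_mx 0 j) - l * w =
    - ((l - w^-1 *: (f (w *: delta_mx 0 j + x) - f x)) * w).
  have -> : z + (w0 + w) *: delta_mx 0 j = w *: delta_mx 0 j + x.
    by rewrite /x scalerDl addrA addrC.
  rewrite mulrBl /GRing.scale/= mulrAC mulVf// mul1r opprB; ring.
by rewrite normcN normcM ler_wpM2r ?normc_ge0.
Qed.

Lemma Cn_continuousP (phi : Cn -> R) z : {for z, continuous phi} <->
  forall e : R, 0 < e -> exists2 d : R, 0 < d &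
    forall y, (forall j, normc (y 0 j - z 0 j) < d) -> `|phi y - phi z| <= e.
Proof.
split=> [/cvgrPdist_le H e /H/nbhsCnP[d d0 dH]|H].
  by exists d => // y /dH; rewrite distrC.
apply/(@cvgrPdist_le _ _ _ (nbhs z)) => e /H[d d0 dH]; apply/nbhsCnP; exists d => // y /dH.
by rewrite distrC.
Qed.

Lemma normc_comp_continuous f z : {for z, continuous (f : Cn -> R[i]^o)} ->
  {for z, continuous (fun y => normc (f y))}.
Proof.
move=> /cvgrPdist_le H; apply/Cn_continuousP => e e0.
have := H (e%:C); rewrite ltcR => /(_ e0)/nbhsCnP[d d0 dH].
exists d => // y /dH.
rewrite normCE lecR; apply: le_trans; rewrite ler_norml.
by have := normc_triangle (f z) (f y); have := normc_triangle (f y) (f z); rewrite normcB; lra.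
Qed.

Lemma Re_coord_continuous j : continuous (fun z : Cn => Re (z 0 j)).
Proof.
move=> z; apply/Cn_continuousP => e e0; exists e => // y /(_ j) yz.
by have := ler_Re_normc (y 0 j - z 0 j); rewrite raddfB/=; move: yz; lra.
Qed.

Lemma Im_coord_continuous j : continuous (fun z : Cn => Im (z 0 j)).
Proof.
move=> z; apply/Cn_continuousP => e e0; exists e => // y /(_ j) yz.
by have := ler_Im_normc (y 0 j - z 0 j); rewrite raddfB/=; move: yz; lra.
Qed.

Lemma compact_Cn_box (M : R) : compact [set z : Cn | forall j, `|Re (z 0 j)| <= M /\ `|Im (z 0
  j)| <= M].
Proof.
apply: (@rV_compact R[i] n (fun=> [set w | `|Re w| <= M /\ `|Im w| <= M])) => _.
have -> : [set w : R[i] | `|Re w| <= M /\ `|Im w| <= M] =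
    (fun p : R * R => p.1 +i* p.2) @` (`[- M, M] `*` `[- M, M]).
  apply/seteqP; split=> [[x y] /= []|_ [[x y] /= [+ +] <-]]; rewrite /= ?in_itv/= !ler_norml.
    by move=> h1 h2; exists (x, y) => //=; rewrite !in_itv.
  by [].
apply: continuous_compact; last by apply: compact_setX; exact: segment_compact.
apply: continuous_subspaceT => -[x y]; apply/cvgrPdist_lt => e /gtc0P[eE e0].
rewrite eE; near=> p; rewrite normCE ltcR; apply: (le_lt_trans (normc_le_ReIm _)) => /=.
have h1 : `|x - p.1| < Re e / 2.
  near: p; apply: (@cvgr_dist_lt _ _ _ _ _ (fst : R * R -> R) x); first exact: cvg_fst.
  by rewrite divr_gt0.
have h2 : `|y - p.2| < Re e / 2.
  near: p; apply: (@cvgr_dist_lt _ _ _ _ _ (snd : R * R -> R) y); first exact: cvg_snd.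
  by rewrite divr_gt0.
lra.
Unshelve. all: by end_near. Qed.

(* A quarter of the Laplacian, read off the |w|^2 terms of second order expansions
   along the complex coordinate lines. *)
Definition lap (phi : Cn -> R) z L := exists a c,
  (forall j : 'I_n, jet (fun w => phi (z + w *: delta_mx 0 j)) (phi z) (a j) (c j)) /\
  \sum_j c j = L.

(** At a maximum of |f| exp (- phi) where the second alternative holds, the [c j] have negative sum,
    so one of them is negative, and that single coordinate line yields a contradiction. An expansion
    of [phi] at the point is enough. *)
Lemma maximum_principle (Omega X : set Cn) f (phi : Cn -> R) :
  holomorphic Omega f -> compact X -> X `<=` Omega ->
  (forall x, X x -> {for x, continuous phi}) ->
  (forall x, X x -> normc (f x) <= expR (phi x) \/
     (nbhs x X /\ exists2 L, L < 0 & lap phi x L)) ->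
  forall x, X x -> normc (f x) <= expR (phi x).
Proof.
move=> hf cX XO cphi bX x Xx.
pose g y := normc (f y) * expR (- phi y).
suff : g x <= 1 by rewrite /g expRN ler_pdivrMr ?expR_gt0// mul1r.
have cg : {within X, continuous g}.
  apply: continuous_in_subspaceT => y /set_mem Xy.
  have c1 : {for y, continuous (fun y => normc (f y))}.
    by apply: normc_comp_continuous; apply: differentiable_continuous; apply: hf; exact: XO.
  have c2 : {for y, continuous (fun y => expR (- phi y))}.
    by apply: continuous_comp; [exact: continuousN (cphi _ Xy)|exact: continuous_expR].
  exact: (continuousM c1 c2).
have [x0 /set_mem Xx0 maxg] := compact_EVT_max (ex_intro _ x Xx : X !=set0) cX cg.
apply: (le_trans (maxg x (mem_set Xx))).
have [fb|[nX [L L0 [a [c [jc sc]]]]]] := bX _ Xx0.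
  by rewrite /g expRN ler_pdivrMr ?expR_gt0// mul1r.
have [f0|f0] := eqVneq (f x0) 0; first by rewrite /g f0 normc0 mul0r.
exfalso.
have [j cj] : exists j, c j < 0.
  apply: contrapT => /forallNP c0; move: L0; rewrite -sc ltNge sumr_ge0// => j _.
  by rewrite leNgt; apply/negP.
have [b ob] := jc j.
(* Half of the radial drop 2 k |w|^2 pays for the remainder. *)
pose k := - c j / 2; have k0 : 0 < k by rewrite divr_gt0// oppr_gt0.
have [d1 d10 h1] := ob _ k0.
have [d2 d20 h2] := (nbhsCnP _ _).1 nX.
pose r := Num.min (Num.min d1 d2) (Num.min 1 k^-1).
have r0 : 0 < r by rewrite !lt_min d10 d20 ltr01 invr_gt0.
pose F w := f (x0 + w *: delta_mx 0 j) * cexp (- (a j * w + b * w ^+ 2)).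
have Xw w : normc w < r -> X (x0 + w *: delta_mx 0 j).
  rewrite !lt_min => /andP[/andP[_ wd2] _]; apply: h2 => i.
  rewrite !mxE [_ + _ * _]addrC addrK eqxx/=; case: (i == j); rewrite ?mulr1// mulr0.
  by rewrite normc0.
have F0 : F 0 = f x0.
  by rewrite /F scale0r addr0 expr0n /= !mulr0 addr0 oppr0 cexp0 mulr1.
apply: (@no_strict_local_max R F r (k / 2)) => //.
- by rewrite divr_gt0.
- move=> w wr; have [l hl] := holomorphic_cdiff f x0 j w (hf _ (XO _ (Xw _ wr))).
  eexists; apply: cdiffM; first exact: hl.
  apply: (cdiff_comp cexp (fun w => - (a j * w + b * w ^+ 2))); last exact: cdiff_cexp.
  have -> : (fun w => - (a j * w + b * w ^+ 2)) = (fun w => (- a j) * w + (- b) * (w * w)).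
    by apply/funext => u; ring.
  apply: cdiffD; apply: cdiffM; [exact: cdiff_cst|exact: cdiff_id|exact: cdiff_cst|].
  by apply: cdiffM; exact: cdiff_id.
- by rewrite F0.
move=> w wr; rewrite F0; have Xwr := Xw _ wr.
move: wr; rewrite !lt_min => /andP[/andP[wd1 _] /andP[w1 wk]].
have w0 := normc_ge0 w.
have := h1 _ wd1; set y := x0 + _ in Xwr *; set q := quad _ _ _ _ _ => hq.
have gy : normc (f y) <= normc (f x0) * expR (phi y - phi x0).
  have := maxg y (mem_set Xwr); rewrite /g !expRN expRD expRN.
  rewrite ler_pdivrMr ?expR_gt0// => /le_trans; apply.
  by rewrite le_eqVlt mulrAC mulrA eqxx.
rewrite /F normcM normc_cexp -/y.
apply: (le_trans (ler_wpM2r (ltW (expR_gt0 _)) gy)).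
rewrite -mulrA ler_wpM2l ?normc_ge0// -expRD.
have le1 : phi y - phi x0 + Re (- (a j * w + b * w ^+ 2)) <= - (k * normc w ^+ 2).
  have -> : Re (- (a j * w + b * w ^+ 2)) = - (Re (a j * w) + Re (b * w ^+ 2)).
    by rewrite raddfN raddfD.
  have ck : c j = - (2 * k) by rewrite /k; field.
  by move: hq; rewrite /q /quad ck ler_norml => /andP[_]; lra.
have t0 : 0 <= k * normc w ^+ 2 by rewrite mulr_ge0 ?sqr_ge0// ltW.
have t1 : k * normc w ^+ 2 <= 1.
  have : normc w * k <= 1 by rewrite -ler_pdivlMr// div1r ltW.
  by rewrite expr2; nra.
apply: (@le_trans _ _ (expR (- (k * normc w ^+ 2)))); first by rewrite ler_expR.
(* exp (- t) <= 1 - t / 2 on [0, 1], from exp t >= 1 + t; the radius was chosen to make t <= 1. *)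
have := expR_ge1Dx (k * normc w ^+ 2); set t := k * _ in t0 t1 * => et.
have -> : k / 2 * normc w ^+ 2 = t / 2 by rewrite /t; ring.
rewrite expRN -[_^-1]mul1r ler_pdivrMr ?expR_gt0//; nra.
Qed.

End complex_space_topology.

(** * Laplacians of the explicit functions *)

Section laplacian.
Context {R : realType} {n : nat}.
Local Notation Cn := 'rV[R[i]]_n.
Implicit Types (z y g : Cn) (phi : Cn -> R).

Definition sqn z : R := \sum_j normc (z 0 j) ^+ 2.
Definition cdot g z : R := \sum_j Re ((g 0 j)^* * z 0 j).

Lemma sqn_ge0 z : 0 <= sqn z.
Proof. by apply: sumr_ge0 => j _; exact: sqr_ge0. Qed.

Lemma lap_cst (k : R) z : lap (fun=> k) z 0.
Proof.
exists (fun=> 0), (fun=> 0); split; last by rewrite big1.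
move=> j; apply: jet_eq (jet_quad k 0 0 0) => //.
by move=> w; rewrite /quad !mul0r /= !addr0.
Qed.

Lemma lapD phi psi z L M : lap phi z L -> lap psi z M ->
  lap (fun y => phi y + psi y) z (L + M).
Proof.
move=> [a [c [j1 <-]]] [a' [c' [j2 <-]]].
exists (fun j => a j + a' j), (fun j => c j + c' j); split; last by rewrite big_split.
by move=> j; exact: jetD.
Qed.

Lemma lapZ phi z k L : lap phi z L -> lap (fun y => k * phi y) z (k * L).
Proof.
move=> [a [c [j1 <-]]]; exists (fun j => k%:C * a j), (fun j => k * c j).
by split; [move=> j; exact: jetZ | rewrite mulr_sumr].
Qed.

Lemma lap_sum (I : Type) (s : seq I) (P : pred I) (F : I -> Cn -> R) z (L : I -> R) :
  (forall i, P i -> lap (F i) z (L i)) ->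
  lap (fun y => \sum_(i <- s | P i) F i y) z (\sum_(i <- s | P i) L i).
Proof.
move=> h; elim: s => [|i s IH].
  by under eq_fun do rewrite big_nil; rewrite big_nil; exact: lap_cst.
rewrite big_cons; under eq_fun do rewrite big_cons.
by case: ifPn => // Pi; apply: lapD => //; exact: h.
Qed.

Lemma row_line z j i (w : R[i]) :
  (z + w *: delta_mx 0 j) 0 i = z 0 i + (if i == j then w else 0).
Proof. by rewrite !mxE eqxx; case: eqP => _; rewrite ?mulr1 ?mulr0. Qed.

Lemma sqn_line z y j w : sqn (z + w *: delta_mx 0 j - y) =
  quad (sqn (z - y)) (2%:C * ((z - y) 0 j)^*) 0 1 w.
Proof.
have -> : z + w *: delta_mx 0 j - y = (z - y) + w *: delta_mx 0 j by rewrite addrAC.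
set u := z - y; rewrite /quad /sqn (bigD1 j)//= [X in _ = X + _ + _ + _](bigD1 j)//=.
rewrite row_line eqxx (eq_bigr (fun i => normc (u 0 i) ^+ 2)); last first.
  by move=> i /negPf ij; rewrite row_line ij addr0.
set S := \sum_(i < n | _) _; rewrite !normc_sqr; case: (u 0 j) w => [p q] [x v] /=; ring.
Qed.

Lemma cdot_line g z y j w : cdot g (z + w *: delta_mx 0 j - y) =
  quad (cdot g (z - y)) (g 0 j)^* 0 0 w.
Proof.
have -> : z + w *: delta_mx 0 j - y = (z - y) + w *: delta_mx 0 j by rewrite addrAC.
set u := z - y; rewrite /quad /cdot (bigD1 j)//= [X in _ = X + _ + _ + _](bigD1 j)//=.
rewrite row_line eqxx (eq_bigr (fun i => Re ((g 0 i)^* * u 0 i))); last first.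
  by move=> i /negPf ij; rewrite row_line ij addr0.
set S := \sum_(i < n | _) _; case: (u 0 j) w (g 0 j) => [p q] [x v] [? ?] /=; ring.
Qed.

Lemma jet_sqn z y j : jet (fun w => sqn (z + w *: delta_mx 0 j - y))
  (sqn (z - y)) (2%:C * ((z - y) 0 j)^*) 1.
Proof. by under eq_fun do rewrite sqn_line; exact: jet_quad. Qed.

Lemma jet_cdot g z y j : jet (fun w => cdot g (z + w *: delta_mx 0 j - y))
  (cdot g (z - y)) (g 0 j)^* 0.
Proof. by under eq_fun do rewrite cdot_line; exact: jet_quad. Qed.

Lemma jet_sqnV z y j m : sqn (z - y) != 0 ->
  let s := sqn (z - y) in
  jet (fun w => (sqn (z + w *: delta_mx 0 j - y))^-1 ^+ m) (s^-1 ^+ m)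
    ((- (2 * m%:R * s^-1 ^+ m.+1))%:C * ((z - y) 0 j)^*)
    (- (m%:R * s^-1 ^+ m.+1) + m%:R * m.+1%:R * s^-1 ^+ m.+2 * normc ((z - y) 0 j) ^+ 2).
Proof.
move=> s0 s; have jV := jetV _ _ _ _ (jet_sqn z y j) s0; rewrite -/s in jV.
elim: m => [|m IH].
  apply: jet_eq (jet_quad 1 0 0 0).
  - by move=> w; rewrite /quad !mul0r /= !addr0 expr0.
  - by rewrite expr0.
  - by rewrite mulr0 mul0r oppr0 mul0r.
  - by rewrite !mul0r oppr0 addr0.
apply: jet_eq (jetM _ _ _ _ _ _ _ _ jV IH).
- by move=> w; rewrite exprS.
- by rewrite exprS.
- move: IH => _; case: ((z - y) 0 j) => p q.
  apply/eqP; rewrite eq_complex /= -!natr1; apply/andP; split; apply/eqP; rewrite !exprS;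
    field; exact: s0.
rewrite normc_sqr; case: ((z - y) 0 j) {IH} => p q /=.
by rewrite -!natr1 !exprS; field; exact: s0.
Qed.

Lemma continuous_coord_sum (F : 'I_n -> Cn -> R) z :
  (forall j, {for z, continuous (F j)}) -> {for z, continuous (fun y => \sum_j F j y)}.
Proof.
move=> h; elim: (index_enum _) => [|i s IH].
  have -> : (fun y => \sum_(j <- [::]) F j y) = (fun=> 0) by apply/funext => y; rewrite big_nil.
  exact: cst_continuous.
have -> : (fun y => \sum_(j <- i :: s) F j y) = (fun y => F i y + \sum_(j <- s) F j y).
  by apply/funext => y; rewrite big_cons.
by apply: continuousD; [exact: h|].
Qed.

Lemma continuous_sqn y : continuous (fun z => sqn (z - y)).
Proof.
move=> z; apply: continuous_coord_sum => j.
have -> : (fun u : Cn => normc ((u - y) 0 j) ^+ 2) = (fun u : Cn =>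
    (Re (u 0 j) + Re ((- y) 0 j)) * (Re (u 0 j) + Re ((- y) 0 j)) +
    (Im (u 0 j) + Im ((- y) 0 j)) * (Im (u 0 j) + Im ((- y) 0 j))).
  by apply/funext => u; rewrite normc_sqr !mxE !raddfD/= !expr2.
have cR : {for z, continuous (fun u : Cn => Re (u 0 j) + Re ((- y) 0 j))}.
  by apply: continuousD; [exact: Re_coord_continuous|exact: cst_continuous].
have cI : {for z, continuous (fun u : Cn => Im (u 0 j) + Im ((- y) 0 j))}.
  by apply: continuousD; [exact: Im_coord_continuous|exact: cst_continuous].
by apply: continuousD; exact: continuousM.
Qed.

Lemma continuous_cdot g y : continuous (fun z => cdot g (z - y)).
Proof.
move=> z; apply: continuous_coord_sum => j.
have E (u : Cn) : Re ((g 0 j)^* * (u - y) 0 j) =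
    Re (g 0 j) * (Re (u 0 j) + Re ((- y) 0 j)) + Im (g 0 j) * (Im (u 0 j) + Im ((- y) 0 j)).
  by rewrite !mxE; case: (g 0 j) (u 0 j) (y 0 j) => [? ?] [? ?] [? ?] /=; ring.
rewrite (funext E).
have cR : {for z, continuous (fun u : Cn => Re (u 0 j) + Re ((- y) 0 j))}.
  by apply: continuousD; [exact: Re_coord_continuous|exact: cst_continuous].
have cI : {for z, continuous (fun u : Cn => Im (u 0 j) + Im ((- y) 0 j))}.
  by apply: continuousD; [exact: Im_coord_continuous|exact: cst_continuous].
by apply: continuousD; apply: continuousM => //; exact: cst_continuous.
Qed.

Lemma continuous_sqnV y z (m : nat) : sqn (z - y) != 0 ->
  {for z, continuous (fun u : Cn => (sqn (u - y))^-1 ^+ m)}.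
Proof.
move=> s0; elim: m => [|m IH].
  have -> : (fun u : Cn => (sqn (u - y))^-1 ^+ 0) = (fun=> 1) by apply/funext.
  exact: cst_continuous.
have -> : (fun u : Cn => (sqn (u - y))^-1 ^+ m.+1) =
    (fun u : Cn => (sqn (u - y))^-1 * (sqn (u - y))^-1 ^+ m).
  by apply/funext => u; rewrite exprS.
by apply: continuousM => //; apply: continuousV => //; exact: continuous_sqn.
Qed.

(** With s = |z - y|^2 the coordinates contribute - n^2 and n (n + 1) times s^(- n - 1): |z|^(- 2n)
    is strictly subharmonic for n > 0, as the comparison on annuli requires. *)
Lemma lap_sqnV z y : sqn (z - y) != 0 ->
  lap (fun z => (sqn (z - y))^-1 ^+ n) z (n%:R * (sqn (z - y))^-1 ^+ n.+1).
Proof.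
move=> s0; eexists; eexists; split=> [j|]; first exact: jet_sqnV.
rewrite big_split/= sumr_const card_ord -mulr_sumr -/(sqn _) !exprS -!natr1 mulNrn -mulr_natl.
by field.
Qed.

(* |z|^(2 - 2n) and the derivative of this function (of log |z| if n = 1) in the
   direction g are harmonic. *)
Definition hkernel (A : R) g z := (A * sqn z - cdot g z) * (sqn z)^-1 ^+ n.

Lemma lap_hkernel A g z y : sqn (z - y) != 0 -> lap (fun z => hkernel A g (z - y)) z 0.
Proof.
move=> s0; eexists; eexists; split=> [j|].
  apply: jetM (jet_sqnV _ _ _ n s0).
  apply: jetD; first by apply: jetZ; exact: jet_sqn.
  by apply: jetN; exact: jet_cdot.
set s := sqn (z - y) in s0 *; set X := cdot g (z - y).
pose t : R := s^-1 ^+ n.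
pose N j := normc ((z - y) 0 j) ^+ 2; pose D j := Re ((g 0 j)^* * (z - y) 0 j).
(* Each coefficient becomes affine in [N j] and [D j], whose sums are [s] and [X]. *)
rewrite (eq_bigr (fun j => (A * s - X) * (- n%:R * t * s^-1) + t * A +
   ((A * s - X) * (n%:R * n.+1%:R * t * s^-1 * s^-1) - 2 * A * n%:R * t * s^-1) * N j +
   n%:R * t * s^-1 * D j)); last first.
  move=> j _; rewrite /N /D /X /s /t normc_sqr -!natr1 !exprS.
  case: ((z - y) 0 j) (g 0 j) => [p q] [u v] /=; field; exact: s0.
rewrite 2!big_split/= sumr_const card_ord -!mulr_sumr -[\sum_(i < n) N i]/s -[\sum_(i < n) D i]/X.
by rewrite -mulr_natl -!natr1; field.
Qed.

(* If |g|^2 La is large this is superharmonic.  Inside Omega, with g a normal and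
   A |z|^2 - g.z > 0, the last term absorbs - La (g.z)^2 where g.z < 0. *)
Definition barrier (A La B : R) g z :=
  sqn z - La * cdot g z ^+ 2 + B * (A * sqn z - cdot g z).

Lemma lap_barrier A La B g z y : lap (fun z => barrier A La B g (z - y)) z
  (n%:R - La * (sqn g / 2) + B * A * n%:R).
Proof.
eexists; eexists; split=> [j|].
  apply: jetD; last first.
    apply: jetZ; apply: jetD; first by apply: jetZ; exact: jet_sqn.
    by apply: jetN; exact: jet_cdot.
  apply: jetD; first exact: jet_sqn.
  by apply: jetN; apply: jetZ; apply: jetM; exact: jet_cdot.
rewrite (eq_bigr (fun j => 1 + B * A + (- La / 2) * normc (g 0 j) ^+ 2)); last first.
  by move=> j _; rewrite normc_sqr; case: (g 0 j) => u v /=; field.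
rewrite big_split/= sumr_const card_ord -mulr_sumr -/(sqn g) -mulr_natl; ring.
Qed.

End laplacian.

(** * The Euclidean norm *)

Section euclidean_norm.
Context {R : realType} {n : nat}.
Local Notation Cn := 'rV[R[i]]_n.
Implicit Types (a b x y z : Cn).

Lemma enorm_ge0 z : 0 <= enorm z.
Proof. exact: sqrtr_ge0. Qed.

Lemma enorm_sqr z : enorm z ^+ 2 = sqn z.
Proof. by rewrite sqr_sqrtr//; exact: sqn_ge0. Qed.

Lemma enormN z : enorm (- z) = enorm z.
Proof. by congr Num.sqrt; apply: eq_bigr => j _; rewrite mxE normcN. Qed.

Lemma enormB x y : enorm (x - y) = enorm (y - x).
Proof. by rewrite -enormN opprB. Qed.

Lemma enorm0 : enorm (0 : Cn) = 0.
Proof.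
rewrite /enorm big1 ?sqrtr0// => j _.
by rewrite mxE normc0 expr0n.
Qed.

Lemma sqnD a b : sqn (a + b) = sqn a + sqn b + 2 * cdot a b.
Proof.
rewrite /sqn /cdot mulr_sumr -!big_split/=; apply: eq_bigr => j _.
rewrite !normc_sqr mxE; case: (a 0 j) (b 0 j) => [p q] [u v] /=; ring.
Qed.

Lemma sqnZ (t : R) a : sqn (t%:C *: a) = t ^+ 2 * sqn a.
Proof.
rewrite /sqn mulr_sumr; apply: eq_bigr => j _; rewrite mxE normcM exprMn.
by congr (_ * _); rewrite normc_sqr /=; ring.
Qed.

Lemma cdotZ (t u : R) a b : cdot (t%:C *: a) (u%:C *: b) = t * u * cdot a b.
Proof.
rewrite /cdot mulr_sumr; apply: eq_bigr => j _; rewrite !mxE.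
by case: (a 0 j) (b 0 j) => [p q] [w v] /=; ring.
Qed.

Lemma normc_le_enorm z j : normc (z 0 j) <= enorm z.
Proof.
rewrite -(@ler_pXn2r _ 2)// ?nnegrE ?normc_ge0 ?enorm_ge0// enorm_sqr.
by rewrite /sqn (bigD1 j)//= lerDl sumr_ge0// => i _; rewrite sqr_ge0.
Qed.

Lemma enorm_eq0 z : enorm z = 0 -> z = 0.
Proof.
move=> z0; apply/rowP => j; rewrite mxE; apply: eq0_normc; apply/eqP.
by rewrite eq_le normc_ge0 andbT -z0 normc_le_enorm.
Qed.

Lemma cdot_le a b : `|cdot a b| <= enorm a * enorm b.
Proof.
have [a0|a0] := eqVneq (enorm a) 0.
  rewrite a0 mul0r (enorm_eq0 _ a0) /cdot big1 ?normr0// => j _.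
  by rewrite mxE rmorph0 mul0r.
have [b0|b0] := eqVneq (enorm b) 0.
  rewrite b0 mulr0 (enorm_eq0 _ b0) /cdot big1 ?normr0// => j _.
  by rewrite mxE mulr0.
have ap : 0 < enorm a by rewrite lt_neqAle eq_sym a0 enorm_ge0.
have bp : 0 < enorm b by rewrite lt_neqAle eq_sym b0 enorm_ge0.
have abp := mulr_gt0 ap bp.
(* Nonnegativity of the squared norm of |b| a + s |a| b, for s = 1 and s = - 1. *)
have key (s : R) : s ^+ 2 = 1 -> 0 <= (enorm a * enorm b) * (enorm a * enorm b + s * cdot a b).
  move=> s2; have := sqn_ge0 ((enorm b)%:C *: a + (s * enorm a)%:C *: b).
  rewrite sqnD !sqnZ cdotZ -!enorm_sqr exprMn s2 => h.
  have -> : enorm a * enorm b * (enorm a * enorm b + s * cdot a b) =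
    2^-1 * (enorm b ^+ 2 * enorm a ^+ 2 + 1 * enorm a ^+ 2 * enorm b ^+ 2 +
     2 * (enorm b * (s * enorm a) * cdot a b)) by field.
  by rewrite mulr_ge0.
have := key 1 (expr1n _ _); have := key (-1) ltac:(by rewrite sqrrN expr1n).
rewrite !pmulr_rge0// ler_norml; lra.
Qed.

Lemma enormD a b : enorm (a + b) <= enorm a + enorm b.
Proof.
rewrite -(@ler_pXn2r _ 2)// ?nnegrE ?addr_ge0 ?enorm_ge0//.
rewrite enorm_sqr sqnD -!enorm_sqr.
have := cdot_le a b; rewrite ler_norml => /andP[_]; lra.
Qed.

Lemma enorm_triangle x y z : enorm (x - z) <= enorm (x - y) + enorm (y - z).
Proof. by have := enormD (x - y) (y - z); rewrite addrA subrK. Qed.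

Lemma enorm_le_sum z : enorm z <= \sum_j normc (z 0 j).
Proof.
rewrite -(@ler_pXn2r _ 2)// ?nnegrE ?enorm_ge0//; last first.
  by apply: sumr_ge0 => j _; exact: normc_ge0.
rewrite enorm_sqr /sqn; elim: (index_enum _) => [|j s IH].
  by rewrite !big_nil expr0n.
rewrite !big_cons sqrrD -addrA lerD2l (le_trans IH)// lerDr mulrn_wge0// mulr_ge0 ?normc_ge0//.
by apply: sumr_ge0 => i _; exact: normc_ge0.
Qed.

Lemma nbhs_enormP z (A : set Cn) : nbhs z A <->
  exists2 r : R, 0 < r & forall y, enorm (y - z) < r -> A y.
Proof.
split=> [/nbhsCnP[d d0 dA]|[r r0 rA]].
  exists d => // y yz; apply: dA => j; apply: le_lt_trans yz.
  by have := normc_le_enorm (y - z) j; rewrite !mxE.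
(* The successor keeps the quotient meaningful for n = 0 and the final inequality strict. *)
apply/nbhsCnP; exists (r / n.+1%:R); first by rewrite divr_gt0.
move=> y yz; apply: rA; apply: (le_lt_trans (enorm_le_sum _)).
apply: (@le_lt_trans _ _ (\sum_(j < n) (r / n.+1%:R))).
  by apply: ler_sum => j _; rewrite !mxE ltW.
rewrite sumr_const card_ord -[_ *+ n]mulr_natr mulrAC ltr_pdivrMr//.
by rewrite ltr_pM2l// ltr_nat.
Qed.

Lemma enorm_lt (r : R) z : 0 < r -> (enorm z < r) = (sqn z < r ^+ 2).
Proof.
by move=> r0; rewrite -enorm_sqr ltr_pXn2r// nnegrE ?enorm_ge0// ltW.
Qed.

Lemma enorm_le (r : R) z : 0 <= r -> (enorm z <= r) = (sqn z <= r ^+ 2).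
Proof. by move=> r0; rewrite -enorm_sqr ler_pXn2r// nnegrE ?enorm_ge0. Qed.

Lemma closed_le_continuous (phi psi : Cn -> R) :
  continuous phi -> continuous psi -> closed [set z | phi z <= psi z].
Proof.
move=> cphi cpsi.
have -> : [set z | phi z <= psi z] = (fun z => phi z - psi z) @^-1` [set x | x <= 0].
  by apply/seteqP; split => z /=; rewrite subr_le0.
apply: preimage_closed; last exact: closed_le.
by move=> z _; apply: continuousB; [exact: cphi|exact: cpsi].
Qed.

Lemma enorm_continuous y : continuous (fun z => enorm (z - y)).
Proof.
move=> z; apply/Cn_continuousP => e e0.
have := (nbhs_enormP z [set x | enorm (x - z) < e]).2 ltac:(by exists e).
move=> /nbhsCnP[d d0 dH]; exists d => // x /dH /= xz.
rewrite ler_norml; have := enorm_triangle x z y; have := enorm_triangle z x y.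
by rewrite [enorm (z - x)]enormB; lra.
Qed.

Lemma compact_Cn (A : set Cn) M : closed A -> (forall z, A z -> enorm z <= M) -> compact A.
Proof.
move=> cA bA; apply: (subclosed_compact cA (compact_Cn_box M)) => z /bA zM j.
have := normc_le_enorm z j; have := ler_Re_normc (z 0 j); have := ler_Im_normc (z 0 j).
by split; lra.
Qed.

Lemma compact_ball y (r : R) : compact [set z | enorm (z - y) <= r].
Proof.
apply: (@compact_Cn _ (r + enorm y)).
  by apply: closed_le_continuous; [exact: enorm_continuous|exact: cst_continuous].
by move=> z /= zr; have := enormD (z - y) y; rewrite subrK; lra.
Qed.

End euclidean_norm.

(** * The identity theorem *)

Section identity_theorem.
Context {R : realType}.

(** Turns an estimate valid for every L into vanishing; exp t >= 1 + t at L = M / (a d) suffices. *)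
Lemma expR_decay (a M d : R) : 0 < M -> 0 < d ->
  (forall L, 0 < L -> a <= M * expR (- (L * d))) -> a <= 0.
Proof.
move=> M0 d0 h; rewrite leNgt; apply/negP => a0.
have L0 : 0 < M / (a * d) by rewrite divr_gt0// mulr_gt0.
have := h _ L0; rewrite expRN ler_pdivlMr ?expR_gt0//; apply/negP; rewrite -ltNge.
apply: (@lt_le_trans _ _ (a * (1 + M / (a * d) * d))); last by rewrite ler_pM2l// expR_ge1Dx.
have -> : a * (1 + M / (a * d) * d) = a + M by field; rewrite !lt0r_neq0.
by rewrite ltrDr.
Qed.

Context {n : nat}.
Local Notation Cn := 'rV[R[i]]_n.

(* Comparison with - L (|z - y|^(- 2n) - r^(- 2n)), L large, on an annulus. *)
Lemma vanish_ball (Omega : set Cn) (f : Cn -> R[i]) y (r0 r : R) : (0 < n)%N ->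
  holomorphic Omega f -> 0 < r0 ->
  (forall z, enorm (z - y) <= r -> Omega z) ->
  (forall z, enorm (z - y) <= r0 -> f z = 0) ->
  forall z, enorm (z - y) < r -> f z = 0.
Proof.
move=> n0 hf r00 rO r0f z zr.
have [zr0|zr0] := leP (enorm (z - y)) r0; first exact: r0f.
have rp : 0 < r := le_lt_trans (enorm_ge0 _) zr.
pose K := [set z | enorm (z - y) <= r].
have [M M0 KM] : exists2 M, 0 < M & forall x, K x -> normc (f x) <= M.
  have cf : {within K, continuous (fun x => normc (f x))}.
    apply: continuous_in_subspaceT => x /set_mem Kx; apply: normc_comp_continuous.
    by apply: differentiable_continuous; apply: hf; exact: rO.
  have Ky : K !=set0 by exists y; rewrite /K/= subrr enorm0 ltW.
  have [x0 _ mx] := compact_EVT_max Ky (compact_ball y r) cf.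
  exists (normc (f x0) + 1); first by have := normc_ge0 (f x0); lra.
  by move=> x /mem_set/mx; lra.
apply: eq0_normc; apply/eqP; rewrite eq_le normc_ge0 andbT.
pose s := sqn (z - y).
have s0 : 0 < s by rewrite /s -enorm_sqr exprn_gt0// (lt_trans r00).
pose d := s^-1 ^+ n - (r ^+ 2)^-1 ^+ n.
have d0 : 0 < d.
  rewrite subr_gt0 ltr_pXn2r ?nnegrE ?invr_ge0 ?exprn_ge0 ?ltW//.
  by rewrite ltf_pV2 ?posrE ?exprn_gt0// /s -enorm_lt.
apply: (expR_decay _ M d) => // L L0.
(* On the outer sphere the value is [ln M]; on the inner one f = 0, so any value serves. At z the
   bracket is the positive number [d]. *)
pose phi x := ln M - L * ((sqn (x - y))^-1 ^+ n - (r ^+ 2)^-1 ^+ n).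
have -> : M * expR (- (L * d)) = expR (phi z) by rewrite expRD lnK.
pose X := [set x | enorm (x - y) <= r] `&` [set x | r0 <= enorm (x - y)].
have X0 x : X x -> sqn (x - y) != 0.
  by move=> [_ /= xr]; rewrite -enorm_sqr expf_neq0// lt0r_neq0// (lt_le_trans r00).
apply: (maximum_principle Omega X f phi) => //.
- apply: (@compact_Cn _ _ _ (r + enorm y)).
    by apply: closedI; apply: closed_le_continuous; try exact: enorm_continuous;
      exact: cst_continuous.
  by move=> x [/= xr _]; have := enormD (x - y) y; rewrite subrK; lra.
- by move=> x [xr _]; exact: rO.
- move=> x Xx; apply: continuousB; first exact: cst_continuous.
  apply: continuousM; first exact: cst_continuous.
  apply: continuousB; last exact: cst_continuous.
  by apply: continuous_sqnV; exact: X0.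
- move=> x Xx; have [xr|xr] := eqVneq (enorm (x - y)) r.
    left; rewrite /phi -enorm_sqr xr subrr mulr0 subr0 lnK//; apply: KM.
    by rewrite /K/= xr.
  have [xr0|xr0] := eqVneq (enorm (x - y)) r0.
    by left; rewrite r0f ?xr0// normc0 expR_ge0.
  right; split.
    have [/= x1 x2] := Xx.
    have h1 : 0 < Num.min (r - enorm (x - y)) (enorm (x - y) - r0).
      by rewrite lt_min !subr_gt0 !lt_neqAle xr x1 x2 eq_sym xr0.
    apply/nbhs_enormP; exists (Num.min (r - enorm (x - y)) (enorm (x - y) - r0)) => // u.
    rewrite lt_min => /andP[u1 u2]; have t1 := enorm_triangle u x y.
    have t2 := enorm_triangle x u y; rewrite [enorm (x - u)]enormB in t2.
    by split => /=; lra.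
  exists (0 + - L * (n%:R * (sqn (x - y))^-1 ^+ n.+1 + 0)).
    rewrite add0r addr0 mulNr oppr_lt0 mulr_gt0// mulr_gt0 ?ltr0n// exprn_gt0//.
    by rewrite invr_gt0 lt_neqAle sqn_ge0 andbT eq_sym X0.
  rewrite /phi; under eq_fun do rewrite -mulNr.
  apply: lapD; first exact: lap_cst.
  by apply: lapZ; apply: lapD; [apply: lap_sqnV; exact: X0|exact: lap_cst].
- by split => /=; exact: ltW.
Qed.

Lemma identity_theorem (Omega : set Cn) (f : Cn -> R[i]) z0 :
  open Omega -> connected Omega -> holomorphic Omega f ->
  Omega z0 -> nbhs z0 [set z | f z = 0] -> forall z, Omega z -> f z = 0.
Proof.
move=> oO cO hf Oz0 fz0 z Oz.
have [n0|n0] := posnP n.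
  (* C^0 is a point, while [vanish_ball] requires n > 0. *)
  have -> : z = z0 by move: z z0 {Oz Oz0 fz0}; rewrite n0 => u v; rewrite !thinmx0.
  exact: nbhs_singleton fz0.
pose N : set Cn := [set z | nbhs z [set x | f x = 0]].
suff : Omega `&` N = Omega by move=> /seteqP[_ /(_ z Oz)[_ /nbhs_singleton]].
apply: cO.
- by exists z0.
- by exists N => //; rewrite openE => x /= /nbhs_interior.
exists (closure N); first exact: closed_closure.
suff sub x : Omega x -> closure N x -> N x.
  apply/seteqP; split=> x [Ox Nx]; split; [exact: Ox|exact: subset_closure|exact: Ox|].
  exact: sub.
move=> Ox Nx.
have /nbhs_enormP[r r0 rO] : nbhs x Omega by move: oO; rewrite openE; apply.
(* For y within r / 4 of x, the ball of radius r / 2 about y lies in Omega and contains the ball of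
   radius r / 4 about x. *)
have /Nx[y [Ny /= yx]] : nbhs x [set y | enorm (y - x) < r / 4].
  by apply/nbhs_enormP; exists (r / 4) => //; rewrite divr_gt0.
have [r1 r10 r1f] := (nbhs_enormP _ _).1 Ny.
have key : forall u, enorm (u - y) < r / 2 -> f u = 0.
  apply: (vanish_ball Omega f y (r1 / 2)) => //; first by rewrite divr_gt0.
    by move=> u uy; apply: rO; have := enorm_triangle u y x; lra.
  by move=> u uy; apply: r1f; lra.
apply/nbhs_enormP; exists (r / 4); first by rewrite divr_gt0.
move=> u ux; apply: key; have := enorm_triangle u x y.
by rewrite [enorm (x - y)]enormB; lra.
Qed.

End identity_theorem.

(** * Real coordinates and mean value estimates *)

Section real_coordinates.
Context {R : realType} {n : nat}.
Local Notation Cn := 'rV[R[i]]_n.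
Local Notation I2 := 'I_(n + n).
Implicit Types (x y z : Cn) (k l : I2) (t : R) (u : Cn -> R).

Definition rc k z : R :=
  match fintype.split k with inl j => Re (z 0 j) | inr j => Im (z 0 j) end.

Definition of_rc (v : I2 -> R) : Cn := \row_j (v (lshift n j) +i* v (rshift n j)).

Lemma of_rcK v k : rc k (of_rc v) = v k.
Proof.
by rewrite /rc; case: split_ordP => j ->; rewrite mxE.
Qed.

Lemma rcK z : of_rc (fun k => rc k z) = z.
Proof.
apply/rowP => j; rewrite mxE /rc.
by rewrite -[lshift n j]/(unsplit (inl j)) -[rshift n j]/(unsplit (inr j)) !unsplitK; case: (z 0 j).
Qed.

Lemma rc_inj x y : (forall k, rc k x = rc k y) -> x = y.
Proof. by move=> h; rewrite -(rcK x) -(rcK y); congr of_rc; apply/funext. Qed.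

Lemma rcB k x y : rc k (x - y) = rc k x - rc k y.
Proof. by rewrite /rc; case: fintype.split => j; rewrite !mxE;
  case: (x 0 j) (y 0 j) => [? ?] [? ?]. Qed.

Lemma rc_line l z k t : rc l (real_line z k t) = rc l z + (if l == k then t else 0).
Proof.
rewrite /real_line /real_basis /rc; case: (split_ordP l) => i ->; case: (split_ordP k) => j ->;
  rewrite !mxE ?(inj_eq (@lshift_inj _ _)) ?(inj_eq (@rshift_inj _ _)) ?eq_lrshift ?eq_rlshift
    ?eqxx /=.
all: by case: (i == j); rewrite /= ?mulr1n ?mulr0n; case: (z 0 i) => ? ? /=; ring.
Qed.

Lemma cdot_rc x y : cdot x y = \sum_k rc k x * rc k y.
Proof.
rewrite big_split_ord /= -big_split; apply: eq_bigr => j _ /=.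
rewrite /rc -[lshift n j]/(unsplit (inl j)) -[rshift n j]/(unsplit (inr j)) !unsplitK.
by case: (x 0 j) (y 0 j) => [? ?] [? ?] /=; ring.
Qed.

Lemma sqn_rc z : sqn z = \sum_k rc k z ^+ 2.
Proof.
rewrite big_split_ord /= -big_split; apply: eq_bigr => j _ /=.
rewrite /rc -[lshift n j]/(unsplit (inl j)) -[rshift n j]/(unsplit (inr j)) !unsplitK.
exact: normc_sqr.
Qed.

Lemma rc_le_enorm k z : `|rc k z| <= enorm z.
Proof.
rewrite -(@ler_pXn2r _ 2)// ?nnegrE ?enorm_ge0// enorm_sqr sqn_rc.
rewrite real_normK ?num_real// (bigD1 k)//= lerDl sumr_ge0// => i _.
exact: sqr_ge0.
Qed.

Definition nl1 z : R := \sum_k `|rc k z|.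

Lemma nl1_ge0 z : 0 <= nl1 z.
Proof. by apply: sumr_ge0. Qed.

Lemma nl1_le_enorm z : nl1 z <= (n + n)%:R * enorm z.
Proof.
apply: (@le_trans _ _ (\sum_(k < n + n) enorm z)).
  by apply: ler_sum => k _; exact: rc_le_enorm.
by rewrite sumr_const card_ord mulr_natl.
Qed.

Lemma enorm_le_nl1 z : enorm z <= nl1 z.
Proof.
rewrite -(@ler_pXn2r _ 2)// ?nnegrE ?enorm_ge0 ?nl1_ge0// enorm_sqr sqn_rc /nl1.
elim: (index_enum _) => [|j s IH]; first by rewrite !big_nil expr0n.
rewrite !big_cons sqrrD real_normK ?num_real// -addrA lerD2l (le_trans IH)//.
by rewrite lerDr mulrn_wge0// mulr_ge0// sumr_ge0.
Qed.

Lemma real_lineD z k t t' : real_line (real_line z k t) k t' = real_line z k (t' + t).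
Proof. by rewrite /real_line -addrA -scalerDl rmorphD [_ + t'%:C]addrC. Qed.

Lemma real_line0 z k : real_line z k 0 = z.
Proof. by rewrite /real_line scale0r addr0. Qed.

(** Moving the base point along the line turns differentiability at 0 on all parallel lines into
    differentiability at t. *)
Lemma is_derive_line u z k t : (forall y, derivable (u \o real_line y k) 0 1) ->
  is_derive t (1 : R) (u \o real_line z k) (real_partial k u (real_line z k t)).
Proof.
move=> du; have E : (fun h : R => h^-1 *: (((u \o real_line (real_line z k t) k) \o shift 0) (h
  *: 1) -
    (u \o real_line (real_line z k t) k) 0)) =
  (fun h : R => h^-1 *: (((u \o real_line z k) \o shift t) (h *: 1) - (u \o real_line z k) t)).
  by apply/funext => h /=; rewrite !real_lineD addr0 add0r.
apply: DeriveDef.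
  exact: (eq_ind _ (fun g => cvg (g @ 0^')) (du (real_line z k t)) _ E).
rewrite /real_partial derive1E; exact: (congr1 (fun g => lim (g @ 0^')) (esym E)).
Qed.

Lemma line_mvt u z k t : (forall y, derivable (u \o real_line y k) 0 1) ->
  exists2 h : R, 0 <= h <= 1 &
    u (real_line z k t) - u z = t * real_partial k u (real_line z k (h * t)).
Proof.
move=> du; have dl s := is_derive_line u z k s du.
have cl (a b : R) : {within `[a, b], continuous (u \o real_line z k)}.
  apply: continuous_subspaceT => s; apply: differentiable_continuous.
  by apply/derivable1_diffP; have [] := dl s.
have [t0|t0|->] := ltgtP t 0; last first.
- by exists 0; [rewrite lexx ler01|rewrite real_line0 subrr mul0r].
- have [c] := MVT t0 (fun s _ => dl s) (cl _ _).
  rewrite in_itv/= => /andP[c0 ct]; rewrite /= real_line0 subr0 => E.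
  exists (c / t); first by rewrite ler_pdivrMr// ler_pdivlMr// mul0r mul1r !ltW.
  by rewrite E mulrC divfK// gt_eqF.
have [c] := MVT t0 (fun s _ => dl s) (cl _ _).
rewrite in_itv/= => /andP[c0 ct]; rewrite /= real_line0 sub0r => E.
exists (c / t).
  by rewrite ler_ndivrMr// ler_ndivlMr// mul0r mul1r !ltW.
by rewrite -opprB E mulrN opprK mulrC divfK// lt_eqF.
Qed.

(** One coordinate is changed at a time, with the mean value theorem on each edge, since only
    derivatives along coordinate lines are given. The points [xi k] stay in the coordinate box
    spanned by x and y, hence in any chart box containing both. *)
Lemma telescoping_mvt u x y : (forall k z, derivable (u \o real_line z k) 0 1) ->
  exists xi : I2 -> Cn,
    u x - u y = \sum_k (rc k x - rc k y) * real_partial k u (xi k) /\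
    forall k l, exists2 h : R, 0 <= h <= 1 & rc l (xi k) = rc l y + h * (rc l x - rc l y).
Proof.
move=> du.
pose mix (m : nat) := of_rc (fun k => if (k < m)%N then rc k x else rc k y).
have mixS k : mix k.+1 = real_line (mix k) k (rc k x - rc k y).
  apply: rc_inj => l; rewrite rc_line !of_rcK ltnS leq_eqVlt.
  have [->|lk] := eqVneq l k; first by rewrite eqxx ltnn/= addrC subrK.
  by rewrite (_ : (l == k :> nat) = false) ?addr0//; apply/negbTE.
have step k : exists xi, u (mix k.+1) - u (mix k) = (rc k x - rc k y) * real_partial k u xi /\
    forall l, exists2 h : R, 0 <= h <= 1 & rc l xi = rc l y + h * (rc l x - rc l y).
  rewrite mixS; have [h h01 E] := line_mvt u (mix k) k (rc k x - rc k y) (du k).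
  exists (real_line (mix k) k (h * (rc k x - rc k y))); split => // l.
  rewrite rc_line of_rcK; have [->|lk] := eqVneq l k; first by rewrite ltnn; exists h.
  case: ifP => _; [exists 1|exists 0]; rewrite ?lexx ?ler01// addr0 ?mul0r ?addr0//.
  by rewrite mul1r addrC subrK.
have /choice[xi hxi] := step; exists xi; split; last by move=> k; have [] := hxi k.
have -> : u x = u (mix (n + n)%N).
  by congr u; apply: rc_inj => l; rewrite of_rcK ltn_ord.
have -> : u y = u (mix 0%N) by congr u; apply: rc_inj => l; rewrite of_rcK.
rewrite -(telescope_sumr (fun m => u (mix m)))// big_mkord.
by apply: eq_bigr => k _; have [-> _] := hxi k.
Qed.

End real_coordinates.

(** * Charts of the boundary *)

Section chart.
Context {R : realType} {n : nat}.
Local Notation Cn := 'rV[R[i]]_n.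
Local Notation I2 := 'I_(n + n).
Implicit Types (x y z : Cn) (k l : I2) (u : Cn -> R).

Definition inbox (P0 : Cn) (r : R) z := forall k, `|rc k z - rc k P0| < r.

Definition grad u z : Cn := of_rc (fun k => real_partial k u z).

Definition nl1' k0 z : R := \sum_(k | k != k0) `|rc k z|.

(* A box around the boundary point P0 in which rho is controlled up to second
   order and is strictly monotone along the k0-th real coordinate. *)
Record chart (rho : Cn -> R) (P0 : Cn) (r M m0 s : R) (k0 : I2) : Prop := Chart {
  chart_r : 0 < r;
  chart_M : 0 < M;
  chart_m0 : 0 < m0;
  chart_s : `|s| = 1;
  chart_rho0 : rho P0 = 0;
  chart_cont : continuous rho;
  chart_d1 : forall k z, derivable (rho \o real_line z k) 0 1;
  chart_d2 : forall k l z, derivable (real_partial k rho \o real_line z l) 0 1;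
  chart_b1 : forall k z, inbox P0 r z -> `|real_partial k rho z| <= M;
  chart_b2 : forall k l z, inbox P0 r z ->
    `|real_partial l (real_partial k rho) z| <= M;
  chart_b3 : forall z, inbox P0 r z -> m0 <= s * real_partial k0 rho z }.

End chart.

Arguments chart_r {R n rho P0 r M m0 s k0}.
Arguments chart_M {R n rho P0 r M m0 s k0}.
Arguments chart_m0 {R n rho P0 r M m0 s k0}.
Arguments chart_s {R n rho P0 r M m0 s k0}.
Arguments chart_rho0 {R n rho P0 r M m0 s k0}.
Arguments chart_cont {R n rho P0 r M m0 s k0}.
Arguments chart_d1 {R n rho P0 r M m0 s k0}.
Arguments chart_d2 {R n rho P0 r M m0 s k0}.
Arguments chart_b1 {R n rho P0 r M m0 s k0}.
Arguments chart_b2 {R n rho P0 r M m0 s k0}.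
Arguments chart_b3 {R n rho P0 r M m0 s k0}.

Section chart_theory.
Context {R : realType} {n : nat}.
Local Notation Cn := 'rV[R[i]]_n.
Local Notation I2 := 'I_(n + n).
Implicit Types (x y z : Cn) (k l : I2) (u : Cn -> R).

Let ler_norm_near (a b M : R) : `|a - b| < 1 -> `|b| + 1 <= M -> `|a| <= M.
Proof. by have := lerB_dist a b; lra. Qed.

Lemma class_C2_chart (rho : Cn -> R) P0 : class_C 2 rho -> rho P0 = 0 ->
  real_gradient rho P0 != 0 ->
  exists r M m0 s k0, chart rho P0 r M m0 s k0.
Proof.
move=> [crho C1] rho0 /rV0Pn[k0 gk0].
have cp k : continuous (real_partial k rho) by have [_ []] := C1 k.
have cpp k l : continuous (real_partial l (real_partial k rho)).
  by have [_ [_ /(_ l)[_ []]]] := C1 k.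
pose g := real_partial k0 rho P0.
have g0 : g != 0 by move: gk0; rewrite mxE.
(* The summand 1 is room for the variation of the derivatives near P0. *)
pose M := 1 + \sum_k `|real_partial k rho P0| +
   \sum_k \sum_l `|real_partial l (real_partial k rho) P0|.
have cbnd (u : Cn -> R) (e : R) : {for P0, continuous u} -> 0 < e ->
    \forall z \near P0, `|u z - u P0| < e.
  move=> /Cn_continuousP cu e0; have [d d0 dH] := cu (e / 2) ltac:(by rewrite divr_gt0).
  by apply/nbhsCnP; exists d => // y /dH; lra.
have M1 k : `|real_partial k rho P0| + 1 <= M.
  rewrite /M (bigD1 k)//=.
  have : 0 <= \sum_(i | i != k) `|real_partial i rho P0| by apply: sumr_ge0.
  have : 0 <= \sum_k \sum_l `|real_partial l (real_partial k rho) P0|.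
    by apply: sumr_ge0 => i _; apply: sumr_ge0.
  lra.
have M2 k l : `|real_partial l (real_partial k rho) P0| + 1 <= M.
  rewrite /M; have : 0 <= \sum_k `|real_partial k rho P0| by apply: sumr_ge0.
  have : `|real_partial l (real_partial k rho) P0| <=
      \sum_k \sum_l `|real_partial l (real_partial k rho) P0|.
    apply: (@le_trans _ _ (\sum_l `|real_partial l (real_partial k rho) P0|)).
      by rewrite (bigD1 l)//= lerDl; apply: sumr_ge0 => i _; exact: normr_ge0.
    rewrite [leRHS](bigD1 k)//= lerDl; apply: sumr_ge0 => i _.
    by apply: sumr_ge0 => j _; exact: normr_ge0.
  set a := \sum_k `|_|; set b := \sum_k _; set c := `|_|; lra.
have : \forall z \near P0, (forall k, `|real_partial k rho z| <= M) /\
   (forall k l, `|real_partial l (real_partial k rho) z| <= M) /\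
   `|g| / 2 <= Num.sg g * real_partial k0 rho z.
  near=> z; split; last split.
  - move=> k; apply: ler_norm_near (M1 k).
    by move: k; near: z; apply: filter_forall => k; apply: cbnd => //; exact: cp.
  - move=> k l; apply: ler_norm_near (M2 k l).
    move: k l; near: z; apply: filter_forall => k; apply: filter_forall => l.
    by apply: cbnd => //; exact: cpp.
  - have gz : `|real_partial k0 rho z - g| < `|g| / 2.
      by near: z; apply: cbnd; [exact: cp|rewrite divr_gt0// normr_gt0].
    have -> : real_partial k0 rho z = g + (real_partial k0 rho z - g) by rewrite addrC subrK.
    rewrite mulrDr -normrEsg.
    have : `|Num.sg g * (real_partial k0 rho z - g)| < `|g| / 2.
      by rewrite normrM normr_sg g0 mul1r.
    by rewrite ltr_norml => /andP[+ _]; lra.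
move=> /nbhs_enormP[e e0 eP].
have N0 : 0 < (n + n)%:R :> R.
  by rewrite ltr0n; case: (n + n)%N k0 {gk0 g g0 eP} => [[]|].
(* With [s] the sign of the [k0]-th derivative, s times this derivative stays above half of its
   value |g| at P0. The radius is divided by 2n because the box bounds each coordinate
   separately. *)
exists (e / (n + n)%:R), M, (`|g| / 2), (Num.sg g), k0.
have inb z : inbox P0 (e / (n + n)%:R) z -> enorm (z - P0) < e.
  move=> zb; apply: (le_lt_trans (enorm_le_nl1 _)).
  apply: (@lt_le_trans _ _ (\sum_(k < n + n) e / (n + n)%:R)).
    apply: ltr_sum; last by move=> k _; rewrite rcB; exact: zb.
    by apply/hasP; exists k0; rewrite ?mem_index_enum.
  by rewrite sumr_const card_ord -[_ *+ _]mulr_natr divfK// lt0r_neq0.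
split.
- by rewrite divr_gt0.
- by apply: lt_le_trans (M1 k0); rewrite ltr_wpDl.
- by rewrite divr_gt0// normr_gt0.
- by rewrite normr_sg g0.
- exact: rho0.
- exact: crho.
- by move=> k; have [] := C1 k.
- by move=> k l; have [_ [_ /(_ l)[]]] := C1 k.
- by move=> k z /inb/eP[+ _]; apply.
- by move=> k l z /inb/eP[_ [+ _]]; apply.
- by move=> z /inb/eP[_ []].
Unshelve. all: by end_near. Qed.

Lemma inbox_between P0 r x y z :
  (forall l, exists2 h : R, 0 <= h <= 1 & rc l z = rc l y + h * (rc l x - rc l y)) ->
  inbox P0 r x -> inbox P0 r y -> inbox P0 r z.
Proof.
move=> hz xb yb l; have [h /andP[h0 h1] ->] := hz l.
have -> : rc l y + h * (rc l x - rc l y) - rc l P0 =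
  (1 - h) * (rc l y - rc l P0) + h * (rc l x - rc l P0) by ring.
have h1' : 0 <= 1 - h by rewrite subr_ge0.
apply: (le_lt_trans (ler_normD _ _)); rewrite !normrM (ger0_norm h1') (ger0_norm h0).
have [->|h1n] := eqVneq h 1; first by rewrite subrr mul0r add0r mul1r; exact: xb.
have h1lt : 0 < 1 - h by rewrite subr_gt0 lt_neqAle h1n.
have -> : r = (1 - h) * r + h * r by ring.
by apply: ltr_leD; [rewrite ltr_pM2l//; exact: yb|rewrite ler_wpM2l// ltW//; exact: xb].
Qed.

Lemma nl1_between x y z :
  (forall l, exists2 h : R, 0 <= h <= 1 & rc l z = rc l y + h * (rc l x - rc l y)) ->
  nl1 (z - y) <= nl1 (x - y).
Proof.
move=> hz; apply: ler_sum => l _; have [h /andP[h0 h1] E] := hz l.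
by rewrite !rcB E addrAC subrr add0r normrM ler_piMl// ger0_norm.
Qed.

Lemma lip_inbox P0 (r M : R) u x y : (forall k z, derivable (u \o real_line z k) 0 1) ->
  (forall k z, inbox P0 r z -> `|real_partial k u z| <= M) ->
  inbox P0 r x -> inbox P0 r y -> `|u x - u y| <= M * nl1 (x - y).
Proof.
move=> du bu xb yb; have [xi [-> hxi]] := telescoping_mvt u x y du.
rewrite /nl1 mulr_sumr; apply: (le_trans (ler_norm_sum _ _ _)); apply: ler_sum => k _.
rewrite normrM mulrC -rcB ler_wpM2r//; apply: bu.
exact: inbox_between (hxi k) xb yb.
Qed.

Context (rho : Cn -> R) (P0 : Cn) (r M m0 s : R) (k0 : I2).
Hypothesis Ch : chart rho P0 r M m0 s k0.

Lemma chart_lip x y : inbox P0 r x -> inbox P0 r y -> `|rho x - rho y| <= M * nl1 (x - y).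
Proof.
move=> xb yb; apply: (@lip_inbox P0 r) => //.
  by move=> k z; exact: (chart_d1 Ch).
by move=> k z; exact: (chart_b1 Ch).
Qed.

(** The Taylor remainder is M times the square of the l^1 norm; each of the two factors costs 2n on
    passing to the Euclidean norm. *)
Definition chartA : R := M * (n + n)%:R ^+ 2.

Lemma chart_taylor x y : inbox P0 r x -> inbox P0 r y ->
  rho y + cdot (grad rho y) (x - y) - chartA * sqn (x - y) <= rho x.
Proof.
move=> xb yb; have [xi [E hxi]] := telescoping_mvt rho x y (chart_d1 Ch).
have M0 := ltW (chart_M Ch).
suff : `|rho x - rho y - cdot (grad rho y) (x - y)| <= chartA * sqn (x - y).
  by rewrite ler_norml => /andP[+ _]; lra.
rewrite E cdot_rc -sumrB; apply: (@le_trans _ _ (M * nl1 (x - y) ^+ 2)).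
  have -> : M * nl1 (x - y) ^+ 2 = \sum_k (M * nl1 (x - y)) * `|rc k (x - y)|.
    by rewrite -mulr_sumr -/(nl1 _); ring.
  apply: (le_trans (ler_norm_sum _ _ _)); apply: ler_sum => k _.
  rewrite of_rcK [in X in _ - X]rcB [real_partial k rho y * _]mulrC -mulrBr normrM mulrC -rcB
    ler_wpM2r//.
  apply: le_trans (ler_wpM2l M0 (nl1_between _ _ _ (hxi k))).
  apply: (@lip_inbox P0 r) => //; last exact: inbox_between (hxi k) xb yb.
  - by move=> l z; exact: (chart_d2 Ch).
  - by move=> l z; exact: (chart_b2 Ch).
rewrite /chartA -mulrA ler_wpM2l// -enorm_sqr -exprMn.
by rewrite ler_pXn2r ?nnegrE ?nl1_ge0 ?mulr_ge0 ?enorm_ge0 ?nl1_le_enorm.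
Qed.

Lemma chart_grad_ge y : inbox P0 r y -> m0 <= enorm (grad rho y).
Proof.
move=> yb; apply: le_trans (rc_le_enorm k0 _); rewrite of_rcK.
have := chart_b3 Ch _ yb; have := ler_norm (s * real_partial k0 rho y).
by rewrite normrM (chart_s Ch) mul1r; lra.
Qed.

Lemma chart_grad_le y : inbox P0 r y -> enorm (grad rho y) <= (n + n)%:R * M.
Proof.
move=> yb; apply: (le_trans (enorm_le_nl1 _)).
apply: (@le_trans _ _ (\sum_(k < n + n) M)).
  by apply: ler_sum => k _; rewrite of_rcK; exact: (chart_b1 Ch).
by rewrite sumr_const card_ord mulr_natl.
Qed.

Definition chartC : R := (1 + M + m0) / m0.

(** The mean value identity is solved for the [k0]-th coordinate, where the derivative has size at
    least [m0]. *)
Lemma chart_cone x y : inbox P0 r x -> inbox P0 r y ->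
  enorm (x - y) <= chartC * (`|rho x - rho y| + nl1' k0 (x - y)).
Proof.
move=> xb yb; have [xi [E hxi]] := telescoping_mvt rho x y (chart_d1 Ch).
have mp := chart_m0 Ch; have Mp := chart_M Ch.
have n0 : 0 <= nl1' k0 (x - y) by apply: sumr_ge0.
have h1 : m0 * `|rc k0 (x - y)| <= `|rho x - rho y| + M * nl1' k0 (x - y).
  rewrite (bigD1 k0)//= in E.
  have {}E : (rc k0 x - rc k0 y) * real_partial k0 rho (xi k0) = rho x - rho y -
     \sum_(k | k != k0) (rc k x - rc k y) * real_partial k rho (xi k) by rewrite E addrK.
  apply: (@le_trans _ _ `|(rc k0 x - rc k0 y) * real_partial k0 rho (xi k0)|).
    rewrite normrM mulrC rcB ler_wpM2l//.
    have := chart_b3 Ch _ (inbox_between _ _ _ _ _ (hxi k0) xb yb).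
    have := ler_norm (s * real_partial k0 rho (xi k0)).
    by rewrite normrM (chart_s Ch) mul1r; lra.
  rewrite E; apply: (le_trans (ler_normB _ _)); rewrite lerD2l.
  rewrite /nl1' mulr_sumr; apply: (le_trans (ler_norm_sum _ _ _)); apply: ler_sum => k _.
  rewrite normrM mulrC -rcB ler_wpM2r//; apply: (chart_b1 Ch).
  exact: inbox_between (hxi k) xb yb.
apply: (le_trans (enorm_le_nl1 _)); rewrite /nl1 (bigD1 k0)//= -/(nl1' k0 (x - y)).
rewrite /chartC mulrAC ler_pdivlMr//; have := normr_ge0 (rho x - rho y); nra.
Qed.

Lemma chart_down y (t : R) : inbox P0 r y -> 0 <= t ->
  inbox P0 r (real_line y k0 (- (s * t))) ->
  rho (real_line y k0 (- (s * t))) <= rho y - m0 * t.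
Proof.
move=> yb t0 xb; have [h h01 E] := line_mvt rho y k0 (- (s * t)) (chart_d1 Ch k0).
have := chart_b3 Ch _ (inbox_between P0 r (real_line y k0 (- (s * t))) y
   (real_line y k0 (h * - (s * t))) _ xb yb).
have -> : rho (real_line y k0 (- (s * t))) = rho y +
    - (s * t) * real_partial k0 rho (real_line y k0 (h * - (s * t))) by rewrite -E addrC subrK.
set D := real_partial _ _ _ => hD; suff : m0 <= s * D by nra.
apply: hD => l; exists h => //; rewrite !rc_line.
by case: (l == k0); ring.
Qed.

(** The existence part of the implicit function theorem with explicit sizes: at the base point |rho|
    <= m0 r / 2, and moving by r / 2 along the [k0]-th coordinate changes [rho] by at least that
    much in either direction, so the intermediate value theorem applies. *)
Lemma chart_graph (d : R) (v : I2 -> R) : 0 <= d -> (n + n)%:R * M * d <= m0 * (r / 2) -> d <=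
  r / 2 ->
  (forall k, k != k0 -> `|v k - rc k P0| <= d) ->
  exists y, [/\ inbox P0 r y, rho y = 0, forall k, k != k0 -> rc k y = v k &
    `|rc k0 y - rc k0 P0| <= r / 2].
Proof.
move=> d0 dM dr hv; have rp := chart_r Ch; have mp := chart_m0 Ch; have Mp := chart_M Ch.
pose b : Cn := of_rc (fun k => if k == k0 then rc k0 P0 else v k).
have bk k : `|rc k b - rc k P0| <= r / 2 /\ (k != k0 -> `|rc k b - rc k P0| <= d).
  rewrite of_rcK; have [->|kk0] := eqVneq k k0.
    by rewrite subrr normr0; split => //; rewrite divr_ge0// ltW.
  by split; last move=> _; [apply: (le_trans (hv _ kk0))|exact: hv].
have bt t : `|t| <= r / 2 -> inbox P0 r (real_line b k0 t).
  move=> tr k; rewrite rc_line; have [->|kk0] := eqVneq k k0.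
    by rewrite of_rcK eqxx addrAC subrr add0r; lra.
  by rewrite addr0; have [] := bk k; lra.
have bb : inbox P0 r b by rewrite -(real_line0 b k0); apply: bt; rewrite normr0 divr_ge0// ltW.
have PP : inbox P0 r P0 by move=> k; rewrite subrr normr0.
have rb : `|rho b| <= m0 * (r / 2).
  have := chart_lip b P0 bb PP; rewrite (chart_rho0 Ch) subr0 => /le_trans; apply.
  apply: le_trans dM; rewrite [_%:R * M]mulrC -mulrA; apply: ler_wpM2l; first exact: ltW.
  apply: (@le_trans _ _ (\sum_(k < n + n) d)); last by rewrite sumr_const card_ord mulr_natl.
  apply: ler_sum => k _; rewrite rcB; have [->|kk0] := eqVneq k k0; last exact: (bk k).2.
  by rewrite of_rcK eqxx subrr normr0.
pose g t := rho (real_line b k0 t).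
have cg : continuous g.
  move=> t; apply: differentiable_continuous; apply/derivable1_diffP.
  by have [] := is_derive_line rho b k0 t (chart_d1 Ch k0).
have r2 : 0 <= r / 2 by rewrite divr_ge0// ltW.
have ss : s * s = 1 by rewrite -expr2 -[s ^+ 2]real_normK ?num_real// (chart_s Ch) expr1n.
have g1 : g (s * (r / 2)) >= 0 /\ g (- (s * (r / 2))) <= 0.
  have n1 : `|s * (r / 2)| <= r / 2 by rewrite normrM (chart_s Ch) mul1r ger0_norm.
  have h1 := chart_down (real_line b k0 (s * (r / 2))) (r / 2) (bt _ n1) r2.
  rewrite real_lineD addNr real_line0 in h1; have {}h1 := h1 bb.
  have h2 := chart_down b (r / 2) bb r2 (bt _ _); rewrite normrN in h2; have {}h2 := h2 n1.
  by move: rb; rewrite /g ler_norml => /andP[]; lra.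
have [t tr gt] : exists2 t, `|t| <= r / 2 & g t = 0.
  have rr : - (r / 2) <= r / 2 by lra.
  have cg' : {within `[- (r / 2), r / 2], continuous g} by exact: continuous_subspaceT.
  have [] := IVT (v := 0) rr cg'.
    have [s1|s1] : s = 1 \/ s = -1.
      by move/eqP: ss; rewrite -expr2 sqrf_eq1 => /orP[]/eqP ->; [left|right].
    - move: g1 => [+ +]; rewrite s1 !mul1r ge_min le_max => p1 p2.
      apply/andP; split; apply/orP; [left; exact: p2|right; exact: p1].
    - move: g1 => [+ +]; rewrite s1 !mulN1r opprK ge_min le_max => p1 p2.
      apply/andP; split; apply/orP; [right; exact: p2|left; exact: p1].
  by move=> t; rewrite in_itv/= -ler_norml; exists t.
exists (real_line b k0 t); split=> [|//|k kk0|]; first exact: bt.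
  by rewrite rc_line (negbTE kk0) addr0 of_rcK (negbTE kk0).
by rewrite rc_line eqxx of_rcK eqxx addrAC subrr add0r.
Qed.

End chart_theory.

(** * Coding of dyadic cubes *)

Section cube_codes.
Local Open Scope nat_scope.
Context {I : finType}.
Implicit Types (v w : I -> nat).

Definition nchild : nat := #|{ffun I -> bool}|.

(* Codes the dyadic cube of level k with integer coordinates v by a natural
   number below nchild ^ k, in such a way that the code of the parent cube is
   the quotient by nchild: cubes become nchild-adic intervals. *)
Fixpoint code (k : nat) v : nat :=
  if k is k'.+1 then
    code k' (fun l => (v l)./2) * nchild + enum_rank [ffun l => odd (v l)]
  else 0.

Lemma nchildE : nchild = 2 ^ #|I|.
Proof. by rewrite /nchild card_ffun card_bool. Qed.

Lemma code_div k v : code k.+1 v %/ nchild = code k (fun l => (v l)./2).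
Proof.
rewrite /= divnMDl ?divn_small ?addn0 ?ltn_ord//.
by rewrite nchildE expn_gt0.
Qed.

(** The code of level k reads the k lowest binary digits of each coordinate, which is everything
    below 2^k. *)
Lemma code_inj k v w : (forall l, v l < 2 ^ k)%N -> (forall l, w l < 2 ^ k)%N ->
  code k v = code k w -> v =1 w.
Proof.
elim: k v w => [|k IH] v w vk wk E l.
  by move: (vk l) (wk l); rewrite expn0 !ltnS !leqn0 => /eqP -> /eqP ->.
have half_lt (u : I -> nat) : (forall l, u l < 2 ^ k.+1)%N -> forall l, ((u l)./2 < 2 ^ k)%N.
  by move=> uk i; rewrite -divn2 ltn_divLR// -expnSr.
have Eh : code k (fun l => (v l)./2) = code k (fun l => (w l)./2) by rewrite -!code_div E.
have := IH _ _ (half_lt _ vk) (half_lt _ wk) Eh l.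
move: E; rewrite /= Eh => /addnI/ord_inj/enum_rank_inj/ffunP/(_ l).
by rewrite !ffunE => Eo Eh'; rewrite -(odd_double_half (v l)) Eo Eh' odd_double_half.
Qed.

End cube_codes.

(** * Comparison with Lebesgue measure through adic cells *)

Section adic_comparison.
Context {R : realType}.
Local Open Scope ereal_scope.

Lemma eseries_finite (f : nat -> \bar R) (m : nat) : (forall i, 0 <= f i) ->
  (forall i, (m <= i)%N -> f i = 0) -> \sum_(i <oo) f i = \sum_(i < m) f i.
Proof.
move=> f0 fm; rewrite (nneseries_split 0 m); last by move=> k _; exact: f0.
rewrite add0n big_mkord eseries0 ?adde0// => i mi _.
exact: fm.
Qed.

Variables (M : nat) (nu : set R -> \bar R) (C : R) (K1 : nat).
Hypothesis M_gt1 : (1 < M)%N.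
Hypothesis C_gt0 : (0 < C)%R.

Definition cell (k c : nat) : set R :=
  `[(c%:R / M%:R ^+ k)%R, (c.+1%:R / M%:R ^+ k)%R[%classic.

Hypothesis nu0 : nu set0 = 0.
Hypothesis nu_ge0 : forall X, 0 <= nu X.
Hypothesis nu_sub : measurable_subset_sigma_subadditive nu.
Hypothesis nu_cell : forall k c, (K1 <= k)%N -> nu (cell k c) <= (C / M%:R ^+ k)%:E.

Lemma pow_base_gt0 k : (0 < M%:R ^+ k :> R)%R.
Proof. by rewrite exprn_gt0// ltr0n ltnW. Qed.

Lemma le_pow_base k : (2 ^+ k <= M%:R ^+ k :> R)%R.
Proof. by rewrite lerXn2r// ?nnegrE ?ler_nat// ler0n. Qed.

(** At most (b - a) M^k + 2 cells of level k cover the interval, and the excess 2 C / M^k vanishes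
    as k grows. *)
Lemma nu_interval (a b : R) : (0 <= a)%R -> (a <= b)%R ->
  nu `[a, b[%classic <= (C * (b - a))%:E.
Proof.
move=> a0 ab; apply/lee_addgt0Pr => e e0.
have [n nP] := divr_exp2_small (2 * C) e e0.
pose k := maxn n K1; have nk : (n <= k)%N by exact: leq_maxl.
have Kk : (K1 <= k)%N by exact: leq_maxr.
have Mk := pow_base_gt0 k.
have Mke : (2 * C / M%:R ^+ k < e)%R.
  apply: le_lt_trans (nP _ nk); rewrite ler_wpM2l ?mulr_ge0 ?(ltW C_gt0)//.
  by rewrite lef_pV2 ?posrE// ?exprn_gt0// le_pow_base.
pose c0 := Num.truncn (a * M%:R ^+ k); pose c1 := Num.truncn (b * M%:R ^+ k).
have aM : (0 <= a * M%:R ^+ k)%R by rewrite mulr_ge0// ltW.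
have bM : (0 <= b * M%:R ^+ k)%R by apply: mulr_ge0; [exact: le_trans a0 ab|exact: ltW].
have c01 : (c0 <= c1)%N by apply: le_truncn; rewrite ler_pM2r.
pose m := (c1 - c0).+1.
pose A i := if (i < m)%N then cell k (c0 + i) else set0.
have mA i : measurable (A i) by rewrite /A; case: ifP => _ //; exact: measurable_itv.
have sub : `[a, b[%classic `<=` \bigcup_i A i.
  move=> x; rewrite /= in_itv/= => /andP[ax xb].
  have xM : (0 <= x * M%:R ^+ k)%R by apply: mulr_ge0; [exact: le_trans a0 ax|exact: ltW].
  have := truncn_itv xM; set c := Num.truncn _ => /andP[cx xc].
  have c0c : (c0 <= c)%N by apply: le_truncn; rewrite ler_pM2r.
  have cc1 : (c <= c1)%N by apply: le_truncn; rewrite ler_pM2r// ltW.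
  exists (c - c0)%N => //; rewrite /A ifT; last by rewrite /m ltnS leq_sub2r.
  rewrite subnKC// /cell/= in_itv/= ler_pdivrMr// ltr_pdivlMr// cx/=.
  exact: xc.
apply: (le_trans (nu_sub _ _ mA (measurable_itv _) sub)).
rewrite (eseries_finite _ m); last 2 first.
- by move=> i; exact: nu_ge0.
- by move=> i mi; rewrite /A ltnNge mi.
apply: (@le_trans _ _ (\sum_(i < m) (C / M%:R ^+ k)%:E)).
  by apply: lee_sum => i _; rewrite /A ltn_ord; exact: nu_cell.
rewrite sumEFin sumr_const card_ord -EFinD lee_fin -[(_ *+ m)%R]mulr_natl.
have hc0 : (a * M%:R ^+ k < c0%:R + 1)%R.
  by have /andP[_] := truncn_itv aM; rewrite -natr1.
have hc1 : (c1%:R <= b * M%:R ^+ k)%R by have /andP[] := truncn_itv bM.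
have mE : (m%:R = c1%:R - c0%:R + 1 :> R)%R by rewrite /m -natr1 natrB.
have : (m%:R <= (b - a) * M%:R ^+ k + 2 :> R)%R by rewrite mE mulrBl; lra.
move=> mle; apply: (le_trans (ler_wpM2r (ltW (divr_gt0 C_gt0 Mk)) mle)).
have -> : (((b - a) * M%:R ^+ k + 2) * (C / M%:R ^+ k) = C * (b - a) + 2 * C / M%:R ^+ k)%R.
  by field; exact: lt0r_neq0.
by rewrite lerD2l ltW.
Qed.

(** Serves twice: for the outer area of preimages, to show that a set on the line is not null, and
    for the restriction of Lebesgue measure to that set, to find a cell of high density. Only levels
    from [K1] on enter, so this cell can be made as fine as desired. *)
Lemma nu_le_lebesgue (D : set R) : measurable D -> D `<=` `[0, +oo[%classic%R ->
  nu D <= C%:E * lebesgue_measure D.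
Proof.
move=> mD D0; have [->|Dfin] := eqVneq (lebesgue_measure D) +oo.
  by rewrite gt0_muley ?leey// lte_fin.
pose S := [set \sum_(k <oo) (@wlength R idfun) (F k) | F in open_itv_cover D].
have DE : lebesgue_measure D = ereal_inf S.
  exact: outer_measure_open_itv_cover.
have {}Dfin : lebesgue_measure D \is a fin_num.
  by rewrite ge0_fin_numE ?measure_ge0// ltey.
apply/lee_addgt0Pr => e e0.
have eC : (0 < e / C)%R by rewrite divr_gt0.
have Sfin : ereal_inf S \is a fin_num by rewrite -DE.
have [_ [F [Fitv DF] <-]] := lb_ereal_inf_adherent eC Sfin; rewrite -DE => lt.
pose a k := (sval (cid (Fitv k))).1; pose b k := (sval (cid (Fitv k))).2.
have FE k : F k = `]a k, b k[%classic by rewrite /a /b; case: cid.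
(* Cells cover only the half line from 0, so the covering intervals are cut off there; closing them
   on the left merely enlarges them. *)
pose J k : set R := `[Num.max (a k) 0, Num.max (b k) 0[%classic%R.
have DJ : D `<=` \bigcup_k J k.
  move=> x Dx; have [k _] := DF _ Dx; rewrite FE/= in_itv/= => /andP[ax xb].
  exists k => //; rewrite /J/= in_itv/= ge_max lt_max xb ltW//=.
  by have := D0 _ Dx; rewrite /= in_itv/= andbT => ->.
apply: (le_trans (nu_sub _ _ _ mD DJ)); first by move=> k; exact: measurable_itv.
apply: (@le_trans _ _ (\sum_(k <oo) (C%:E * wlength idfun (F k)))).
  apply: lee_nneseries => [k _ _|k _]; first exact: nu_ge0.
  rewrite FE wlength_itv/= lte_fin.
  have [ab|ba] := ltP (a k) (b k).
    apply: le_trans (nu_interval _ _ _ _) _.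
    - by rewrite le_max lexx orbT.
    - by rewrite ge_max !le_max lexx (ltW ab) orbT.
    rewrite -EFinB -EFinM lee_fin ler_pM2l//.
    by rewrite /Num.max; case: ifP; case: ifP; lra.
  rewrite mule0 /J set_itv_ge ?nu0//= bnd_simp -leNgt.
  by rewrite ge_max !le_max lexx ba orbT.
rewrite nneseriesZl; last by move=> i _; rewrite wlength_ge0.
apply: (@le_trans _ _ (C%:E * (lebesgue_measure D + (e / C)%:E))).
  by rewrite lee_pmul2l ?lte_fin// ltW.
rewrite ge0_muleDr ?measure_ge0 ?lee_fin ?(ltW eC)// leeD2l// -EFinM lee_fin.
by rewrite mulrC divfK// gt_eqF.
Qed.

End adic_comparison.

(** * A cell with few bad subcells *)

Section density_cell.
Context {R : realType} {n : nat}.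
Local Notation Cn := 'rV[R[i]]_n.
Variables (M : nat) (S : set Cn) (a : nat -> Cn -> nat) (C0 : R).
Hypothesis M_gt1 : (1 < M)%N.
Hypothesis ME : M = (2 ^ (2 * n).-1)%N.
Hypothesis a0 : forall P, a 0 P = 0%N.
Hypothesis aS : forall k P, (a k.+1 P %/ M)%N = a k P.
Hypothesis C0_ge0 : 0 <= C0.
Hypothesis a_diam : forall k P P', S P -> S P' -> a k P = a k P' ->
  enorm (P - P') <= C0 / 2 ^+ k.

Let Mpos k : 0 < M%:R ^+ k :> R.
Proof. exact: pow_base_gt0. Qed.

Let a_range k i P : (a k P * M ^ i <= a (k + i) P)%N /\ (a (k + i) P < (a k P).+1 * M ^ i)%N.
Proof.
elim: i => [|i [IH1 IH2]]; first by rewrite addn0 expn0 !muln1 ltnS.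
have M0 : (0 < M)%N := ltnW M_gt1.
rewrite addnS expnSr !mulnA; split.
  by rewrite -leq_divRL// aS.
by rewrite -ltn_divLR// aS.
Qed.

Let a_rangeR k i P : (a k P)%:R / M%:R ^+ k <= (a (k + i) P)%:R / M%:R ^+ (k + i) :> R /\
  (a (k + i) P)%:R / M%:R ^+ (k + i) <= (a k P).+1%:R / M%:R ^+ k :> R.
Proof.
have [h1 h2] := a_range k i P; have Mi := Mpos i; have Mk := Mpos k.
split; rewrite ler_pdivrMr// mulrAC ler_pdivlMr// exprD.
  by rewrite mulrCA [leRHS]mulrC ler_pM2l// -natrX -natrM ler_nat.
by rewrite [leRHS]mulrCA [leLHS]mulrC ler_pM2l// -natrX -natrM ler_nat ltnW.
Qed.

(* Sends the nested cells of P to nested adic intervals of [0, 1]. *)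
Definition adic_point P : R := sup (range (fun k => (a k P)%:R / M%:R ^+ k)).

Let adic_pointP k P :
  (a k P)%:R / M%:R ^+ k <= adic_point P <= (a k P).+1%:R / M%:R ^+ k.
Proof.
have ub j i : (a i P)%:R / M%:R ^+ i <= (a j P).+1%:R / M%:R ^+ j :> R.
  have [ij|ji] := leqP i j.
    have [+ _] := a_rangeR i (j - i) P; rewrite subnKC// => /le_trans; apply.
    by rewrite ler_pM2r ?invr_gt0// ler_nat.
  by have [_] := a_rangeR j (i - j) P; rewrite subnKC// ltnW.
apply/andP; split.
  by apply: ub_le_sup; [exists ((a 0 P).+1%:R / M%:R ^+ 0) => _ [i _ <-]|exists k].
by apply: ge_sup; [exists ((a 0 P)%:R / M%:R ^+ 0), 0%N|move=> _ [i _ <-]].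
Qed.

Let d := (2 * n).-1.
(** The factor 2 bounds (m + 1) / m, where m + 1 counts the subcells in [nu_cell]; the summand 1
    makes [C] positive even if [C0] is 0. *)
Let C : R := 2 * (unit_ball_volume R d * (C0 / 2) ^+ d) + 1.

Let C_gt0 : 0 < C.
Proof.
rewrite /C ltr_wpDl// mulr_ge0// mulr_ge0 ?unit_ball_volume_ge0//.
by rewrite exprn_ge0// divr_ge0.
Qed.

(** As M = 2^d, the d-th power of a diameter O (2^(- k)) is O (M^(- k)), the length of an adic
    cell. *)
Let gauge_le k (U : set Cn) : U `<=` S -> (forall P P', U P -> U P' -> a k P = a k P') ->
  (hausdorff_gauge d U <= (unit_ball_volume R d * (C0 / 2) ^+ d / M%:R ^+ k)%:E)%E /\
  (diameter U <= (C0 / 2 ^+ k)%:E)%E.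
Proof.
move=> US Ua; have dU : (diameter U <= (C0 / 2 ^+ k)%:E)%E.
  apply: ge_ereal_sup => _ [P UP] [P' UP'] <-; rewrite lee_fin.
  by apply: a_diam; [exact: US|exact: US|exact: Ua].
split=> //; rewrite /hausdorff_gauge; case: eqP => [_|/eqP/set0P[P UP]].
  rewrite lee_fin divr_ge0// ?(ltW (Mpos _))// mulr_ge0 ?unit_ball_volume_ge0//.
  by rewrite exprn_ge0// divr_ge0.
have dU0 : (0 <= diameter U)%E.
  apply: (@le_trans _ _ (enorm (P - P))%:E); first by rewrite lee_fin enorm_ge0.
  by apply: ereal_sup_ubound; exists P => //; exists P.
have [r rE r0] : exists2 r : R, diameter U = r%:E & 0 <= r.
  move: dU dU0; case: (diameter U) => [r| |]//= dU dU0.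
  by exists r.
rewrite rE -EFinM -EFin_expe -EFinM lee_fin -mulrA ler_wpM2l ?unit_ball_volume_ge0//.
have r1 : r <= C0 / 2 ^+ k by move: dU; rewrite rE lee_fin.
have -> : (C0 / 2) ^+ d / M%:R ^+ k = (C0 / 2 ^+ k / 2) ^+ d.
  rewrite ME natrX -exprM mulnC exprM -expr_div_n; congr (_ ^+ _).
  by field; rewrite ?expf_neq0.
by rewrite lerXn2r ?nnegrE ?divr_ge0 ?exprn_ge0// ler_wpM2r.
Qed.

Let nu X := area_outer R n (S `&` adic_point @^-1` X).

(** The content has to be bounded at every size e, so the cell is divided down to a level where
    diameters fall below e; up to the factor (m + 1) / m the total gauge does not depend on that
    level. *)
Let nu_cell k c : (0 <= k)%N -> (nu (cell M k c) <= (C / M%:R ^+ k)%:E)%E.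
Proof.
move=> _; apply: ge_ereal_sup => _ [e /= e0 <-].
have [N NP] := divr_exp2_small C0 e e0; pose i := maxn N k.
have ki : (k <= i)%N by exact: leq_maxr.
pose m := (M ^ (i - k))%N.
have MiE : M%:R ^+ i = m%:R * M%:R ^+ k :> R by rewrite /m natrX -exprD subnK.
have m0 : 0 < m%:R :> R by rewrite ltr0n expn_gt0 (ltnW M_gt1).
(* A point with code c m - 1 may be sent to the right end of its interval, which belongs to
   [cell M k c]. The list therefore starts one subcell earlier and has m + 1 members. *)
pose U j : set Cn := if (j < m.+1)%N then
  S `&` [set P | a i P = ((c * m).-1 + j)%N] else set0.
have US j : U j `<=` S by rewrite /U; case: ifP => _ // P [].
have Ua j P P' : U j P -> U j P' -> a i P = a i P'.
  by rewrite /U; case: ifP => _ // [_ /= ->] [_ /= ->].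
apply: (@le_trans _ _ (\sum_(j <oo) hausdorff_gauge d (U j))%E).
  apply: ereal_inf_lbound; exists U => //; split.
    move=> j; have [_ /le_trans] := gauge_le i _ (US j) (Ua j); apply.
    by rewrite lee_fin ltW// NP// leq_maxl.
  move=> P [SP /=]; rewrite /cell/= in_itv/= => /andP[cP Pc].
  have /andP[aP Pa] := adic_pointP i P.
  have h1 : (a i P < c.+1 * m)%N.
    have := le_lt_trans aP Pc; rewrite MiE invfM mulrA ltr_pM2r ?invr_gt0//.
    by rewrite ltr_pdivrMr// -natrM ltr_nat.
  have h2 : (c * m <= (a i P).+1)%N.
    have := le_trans cP Pa; rewrite MiE invfM mulrA ler_pM2r ?invr_gt0//.
    by rewrite ler_pdivlMr// -natrM ler_nat.
  exists (a i P - (c * m).-1)%N => //; rewrite /U ifT; last first.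
    by move: h1; rewrite mulSn; lia.
  by split => //=; rewrite subnKC//; lia.
rewrite (eseries_finite _ m.+1); last 2 first.
- by move=> j; exact: hausdorff_gauge_ge0.
- by move=> j mj; rewrite /U ltnNge mj /hausdorff_gauge eqxx.
pose g := unit_ball_volume R d * (C0 / 2) ^+ d.
have g0 : 0 <= g by rewrite mulr_ge0 ?unit_ball_volume_ge0// exprn_ge0// divr_ge0.
apply: (@le_trans _ _ (\sum_(j < m.+1) (g / M%:R ^+ i)%:E)%E).
  by apply: lee_sum => j _; have [] := gauge_le i _ (US j) (Ua j).
rewrite sumEFin sumr_const card_ord lee_fin -[(_ *+ _)%R]mulr_natl MiE.
have m1 : 1 <= m%:R :> R by rewrite ler1n expn_gt0 (ltnW M_gt1).
have -> : m.+1%:R * (g / (m%:R * M%:R ^+ k)) = m.+1%:R / m%:R * g / M%:R ^+ k.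
  by field; rewrite !lt0r_neq0.
rewrite ler_pM2r ?invr_gt0// /C -/g; apply: (@le_trans _ _ (2 * g)); last by rewrite lerDl.
by rewrite ler_wpM2r// ler_pdivrMr// -natr1; lra.
Qed.

(** The cell is found before L, since D collects for every L at once the points covered by good
    cells at all sufficiently fine levels. For a given L the sets [F j] increase to the part of D in
    the cell, so a single level already covers more than 1 - eta of the cell. *)
Theorem density_cell (G : nat -> nat -> set nat) (eta : R) K1 :
  (0 < area_outer R n S)%E -> 0 < eta < 1 ->
  (forall P, S P -> forall L, exists j, forall k, (j <= k)%N -> G L k (a k P)) ->
  exists k0 c0, (K1 <= k0)%N /\ forall L K2, exists k, [/\ (K2 <= k)%N, (k0 <= k)%N &
    #|[pred i : 'I_(M ^ (k - k0)) | ~~ `[< G L k (c0 * M ^ (k - k0) + i)%N >] ]|%:R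
      <= eta * M%:R ^+ (k - k0)].
Proof.
move=> S0 /andP[eta0 eta1] hG.
(* Closed cells, because [adic_point] may be the right end of its cell. *)
pose ccell k c : set R := `[c%:R / M%:R ^+ k, c.+1%:R / M%:R ^+ k]%classic.
have mcc k c : measurable (ccell k c) by exact: measurable_itv.
pose U L k := \bigcup_(c in G L k) ccell k c.
have mU L k : measurable (U L k) by apply: bigcup_measurable => c _.
pose D := (\bigcap_L \bigcup_j \bigcap_(k in [set k | (j <= k)%N]) U L k) `&` `[0, 1]%classic.
have mD : measurable D.
  apply: measurableI; last exact: measurable_itv.
  apply: bigcap_measurable => // L _; apply: bigcup_measurable => j _.
  by apply: bigcap_measurable => //; exists j => /=.
have SD P : S P -> D (adic_point P).
  move=> SP; split.
    move=> L _; have [j hj] := hG P SP L; exists j => // k /= jk.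
    exists (a k P); first exact: hj.
    by rewrite /ccell/= in_itv/= adic_pointP.
  have := adic_pointP 0 P; rewrite a0 expr0 !divr1 /= in_itv/=.
  by rewrite mulr0n mulr1n.
have D_gt0 : (0 < lebesgue_measure D)%E.
  rewrite lt_neqAle measure_ge0 andbT; apply/eqP => Dz.
  suff /(lt_le_trans S0) : (area_outer R n S <= 0)%E by rewrite ltxx.
  have := @nu_le_lebesgue R M nu C 0 M_gt1 C_gt0 _ _ _ nu_cell D mD _.
  rewrite -Dz mule0 => H; apply: le_trans (H _ _ _ _).
  - by apply: le_outer_measure => P SP; split => //; exact: SD.
  - by rewrite /nu preimage_set0 setI0 outer_measure0.
  - by move=> X; exact: outer_measure_ge0.
  - move=> X A mA mX XA; apply: le_trans (outer_measure_sigma_subadditive _ _).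
    apply: le_outer_measure => P [SP /= /XA[k _ Ak]]; exists k => //.
  - by move=> x [_ /=]; rewrite !in_itv/= => /andP[->].
have D_lty : (lebesgue_measure D < +oo)%E.
  apply: (@le_lt_trans _ _ (lebesgue_measure (`[0, 1]%classic : set R))).
    by apply: le_measure; rewrite ?inE// => x [].
  by rewrite lebesgue_measure_itv/= lte01 sube0 ltey.
(* Otherwise [nu_le_lebesgue] with the constant 1 - eta bounds the measure of D, positive and
   finite, by a smaller number. *)
have [k0 [c0 [K1k0 dens]]] : exists k0 c0, (K1 <= k0)%N /\
    (((1 - eta) / M%:R ^+ k0)%:E < lebesgue_measure (D `&` cell M k0 c0))%E.
  apply: contrapT => H.
  have e1 : 0 < 1 - eta by rewrite subr_gt0.
  have := @nu_le_lebesgue R M (fun X => lebesgue_measure (D `&` X)) (1 - eta) K1 M_gt1 e1 _ _ _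
    _ D mD _.
  have : ~ (lebesgue_measure D <= (1 - eta)%:E * lebesgue_measure D)%E.
    have Df : lebesgue_measure D \is a fin_num by rewrite ge0_fin_numE ?measure_ge0.
    move: D_gt0; rewrite -(fineK Df) lte_fin -EFinM lee_fin => Dp.
    by apply/negP; rewrite -ltNge gtr_pMl// ltrBlDr ltrDl.
  move=> + nu_le; apply; rewrite -{1}(setIid D); apply: nu_le.
  - by rewrite setI0 measure0.
  - by move=> X; exact: measure_ge0.
  - move=> X A mA mX XA; apply: measure_sigma_subadditive => //.
    + by move=> i; apply: measurableI; [exact: mD|exact: mA].
    + by apply: measurableI; [exact: mD|exact: mX].
    + by move=> x [Dx /XA[i _ Aix]]; exists i.
  - move=> k c Kk; rewrite leNgt; apply/negP => lt; apply: H.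
    by exists k, c.
  - by move=> x [_ /=]; rewrite !in_itv/= => /andP[->].
exists k0, c0; split => // L K2.
pose F j := (\bigcap_(k in [set k | (j <= k)%N]) U L k) `&` (D `&` cell M k0 c0).
have mQ : measurable (D `&` cell M k0 c0) by apply: measurableI => //; exact: measurable_itv.
have mF j : measurable (F j).
  by apply: measurableI => //; apply: bigcap_measurable => //; exists j => /=.
have FU : \bigcup_j F j = D `&` cell M k0 c0.
  apply/seteqP; split=> [x [j _ []]//|x [Dx Qx]].
  by have [/(_ L I)[j _ hj] _] := Dx; exists j.
have ndF : nondecreasing_seq F.
  move=> i j ij; apply/subsetPset => x [h1 h2]; split=> // k /= jk.
  by apply: h1 => /=; exact: leq_trans jk.
have [j [jK jk0 Fj]] : exists j, [/\ (K2 <= j)%N, (k0 <= j)%N &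
    (((1 - eta) / M%:R ^+ k0)%:E < lebesgue_measure (F j))%E].
  apply: contrapT => H.
  have cF : lebesgue_measure \o F @ \oo --> lebesgue_measure (\bigcup_j F j).
    by apply: nondecreasing_cvg_mu => //; rewrite FU.
  suff : (lebesgue_measure (D `&` cell M k0 c0) <= ((1 - eta) / M%:R ^+ k0)%:E)%E.
    by move=> /(lt_le_trans dens); rewrite ltxx.
  rewrite -FU -(cvg_lim _ cF)//; apply: lime_le; first by apply/cvg_ex; eexists; exact: cF.
  exists (maxn K2 k0) => // j /=; rewrite geq_max => /andP[h1 h2].
  by rewrite leNgt; apply/negP => lt; apply: H; exists j.
exists j; split => //.
pose m := (M ^ (j - k0))%N; rewrite -/m.
have MjE : M%:R ^+ j = m%:R * M%:R ^+ k0 :> R by rewrite /m natrX -exprD subnK.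
have m0 : 0 < m%:R :> R by rewrite ltr0n expn_gt0 (ltnW M_gt1).
pose good := [pred i : 'I_m | `[< G L j (c0 * m + i)%N >] ].
(* Index m stands for the left end of the cell, the only point that closed cells to its left can
   contribute; it has measure 0. *)
pose B (i : nat) : set R := if (i < m)%N && `[< G L j (c0 * m + i)%N >] then
  ccell j (c0 * m + i)%N else if i == m then [set c0%:R / M%:R ^+ k0] else set0.
have mB i : measurable (B i) by rewrite /B; case: ifP => // _; case: ifP => // _.
have FB : F j `<=` \bigcup_i B i.
  move=> x [/(_ j)/=/(_ (leqnn j))[c Gc +] [_ +]].
  rewrite /ccell/cell/= !in_itv/= => /andP[cx xc] /andP[Qx xQ].
  have h1 : (c < c0.+1 * m)%N.
    have := le_lt_trans cx xQ; rewrite MjE invfM mulrA ltr_pM2r ?invr_gt0//.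
    by rewrite ltr_pdivrMr// -natrM ltr_nat.
  have [h2|h2] := leqP (c0 * m) c.
    exists (c - c0 * m)%N => //; rewrite /B subnKC//.
    have -> : (c - c0 * m < m)%N by rewrite ltn_subLR// -mulSnr.
    rewrite (asboolT Gc)/= /ccell/= in_itv/= cx; exact: xc.
  exists m => //; rewrite /B ltnn eqxx/=.
  apply/eqP; rewrite eq_le Qx andbT (le_trans xc)// MjE invfM mulrA ler_pM2r ?invr_gt0//.
  by rewrite ler_pdivrMr// -natrM ler_nat.
have : (lebesgue_measure (F j) <= \sum_(i <oo) lebesgue_measure (B i))%E.
  by apply: measure_sigma_subadditive; [exact: mB|exact: mF|exact: FB].
rewrite (eseries_finite _ m.+1); last 2 first.
- by move=> i; exact: measure_ge0.
- move=> i mi; rewrite /B ltnNge (ltnW mi)/= ifN ?measure0//.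
  by rewrite (gtn_eqF mi).
rewrite big_ord_recr/= {2}/B ltnn eqxx/= lebesgue_measure_set1 adde0.
have -> : (\sum_(i < m) lebesgue_measure (B i) = \sum_(i < m) (if i \in good then (M%:R ^+
  j)^-1 else 0)%:E)%E.
  apply: eq_bigr => i _; rewrite /B ltn_ord /good inE/=; case: ifP => _.
    rewrite /ccell lebesgue_measure_itv/= lte_fin ltr_pM2r ?invr_gt0// ltr_nat ltnSn.
    by rewrite -EFinB -mulrBl -natrB// subSnn mul1r.
  by rewrite ltn_eqF// measure0.
rewrite sumEFin -big_mkcond sumr_const -[(_ *+ #|_|)%R]mulr_natl => /(lt_le_trans Fj).
rewrite lte_fin MjE invfM mulrA ltr_pM2r ?invr_gt0// ltr_pdivlMr// => lt.
have : (#|good| + #|[predC good]| = m)%N by rewrite cardC card_ord.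
rewrite -/[predC good].
move=> /(congr1 (fun x => x%:R : R)); rewrite natrD -natrX -/m => E.
by move: lt; rewrite -E; lra.
Qed.

End density_cell.

(** * Dyadic cubes in a chart *)

Section chart_cubes.
Context {R : realType} {n : nat}.
Local Notation Cn := 'rV[R[i]]_n.
Variables (rho : Cn -> R) (P0 : Cn) (r M m0 s : R) (k0 : 'I_(n + n)).
Hypothesis Ch : chart rho P0 r M m0 s k0.
Implicit Types (x y z P : Cn).

Definition free_coord (k0 : 'I_(n + n)) := {k : 'I_(n + n) | k != k0}.
Local Notation I := (free_coord k0).
Local Notation N := ((n + n)%:R : R).

Lemma card_free_coord : #|{: I}| = (2 * n).-1.
Proof. by rewrite card_sig cardC1 card_ord mul2n addnn. Qed.

Lemma dim_gt0 : (0 < n)%N.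
Proof. by case: n k0 => [[[]]|]. Qed.

Let Mp : 0 < M := chart_M Ch.
Let mp : 0 < m0 := chart_m0 Ch.
Let rp : 0 < r := chart_r Ch.

Let Np : 0 < N.
Proof. by rewrite ltr0n addn_gt0 dim_gt0. Qed.

(** Side of the root cube. The second bound is what [chart_graph] asks of a displacement by half a
    side. *)
Definition chart_scale : R := Num.min r (m0 * r / (N * M)).
Local Notation sc := chart_scale.

Lemma scale_gt0 : 0 < sc.
Proof. by rewrite lt_min rp/= divr_gt0// mulr_gt0. Qed.

Lemma scale_le_r : sc <= r.
Proof. by rewrite ge_min lexx. Qed.

Lemma scale_le : N * M * (sc / 2) <= m0 * (r / 2).
Proof.
have : sc <= m0 * r / (N * M) by rewrite ge_min lexx orbT.
rewrite ler_pdivlMr ?mulr_gt0//; lra.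
Qed.

(** Ratio of the width of a shadow to the depth of its point. Depth is at most M N lam in the ball
    of radius lam about a boundary point, so shadows there have width at most lam. *)
Definition chart_theta : R := (M * N)^-1.
Local Notation theta := chart_theta.

Lemma theta_gt0 : 0 < theta.
Proof. by rewrite invr_gt0 mulr_gt0. Qed.

Definition chart_C3 : R := chartC M m0 * (1 + N * theta).
Local Notation C3 := chart_C3.

Lemma chartC_gt0 : 0 < chartC M m0.
Proof. by rewrite /chartC divr_gt0//; have := Mp; have := mp; lra. Qed.

Lemma C3_gt0 : 0 < C3.
Proof.
rewrite /chart_C3 mulr_gt0 ?chartC_gt0//; have := mulr_gt0 Np theta_gt0; lra.
Qed.

Lemma cone_coord x y t : inbox P0 r x -> inbox P0 r y -> 0 <= t ->
  `|rho x - rho y| <= t ->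
  (forall k, k != k0 -> `|rc k x - rc k y| <= theta * t) -> enorm (x - y) <= C3 * t.
Proof.
move=> xb yb t0 ht hk; apply: le_trans (chart_cone _ _ _ _ _ _ _ Ch x y xb yb) _.
rewrite /chart_C3 -mulrA ler_wpM2l ?(ltW chartC_gt0)// mulrDl mul1r lerD// -mulrA /nl1'.
apply: (@le_trans _ _ (\sum_(k | k != k0) (theta * t))).
  by apply: ler_sum => k kk0; rewrite rcB; exact: hk.
rewrite sumr_const -[_ *+ _]mulr_natl ler_wpM2r//.
  by rewrite mulr_ge0// ltW// theta_gt0.
by rewrite ler_nat (leq_trans (max_card _))// card_ord.
Qed.

Definition unit_coord (l : I) z : R := (rc (val l) z - rc (val l) P0) / sc + 2^-1.

Definition idx k z (l : I) : nat := Num.truncn (2 ^+ k * unit_coord l z).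

(** Negative values are truncated to 0 at both levels, so points outside the root cube are no
    exception. *)
Lemma idx_half k z l : idx k z l = (idx k.+1 z l)./2.
Proof.
rewrite /idx exprS -mulrA; set y := 2 ^+ k * _.
have [y0|y0] := leP 0 y; last first.
  have := truncn_floor y; rewrite leNgt y0/= => ->.
  by have := truncn_floor (2 * y); rewrite leNgt pmulr_rlt0// y0/= => ->.
have y20 : 0 <= 2 * y by rewrite mulr_ge0.
apply: truncn_def; have /andP[h1 h2] := truncn_itv y20.
set u := Num.truncn (2 * y) in h1 h2 *.
have E : u%:R = (odd u)%:R + 2 * (u./2)%:R :> R.
  by rewrite -{1}(odd_double_half u) natrD -muln2 natrM [2 * _]mulrC.
move: h1 h2; rewrite -[u.+1]addn1 -[(u./2).+1]addn1 !natrD E.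
have : 0 <= ((odd u)%:R : R) <= 1 by case: (odd u); rewrite /= ?lexx ?ler01.
by move=> /andP[p1 p2] h1 h2; apply/andP; split; lra.
Qed.

Lemma idx_bounds k z l : 0 <= unit_coord l z ->
  (idx k z l)%:R * (sc / 2 ^+ k) <= rc (val l) z - (rc (val l) P0 - sc / 2) <
  ((idx k z l)%:R + 1) * (sc / 2 ^+ k).
Proof.
move=> u0; have p2 : 0 < 2 ^+ k :> R by rewrite exprn_gt0.
have : 0 <= 2 ^+ k * unit_coord l z by rewrite mulr_ge0// ltW.
move=> /truncn_itv; rewrite -/(idx k z l) -[(idx k z l).+1%:R]natr1.
have scp := scale_gt0.
have -> : rc (val l) z - (rc (val l) P0 - sc / 2) = (2 ^+ k * unit_coord l z) * (sc / 2 ^+ k).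
  by rewrite /unit_coord; field; rewrite !lt0r_neq0.
have e0 : 0 < sc / 2 ^+ k by apply: divr_gt0.
by rewrite (ler_pM2r e0) (ltr_pM2r e0).
Qed.

Lemma unit_coord_itv z l : `|rc (val l) z - rc (val l) P0| < sc / 2 ->
  0 <= unit_coord l z < 1.
Proof.
have scp := scale_gt0; rewrite ltr_norml => /andP[h1 h2]; rewrite /unit_coord.
have -> : (rc (val l) z - rc (val l) P0) / sc + 2^-1 = (rc (val l) z - rc (val l) P0 + sc / 2) / sc.
  by field; rewrite lt0r_neq0.
by rewrite ler_pdivlMr// ltr_pdivrMr// mul0r mul1r; apply/andP; split; lra.
Qed.

Lemma idx_lt k z l : 0 <= unit_coord l z < 1 -> (idx k z l < 2 ^ k)%N.
Proof.
move=> /andP[u0 u1]; rewrite truncn_lt_nat ?mulr_ge0 ?exprn_ge0//.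
by rewrite natrX -[ltRHS]mulr1 ltr_pM2l// exprn_gt0.
Qed.

Definition small_box := [set P | rho P = 0 /\ forall k, `|rc k P - rc k P0| < sc / 2].

Lemma small_box_inbox P : small_box P -> inbox P0 r P.
Proof. by move=> [_ h] k; have := h k; have := scale_le_r; have := rp; lra. Qed.

Definition cube_code k P := code k (idx k P).

Lemma cube_code_div k P : (cube_code k.+1 P %/ @nchild I)%N = cube_code k P.
Proof.
by rewrite /cube_code code_div; congr code; apply/funext => l; rewrite -idx_half.
Qed.

Lemma cube_code_diam k P P' : small_box P -> small_box P' -> cube_code k P = cube_code k P' ->
  enorm (P - P') <= C3 * (sc / theta) / 2 ^+ k.
Proof.
move=> SP SP' E; have scp := scale_gt0; have thp := theta_gt0.
have hI Q : small_box Q -> forall l : I, 0 <= unit_coord l Q < 1.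
  by move=> [_ hQ] l; apply: unit_coord_itv.
have Ei : idx k P =1 idx k P'.
  by apply: (code_inj k) => // l; apply: idx_lt; exact: hI.
(* This choice of [t] makes theta t the side sc / 2^k of the cubes. *)
rewrite -mulrA; apply: cone_coord.
- exact: small_box_inbox.
- exact: small_box_inbox.
- by rewrite !divr_ge0 ?exprn_ge0 ?ltW.
- by rewrite SP.1 SP'.1 subrr normr0 !divr_ge0 ?exprn_ge0 ?ltW.
move=> j jk0; pose l : I := exist _ j jk0.
have /andP[h1 _] := hI _ SP l; have /andP[h2 _] := hI _ SP' l.
have := idx_bounds k _ _ h1; have := idx_bounds k _ _ h2; rewrite -Ei /=.
have -> : theta * (sc / theta / 2 ^+ k) = sc / 2 ^+ k.
  by field; rewrite expf_neq0//= lt0r_neq0.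
by move=> /andP[? ?] /andP[? ?]; rewrite ler_norml; apply/andP; split; lra.
Qed.

End chart_cubes.

(** * The estimate over one cube *)

Section chart_cell.
Context {R : realType} {n : nat}.
Local Notation Cn := 'rV[R[i]]_n.
Variables (rho : Cn -> R) (P0 : Cn) (r M m0 s : R) (k0 : 'I_(n + n)).
Hypothesis Ch : chart rho P0 r M m0 s k0.
Implicit Types (x y z P : Cn).
Local Notation I := (free_coord k0).
Local Notation N := ((n + n)%:R : R).
Local Notation sc := (@chart_scale R n r M m0).
Local Notation theta := (@chart_theta R n M).
Local Notation C3 := (@chart_C3 R n M m0).
Local Notation A := (@chartA R n M).
Local Notation idx := (@idx R n P0 r M m0 k0).
Local Notation unit_coord := (@unit_coord R n P0 r M m0 k0).
Local Notation d := (2 * n).-1.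

(** The factor 2 is a margin: a point at depth t within C3 t of the apex satisfies the cone
    inequality strictly, which contradicts the hypothesis of [hbad_lower]. *)
Definition chart_beta : R := (2 * C3)^-1.
Local Notation beta := chart_beta.

(** At depth t at least (theta t / (2 eps))^d poles lie within C3 t, and each contributes at least
    eps^d t / (C3 t)^(2n); as d = 2n - 1, the powers of eps and t cancel. *)
Definition kernel_lb : R := (theta / 2) ^+ d / C3 ^+ (2 * n).
Local Notation c4 := kernel_lb.

Let thp : 0 < theta. Proof. exact: theta_gt0 Ch. Qed.
Let C3p : 0 < C3. Proof. exact: C3_gt0 Ch. Qed.
Let scp : 0 < sc. Proof. exact: scale_gt0 Ch. Qed.
Let rp : 0 < r. Proof. exact: chart_r Ch. Qed.
Let Mp : 0 < M. Proof. exact: chart_M Ch. Qed.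
Let np : (0 < n)%N. Proof. exact: dim_gt0 k0. Qed.
Let Np : 0 < N. Proof. by rewrite ltr0n addn_gt0 np. Qed.

Lemma beta_gt0 : 0 < beta.
Proof. by rewrite /chart_beta invr_gt0 mulr_gt0. Qed.

Lemma kernel_lb_gt0 : 0 < c4.
Proof. by rewrite /kernel_lb divr_gt0// exprn_gt0// divr_gt0. Qed.

Variables (kq i : nat) (q : I -> nat) (yc : Cn).
Definition cell_size : R := sc / 2 ^+ kq.
Local Notation ell := cell_size.
Local Notation lam := (cell_size / 4).
Local Notation eps := (sc / 2 ^+ (kq + i)).
Let lo (l : I) : R := rc (val l) P0 - sc / 2.

Hypothesis yc_rho : rho yc = 0.
Hypothesis yc_box : forall k, `|rc k yc - rc k P0| <= r / 2.
Hypothesis yc_coord : forall l : I, rc (val l) yc = lo l + (q l)%:R * ell + ell / 2.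

Lemma cell_size_gt0 : 0 < ell.
Proof. by rewrite /cell_size divr_gt0// exprn_gt0. Qed.
Let ellp := cell_size_gt0.

Let eps_gt0 : 0 < eps.
Proof. by rewrite divr_gt0// exprn_gt0. Qed.

Let ellE : ell = 2 ^+ i * eps.
Proof. by rewrite /cell_size exprD; field; rewrite !expf_neq0. Qed.

Lemma cell_size_le : ell <= r.
Proof.
apply: le_trans (@scale_le_r R n r M m0); rewrite /cell_size ler_pdivrMr ?exprn_gt0//.
by apply: ler_peMr; [exact: ltW|apply: exprn_ege1; rewrite ler1n].
Qed.

Lemma cell_ball_rc z k : enorm (z - yc) <= lam -> `|rc k z - rc k yc| <= lam.
Proof. by move=> zy; rewrite -rcB (le_trans (rc_le_enorm k _)). Qed.

Lemma cell_ball_box z k : enorm (z - yc) <= lam -> `|rc k z - rc k P0| <= 3 / 4 * r.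
Proof.
move=> zy; have h1 := cell_ball_rc z k zy; have h2 := yc_box k; have := cell_size_le.
have -> : rc k z - rc k P0 = (rc k z - rc k yc) + (rc k yc - rc k P0) by ring.
by have := ler_normD (rc k z - rc k yc) (rc k yc - rc k P0); lra.
Qed.

Lemma cell_ball_inbox z : enorm (z - yc) <= lam -> inbox P0 r z.
Proof. by move=> zy k; have := cell_ball_box z k zy; have := rp; lra. Qed.

Lemma yc_inbox : inbox P0 r yc.
Proof. by apply: cell_ball_inbox; rewrite subrr enorm0 divr_ge0// ltW. Qed.

Lemma inbox_lip x y : inbox P0 r x -> inbox P0 r y ->
  `|rho x - rho y| <= M * N * enorm (x - y).
Proof.
move=> xb yb; apply: le_trans (chart_lip _ _ _ _ _ _ _ Ch x y xb yb) _.
by rewrite -mulrA ler_wpM2l ?nl1_le_enorm// ltW.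
Qed.

Lemma cell_ball_rho z : enorm (z - yc) <= lam -> `|rho z| <= M * N * lam.
Proof.
move=> zy; have := inbox_lip _ _ (cell_ball_inbox _ zy) yc_inbox.
rewrite yc_rho subr0 => /le_trans; apply.
by rewrite ler_wpM2l// mulr_ge0// ltW.
Qed.

Local Notation cellT := {ffun I -> 'I_(2 ^ i)}.
Definition abs_idx (w : cellT) (l : I) : nat := (q l * 2 ^ i + w l)%N.

(* The subcubes of level kq + i of the cube q of level kq are indexed by w.  Over
   each stands a pole y w on the boundary, and over each good one a boundary
   point Pt w in whose approach region f is small. *)
Variables (bad : pred cellT) (y Pt : cellT -> Cn).
Hypothesis y_inbox : forall w, inbox P0 r (y w).
Hypothesis y_rho : forall w, rho (y w) = 0.
Hypothesis y_coord : forall w (l : I), rc (val l) (y w) = lo l + (abs_idx w l)%:R * eps.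
Hypothesis Pt_box : forall w, ~~ bad w -> small_box rho P0 r M m0 (Pt w).
Hypothesis Pt_idx : forall w, ~~ bad w -> idx (kq + i) (Pt w) =1 abs_idx w.

(** A Riemann sum of a Poisson-type integral over the bad set. The weight eps^d, the size of a
    subcube in the free coordinates, makes the bounds independent of the level. *)
Definition hbad z : R :=
  \sum_(w | bad w) eps ^+ d * hkernel A (grad rho (y w)) (z - y w).

(** The reason for [A]: the numerators of the kernels dominate the depth, hence are positive in
    Omega even where Omega crosses the tangent plane at the pole. *)
Lemma taylor_numerator z Q : inbox P0 r z -> inbox P0 r Q -> rho Q = 0 ->
  - rho z <= A * sqn (z - Q) - cdot (grad rho Q) (z - Q).
Proof.
move=> zb Qb Q0; have := chart_taylor _ _ _ _ _ _ _ Ch z Q zb Qb.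
by rewrite Q0; lra.
Qed.

Lemma sqn_pole_gt0 z Q : rho z < 0 -> rho Q = 0 -> 0 < sqn (z - Q).
Proof.
move=> zr Q0; rewrite lt_neqAle sqn_ge0 andbT eq_sym -enorm_sqr sqrf_eq0.
by apply/eqP => /enorm_eq0/eqP; rewrite subr_eq0 => /eqP E; move: zr; rewrite E Q0 ltxx.
Qed.

Lemma hbad_term_ge0 z w : enorm (z - yc) <= lam -> rho z < 0 ->
  0 <= eps ^+ d * hkernel A (grad rho (y w)) (z - y w).
Proof.
move=> zy z0; rewrite mulr_ge0 ?exprn_ge0 ?(ltW eps_gt0)// mulr_ge0//; last first.
  by rewrite exprn_ge0// invr_ge0 sqn_ge0.
have := taylor_numerator z (y w) (cell_ball_inbox _ zy) (y_inbox w) (y_rho w); lra.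
Qed.

Lemma hbad_ge0 z : enorm (z - yc) <= lam -> rho z < 0 -> 0 <= hbad z.
Proof. by move=> zy z0; apply: sumr_ge0 => w _; exact: hbad_term_ge0. Qed.

(* Around the shadow of z at scale theta t every cell is bad, and the kernels
   with poles in these cells add up to a constant. *)
Lemma hbad_lower z : enorm (z - yc) <= lam -> rho z < 0 -> eps <= theta * - rho z ->
  (forall w, ~~ bad w -> - rho z <= beta * enorm (z - Pt w)) -> c4 <= hbad z.
Proof.
move=> zy z0 epst far; set t := - rho z in epst far.
have t0 : 0 < t by rewrite oppr_gt0.
have zb := cell_ball_inbox _ zy.
have ztheta : theta * t <= lam.
  have := cell_ball_rho _ zy; rewrite ltr0_norm// -/t => h.
  rewrite /chart_theta mulrC ler_pdivrMr ?mulr_gt0//; rewrite mulrC.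
  by apply: le_trans h _; rewrite mulrC.
have z_lo (l : I) : lo l + (q l)%:R * ell + ell / 4 <= rc (val l) z <=
    lo l + (q l)%:R * ell + 3 / 4 * ell.
  have := cell_ball_rc z (val l) zy; rewrite yc_coord ler_norml => /andP[h1 h2].
  by apply/andP; split; lra.
have zu (l : I) : 0 <= unit_coord l z.
  have /andP[h _] := z_lo l; have : 0 <= (q l)%:R * ell by rewrite mulr_ge0// ltW.
  rewrite /unit_coord; have -> : (rc (val l) z - rc (val l) P0) / sc + 2^-1 = (rc (val l) z -
    lo l) / sc.
    by rewrite /lo; field; exact: lt0r_neq0.
  by move=> h0; apply: divr_ge0; [have := ellp; lra|exact: ltW].
pose v := idx (kq + i) z.
have vz (l : I) : (v l)%:R * eps <= rc (val l) z - lo l < ((v l)%:R + 1) * eps.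
  exact: (idx_bounds _ _ _ _ _ _ _ Ch (kq + i) z l (zu l)).
have x1 : 1 <= theta * t / eps by rewrite ler_pdivlMr// mul1r.
(* Number of whole subcubes in the width theta t; being at least 1, it loses at most a factor 2 by
   rounding. *)
pose m := Num.truncn (theta * t / eps).
have m0' : (0 < m)%N by rewrite truncn_gt0.
have /andP[mx xm] := truncn_itv (le_trans ler01 x1).
have meps : m%:R * eps <= theta * t by rewrite -ler_pdivlMr.
have m2 : theta * t / 2 <= m%:R * eps.
  have : theta * t / eps <= 2 * m%:R.
    apply: (le_trans (ltW xm)); rewrite -/m -natrM ler_nat mul2n -addnn.
    by rewrite -addn1 leq_add2l.
  by rewrite ler_pdivrMr//; lra.
(* The block starts at the subcube under z and extends in the positive directions only, with m
   subcubes per coordinate. *)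
pose nearp := [pred w : cellT | [forall l, (v l <= abs_idx w l < v l + m)%N]].
have near_coord w l : nearp w -> 0 <= (abs_idx w l)%:R - (v l)%:R :> R /\
    (abs_idx w l)%:R - (v l)%:R + 1 <= m%:R :> R.
  move=> /forallP/(_ l)/andP[h1 h2]; split; first by rewrite subr_ge0 ler_nat.
  have : ((abs_idx w l).+1%:R <= (v l + m)%:R :> R) by rewrite ler_nat.
  by rewrite natrD -natr1; lra.
have near_bad w : nearp w -> bad w.
  move=> nw; apply: contraT => gw; exfalso.
  have Pb := Pt_box _ gw; have Pi := Pt_idx _ gw.
  have := far _ gw; apply/negP; rewrite -ltNge.
  have : enorm (z - Pt w) <= C3 * t.
    apply: (cone_coord _ _ _ _ _ _ _ Ch) => //; [exact: small_box_inbox Ch _ Pb|exact: ltW| |].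
      by rewrite Pb.1 subr0 ltr0_norm.
    move=> k kk0; pose l : I := exist _ k kk0.
    have /andP[u0 _] := unit_coord_itv _ _ _ _ _ _ _ Ch (Pt w) l (Pb.2 k).
    have := idx_bounds _ _ _ _ _ _ _ Ch (kq + i) (Pt w) l u0; rewrite Pi => /andP[h1 h2].
    have /andP[h3 h4] := vz l; have [h5 h6] := near_coord w l nw.
    move: h1 h2 h3 h4; rewrite /lo /= => h1 h2 h3 h4.
    have h7 : ((abs_idx w l)%:R - (v l)%:R + 1) * eps <= m%:R * eps by rewrite ler_wpM2r// ltW.
    have h8 : 0 <= ((abs_idx w l)%:R - (v l)%:R) * eps by rewrite mulr_ge0// ltW.
    rewrite ler_norml; apply/andP; split; nra.
  move=> h; apply: (@le_lt_trans _ _ (t / 2)); last by lra.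
  rewrite /chart_beta; apply: le_trans (ler_wpM2l _ h) _; first by rewrite invr_ge0 mulr_ge0 ?ltW.
  by rewrite le_eqVlt; apply/orP; left; apply/eqP; field; exact: lt0r_neq0.
pose kap := t * ((C3 * t) ^+ 2)^-1 ^+ n.
have near_kernel w : nearp w -> kap <= hkernel A (grad rho (y w)) (z - y w).
  move=> nw; have sp := sqn_pole_gt0 _ _ z0 (y_rho w).
  have : enorm (z - y w) <= C3 * t.
    apply: (cone_coord _ _ _ _ _ _ _ Ch); [exact: zb|exact: y_inbox|exact: ltW| |].
      by rewrite y_rho subr0 ltr0_norm.
    move=> k kk0; pose l : I := exist _ k kk0.
    have := y_coord w l; rewrite /= => ->.
    have /andP[h3 h4] := vz l; have [h5 h6] := near_coord w l nw.
    move: h3 h4; rewrite /= => h3 h4.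
    have h7 : ((abs_idx w l)%:R - (v l)%:R + 1) * eps <= m%:R * eps by rewrite ler_wpM2r// ltW.
    have h8 : 0 <= ((abs_idx w l)%:R - (v l)%:R) * eps by rewrite mulr_ge0// ltW.
    rewrite ler_norml; apply/andP; split; nra.
  have C3t : 0 < C3 * t by rewrite mulr_gt0.
  rewrite enorm_le ?(ltW C3t)// => sle.
  apply: ler_pM.
  - exact: ltW.
  - by rewrite exprn_ge0// invr_ge0 sqr_ge0.
  - exact: taylor_numerator.
  by rewrite lerXn2r ?nnegrE ?invr_ge0 ?sqr_ge0 ?sqn_ge0// lef_pV2 ?posrE// exprn_gt0.
(* Each coordinate of z is within ell / 4 of the centre and the block is at most lam = ell / 4 wide,
   so the block stays over the cube [q]. *)
have v_ge (l : I) : (q l * 2 ^ i <= v l)%N.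
  have /andP[h1 _] := z_lo l; have /andP[_ h2] := vz l.
  rewrite -ltnS -(ltr_nat R) -(ltr_pM2r eps_gt0) -[(v l).+1%:R]natr1.
  apply: le_lt_trans h2; rewrite natrM natrX -mulrA -ellE; have := ellp; lra.
have v_lt (l : I) (u : 'I_m) : (v l + u - q l * 2 ^ i < 2 ^ i)%N.
  rewrite ltn_subLR ?(leq_trans (v_ge l)) ?leq_addr//.
  rewrite -(ltr_nat R) -(ltr_pM2r eps_gt0) !natrD natrM natrX.
  have /andP[_ h1] := z_lo l; have /andP[h2 _] := vz l.
  have -> : ((q l)%:R * 2 ^+ i + 2 ^+ i) * eps = (q l)%:R * ell + ell by rewrite ellE; ring.
  have hu : (u%:R + 1) * eps <= m%:R * eps.
    by rewrite ler_wpM2r ?(ltW eps_gt0)// natr1 ler_nat.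
  by move: hu; rewrite !mulrDl mul1r; have := eps_gt0; lra.
pose g (u : {ffun I -> 'I_m}) : cellT := [ffun l => Ordinal (v_lt l (u l))].
have gE u l : abs_idx (g u) l = (v l + u l)%N.
  by rewrite /abs_idx ffunE/= subnKC// (leq_trans (v_ge l)) ?leq_addr.
have g_near u : nearp (g u).
  by apply/forallP => l; rewrite gE leq_addr ltn_add2l ltn_ord.
have g_inj : injective g.
  move=> u u' E; apply/ffunP => l; apply: ord_inj.
  by have := gE u l; rewrite E gE => /addnI.
have card_near : (m ^ d <= #|nearp|)%N.
  have -> : (m ^ d = #|{: {ffun I -> 'I_m}}|)%N by rewrite card_ffun card_ord card_free_coord.
  rewrite -(fintype.card_image g_inj); apply: subset_leq_card;
    apply/fintype.subsetP => _ /fintype.imageP[u _ ->].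
  exact: g_near.
apply: (@le_trans _ _ (\sum_(w : cellT | nearp w) eps ^+ d * kap)).
  rewrite sumr_const -[(_ *+ _)%R]mulr_natl.
  have kap0 : 0 <= kap by rewrite mulr_ge0 ?(ltW t0)// exprn_ge0// invr_ge0 sqr_ge0.
  apply: (@le_trans _ _ ((m ^ d)%:R * (eps ^+ d * kap))); last first.
    by rewrite ler_wpM2r ?ler_nat// mulr_ge0// exprn_ge0// ltW.
  rewrite natrX mulrA -exprMn.
  apply: (@le_trans _ _ ((theta * t / 2) ^+ d * kap)); last first.
    rewrite ler_wpM2r// lerXn2r// nnegrE ?mulr_ge0// ?divr_ge0// ?mulr_ge0// ltW//.
  rewrite le_eqVlt; apply/orP; left; apply/eqP.
  rewrite /kernel_lb /kap exprVn -exprM.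
  move: C3p t0; have -> : (2 * n)%N = ((2 * n).-1).+1 by rewrite prednK// muln_gt0.
  rewrite succnK; move: C3 ((2 * n).-1) (t) (theta) => c e u h cp up.
  have -> : h * u / 2 = h / 2 * u by ring.
  rewrite !exprMn !exprS; field.
  by rewrite ?expf_neq0 ?lt0r_neq0.
rewrite /hbad [leLHS]big_mkcond [leRHS]big_mkcond/=; apply: ler_sum => w _.
case: ifPn => [nw|_].
  by rewrite (near_bad _ nw) ler_wpM2l ?near_kernel// exprn_ge0// ltW.
by case: ifP => // _; exact: hbad_term_ge0.
Qed.

(** As |g| >= m0, the squared term contributes at most - 2n to [lap_barrier], against n from |z|^2
    and at most n / 2 from the last term. *)
Definition barrier_La : R := 4 * n%:R / m0 ^+ 2.
Local Notation La := barrier_La.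
Local Notation gm := (N * M).
Local Notation g := (grad rho yc).
Local Notation brr z := (barrier A La (La * gm * lam) g (z - yc)).

Let m0p : 0 < m0. Proof. exact: chart_m0 Ch. Qed.
Let lamp : 0 < lam. Proof. by rewrite divr_gt0. Qed.
Let gmp : 0 < gm. Proof. by rewrite mulr_gt0. Qed.
Let Ap : 0 < A. Proof. by rewrite /chartA mulr_gt0// exprn_gt0. Qed.

Lemma barrier_La_gt0 : 0 < La.
Proof. by rewrite /barrier_La divr_gt0 ?exprn_gt0// mulr_gt0// ltr0n. Qed.
Let Lap := barrier_La_gt0.

Hypothesis lam_small1 : La * A ^+ 2 * lam ^+ 2 <= 1 / 2.
Hypothesis lam_small2 : La * gm * lam * A <= 1 / 2.

Let cdot_bound z : `|cdot g (z - yc)| <= gm * enorm (z - yc).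
Proof.
apply: le_trans (cdot_le _ _) _; rewrite ler_wpM2r ?enorm_ge0//.
exact: chart_grad_le Ch _ yc_inbox.
Qed.

(** With z measured from [yc]: where g.z < 0, the bound |g.z| <= gm lam explains the coefficient La
    gm lam. Where g.z >= 0, being in Omega forces g.z <= A |z|^2, and for small lam the square costs
    at most |z|^2 / 2. *)
Lemma barrier_lower z : enorm (z - yc) <= lam -> rho z < 0 ->
  sqn (z - yc) / 2 <= brr z.
Proof.
move=> zy z0; have T := taylor_numerator z yc (cell_ball_inbox _ zy) yc_inbox yc_rho.
have X1 := cdot_bound z; rewrite /barrier; set X := cdot _ _ in T X1 *.
have s2 : sqn (z - yc) <= lam ^+ 2 by rewrite -enorm_le// ltW.
have s0 := sqn_ge0 (z - yc).
set q2 := sqn _ in T s2 s0 *.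
have Bp : 0 < La * gm * lam by exact: mulr_gt0 (mulr_gt0 Lap gmp) lamp.
have [Xn|Xp] := ltP X 0.
  have h1 : La * X ^+ 2 <= La * gm * lam * - X.
    have -> : La * X ^+ 2 = La * - X * - X by ring.
    have -> : La * gm * lam * - X = La * - X * (gm * lam) by ring.
    apply: ler_wpM2l; first by rewrite mulr_ge0 ?(ltW Lap)// oppr_ge0 ltW.
    rewrite -(ltr0_norm Xn); apply: (le_trans X1); rewrite ler_wpM2l//.
    exact: ltW.
  have h2 : La * gm * lam * - X <= La * gm * lam * (A * q2 - X).
    rewrite ler_wpM2l ?(ltW Bp)//; have : 0 <= A * q2 by rewrite mulr_ge0// ltW.
    by lra.
  lra.
have XA : X <= A * q2 by lra.
have h1 : La * X ^+ 2 <= q2 / 2.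
  apply: (@le_trans _ _ (La * (A * q2) ^+ 2)).
    by rewrite ler_wpM2l ?(ltW Lap)// lerXn2r// nnegrE// (le_trans Xp).
  apply: (@le_trans _ _ (La * A ^+ 2 * lam ^+ 2 * q2)).
    have -> : La * (A * q2) ^+ 2 = La * A ^+ 2 * (q2 * q2) by ring.
    rewrite -[leRHS]mulrA ler_wpM2l ?ler_wpM2r// mulr_ge0 ?sqr_ge0// ltW//.
  have := ler_wpM2r s0 lam_small1; lra.
have h2 : 0 <= La * gm * lam * (A * q2 - X) by rewrite mulr_ge0 ?(ltW Bp)//; lra.
lra.
Qed.

Lemma barrier_ge0 z : enorm (z - yc) <= lam -> rho z < 0 -> 0 <= brr z.
Proof.
move=> zy z0; apply: le_trans (barrier_lower _ zy z0).
by rewrite divr_ge0// sqn_ge0.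
Qed.

Variables (Omega : set Cn) (f : Cn -> R[i]) (L : R).
Hypothesis OmegaE : Omega = [set z | rho z < 0].
Hypothesis hf : holomorphic Omega f.
Hypothesis L_gt0 : 0 < L.
Hypothesis f_le1 : forall w z, ~~ bad w -> rho z < 0 -> enorm (z - yc) <= lam ->
  beta * enorm (z - Pt w) <= - rho z -> normc (f z) <= 1.
Hypothesis f_small : forall w z, ~~ bad w -> rho z < 0 -> enorm (z - yc) <= lam ->
  beta * enorm (z - Pt w) <= - rho z -> - rho z <= (1 + theta^-1) * eps ->
  normc (f z) <= expR (- L).

Definition majorant z : R := L * (c4^-1 * hbad z + 2 / lam ^+ 2 * brr z - 1).

(** The cut at depth eps makes the region a compact subset of Omega, away from the poles. *)
Definition good_region : set Cn := [set z | enorm (z - yc) <= lam /\ eps <= - rho z /\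
  exists2 w, ~~ bad w & beta * enorm (z - Pt w) <= - rho z].

Let rho_cont : continuous rho. Proof. exact: chart_cont Ch. Qed.

Let rhoN_cont : continuous (fun z => - rho z).
Proof. by move=> z; apply: continuousN; exact: rho_cont. Qed.

Let bdist_cont (P : Cn) : continuous (fun z => beta * enorm (z - P)).
Proof.
move=> z; have c1 : {for z, continuous (fun=> beta : R)} by exact: cst_continuous.
exact: (continuousM c1 (enorm_continuous P z)).
Qed.

Let continuous_scale (c : R) (h : Cn -> R) z :
  {for z, continuous h} -> {for z, continuous (fun u => c * h u)}.
Proof.
move=> ch; have c1 : {for z, continuous (fun=> c)} by exact: cst_continuous.
exact: continuousM c1 ch.
Qed.

Lemma good_region_compact : compact good_region.
Proof.
apply: (@compact_Cn _ _ _ (lam + enorm yc)); last first.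
  by move=> z [h _]; have := enormD (z - yc) yc; rewrite subrK; lra.
have -> : good_region = [set z | enorm (z - yc) <= lam] `&` [set z | eps <= - rho z] `&`
    \bigcup_(w in [set w | ~~ bad w]) [set z | beta * enorm (z - Pt w) <= - rho z].
  by apply/seteqP; split=> [z [h1 [h2 [w h3 h4]]]|z [[h1 h2] [w h3 h4]]];
    (split; [split|exists w]) || (split; [|split; [|exists w]]).
apply: closedI; first apply: closedI.
- by apply: closed_le_continuous; [exact: enorm_continuous|exact: cst_continuous].
- by apply: closed_le_continuous; [exact: cst_continuous|exact: rhoN_cont].
apply: closed_bigcup => [|w _]; first exact: finite_finset.
by apply: closed_le_continuous; [exact: bdist_cont|exact: rhoN_cont].
Qed.

Lemma hbad_continuous z : rho z < 0 -> {for z, continuous hbad}.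
Proof.
move=> z0; rewrite /hbad; elim: (index_enum _) => [|w l IH].
  have -> : (fun z => \sum_(w <- [::] | bad w) eps ^+ d * hkernel A (grad rho (y w)) (z - y w))
    = fun=> 0.
    by apply/funext => u; rewrite big_nil.
  exact: cst_continuous.
have -> : (fun z => \sum_(w <- w :: l | bad w) eps ^+ d * hkernel A (grad rho (y w)) (z - y w)) =
   (fun z => (if bad w then eps ^+ d * hkernel A (grad rho (y w)) (z - y w) else 0) +
      \sum_(w <- l | bad w) eps ^+ d * hkernel A (grad rho (y w)) (z - y w)).
  by apply/funext => u; rewrite big_cons; case: ifP; rewrite ?add0r.
apply: continuousD IH; case: (bad w); last exact: cst_continuous.
apply: continuous_scale; rewrite /hkernel; apply: continuousM; last by apply: continuous_sqnV;
  exact/lt0r_neq0/sqn_pole_gt0.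
apply: continuousB; last exact: continuous_cdot.
by apply: continuous_scale; exact: continuous_sqn.
Qed.

Lemma barrier_continuous z : {for z, continuous (fun z => brr z)}.
Proof.
rewrite /barrier; apply: continuousD; first apply: continuousB.
- exact: continuous_sqn.
- apply: continuous_scale.
  by apply: continuousM; exact: continuous_cdot.
apply: continuous_scale.
apply: continuousB; last exact: continuous_cdot.
by apply: continuous_scale; exact: continuous_sqn.
Qed.

Lemma majorant_continuous z : rho z < 0 -> {for z, continuous majorant}.
Proof.
move=> z0; rewrite /majorant; apply: continuous_scale.
apply: continuousB; last exact: cst_continuous.
apply: continuousD; apply: continuous_scale.
- exact: hbad_continuous.
- exact: barrier_continuous.
Qed.

Lemma lap_majorant z : rho z < 0 -> exists2 l, l < 0 & lap majorant z l.
Proof.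
move=> z0; exists (L * (c4^-1 * 0 + 2 / lam ^+ 2 *
    (n%:R - La * (sqn g / 2) + La * gm * lam * A * n%:R) + 0)); last first.
  apply: lapZ; apply: lapD; last exact: lap_cst.
  apply: lapD; apply: lapZ; last exact: lap_barrier.
  rewrite -[X in lap _ _ X](_ : \sum_(w : cellT | bad w) eps ^+ d * 0 = 0).
    apply: lap_sum => w _; apply: lapZ; apply: lap_hkernel.
    exact/lt0r_neq0/sqn_pole_gt0.
  by rewrite big1// => w _; rewrite mulr0.
rewrite mulr0 add0r addr0 pmulr_rlt0// pmulr_rlt0 ?divr_gt0 ?exprn_gt0//.
have n0 : 0 < n%:R :> R by rewrite ltr0n.
have h1 := ler_wpM2r (ltW n0) lam_small2.
have h2 : 2 * n%:R <= La * (sqn g / 2).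
  have -> : 2 * n%:R = La * (m0 ^+ 2 / 2) by rewrite /barrier_La; field; exact: lt0r_neq0.
  rewrite ler_wpM2l ?(ltW Lap)// ler_wpM2r// -enorm_sqr.
  rewrite lerXn2r ?nnegrE ?enorm_ge0 ?(ltW m0p)//.
  exact: chart_grad_ge Ch _ yc_inbox.
lra.
Qed.

Lemma majorant_bound z : good_region z -> normc (f z) <= expR (majorant z).
Proof.
move: z; apply: (@maximum_principle _ _ Omega) => //.
- exact: good_region_compact.
- by move=> x [_ [h _]]; rewrite OmegaE /=; have := eps_gt0; lra.
- by move=> x [_ [h _]]; apply: majorant_continuous; have := eps_gt0; lra.
move=> x [xy [et [w gw wt]]]; have x0 : rho x < 0 by have := eps_gt0; lra.
have hb := hbad_ge0 _ xy x0; have bl := barrier_lower _ xy x0; have b0 := barrier_ge0 _ xy x0.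
have c4p := kernel_lb_gt0.
have lam2 : 0 < 2 / lam ^+ 2 by rewrite divr_gt0// exprn_gt0.
have nn1 : 0 <= c4^-1 * hbad x by rewrite mulr_ge0// invr_ge0 ltW.
have nn2 : 0 <= 2 / lam ^+ 2 * brr x by rewrite mulr_ge0// ltW.
have le1 : 0 <= majorant x -> normc (f x) <= expR (majorant x).
  move=> m_ge0; apply: le_trans (f_le1 _ _ gw x0 xy wt) _.
  by rewrite -expR0 ler_expR.
(* On the outer sphere the barrier term alone is at least 1. *)
have [xl|xl] := leP lam (enorm (x - yc)).
  left; apply: le1; rewrite /majorant mulr_ge0 ?(ltW L_gt0)//.
  have : lam ^+ 2 <= sqn (x - yc) by rewrite -enorm_sqr lerXn2r// nnegrE ?enorm_ge0 ?(ltW lamp).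
  move=> h; have : 2 / lam ^+ 2 * (lam ^+ 2 / 2) <= 2 / lam ^+ 2 * brr x.
    by rewrite ler_wpM2l ?(ltW lam2)//; lra.
  have -> : 2 / lam ^+ 2 * (lam ^+ 2 / 2) = 1 by field; exact: lt0r_neq0.
  lra.
(* The bottom layer has thickness (1 + 1 / theta) eps because above it [hbad_lower] requires eps <=
   theta t. *)
have [te|te] := leP (- rho x) ((1 + theta^-1) * eps).
  left; apply: le_trans (f_small _ _ gw x0 xy wt te) _; rewrite ler_expR /majorant.
  rewrite -[leLHS]mulrN1 ler_wpM2l ?(ltW L_gt0)//; lra.
have tie : 0 < theta^-1 * eps by rewrite mulr_gt0// invr_gt0.
(* The lateral sides: no good cone has x strictly inside, so [hbad] reaches [c4]. *)
have [far|] := pselect (forall w, ~~ bad w -> - rho x <= beta * enorm (x - Pt w)).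
  left; apply: le1; rewrite /majorant mulr_ge0 ?(ltW L_gt0)//.
  have : c4 <= hbad x.
    apply: hbad_lower => //; rewrite -ler_pdivrMl//; have := eps_gt0; lra.
  move=> h; have : c4^-1 * c4 <= c4^-1 * hbad x by rewrite ler_wpM2l// invr_ge0 ltW.
  by rewrite mulVf ?lt0r_neq0//; lra.
move=> /existsNP[w' /not_implyP[gw' /negP]]; rewrite -ltNge => wt'.
(* All constraints are strict at x for the cone over [w'], so a neighbourhood of x stays in the
   region. *)
right; split; last exact: lap_majorant.
have n1 : \forall u \near x, enorm (u - yc) < lam.
  exact: (cvgr_lt (enorm (x - yc)) (enorm_continuous yc x) lam xl).
have n2 : \forall u \near x, eps < - rho u.
  apply: (cvgr_gt (- rho x) (rhoN_cont x) eps); lra.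
have n3 : \forall u \near x, 0 < - rho u - beta * enorm (u - Pt w').
  have ch := continuousB (rhoN_cont x) (bdist_cont (Pt w') x).
  by apply: (cvgr_gt _ ch 0); rewrite subr_gt0.
near=> u; split; first by apply: ltW; near: u.
split; first by apply: ltW; near: u.
exists w' => //; have : 0 < - rho u - beta * enorm (u - Pt w') by near: u.
lra.
Unshelve. all: by end_near.
Qed.

(** Within kap lam of [yc] the barrier term is at most 2 kap (1 + La gm^2), and this value of kap
    makes that 1 / 8. *)
Definition inner_ratio : R := (16 * (1 + La * gm ^+ 2))^-1.
Local Notation kap := inner_ratio.
(** Near the inner point the depth is at least m0 tau / 2 and [rho] has Lipschitz constant M N, so
    all poles are at distance at least sigma lam. *)
Definition pole_ratio : R := m0 * kap / (4 * (M * N)).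
Local Notation sigma := pole_ratio.
Local Notation tau := (kap * lam / 2).
Definition inner_point : Cn := real_line yc k0 (- (s * tau)).
Local Notation z0 := inner_point.
(** The second bound lets [rho] vary by at most half of m0 tau, a lower bound for the depth of the
    inner point. *)
Definition inner_radius : R := Num.min tau (m0 * tau / (2 * (M * N))).
Variable eta : R.
Hypothesis bad_card : #|bad|%:R <= eta * (2 ^+ i) ^+ d.
Hypothesis eta_small : eta * (4 ^+ d * (A * (2 * N * r) + gm)) <= c4 * sigma ^+ d / 4.
Hypothesis eps_small : (1 + theta^-1) * eps <= m0 * kap * lam / 4.

Lemma inner_ratio_gt0 : 0 < kap.
Proof. by rewrite invr_gt0 mulr_gt0// ltr_wpDr// mulr_ge0 ?sqr_ge0// ltW. Qed.
Let kapp := inner_ratio_gt0.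

Lemma pole_ratio_gt0 : 0 < sigma.
Proof. by apply: divr_gt0; rewrite mulr_gt0// mulr_gt0. Qed.
Let sigp := pole_ratio_gt0.

Let taup : 0 < tau. Proof. by rewrite divr_gt0// mulr_gt0. Qed.

Lemma inner_radius_gt0 : 0 < inner_radius.
Proof. by rewrite lt_min taup/=; apply: divr_gt0; rewrite mulr_gt0// mulr_gt0. Qed.

Let kap16 : kap <= 1 / 16.
Proof.
rewrite /inner_ratio div1r lef_pV2 ?posrE//.
  by rewrite -[leLHS]mulr1 ler_wpM2l// lerDl mulr_ge0 ?sqr_ge0// ltW.
by rewrite mulr_gt0// ltr_wpDr// mulr_ge0 ?sqr_ge0// ltW.
Qed.

Lemma inner_point_dist : enorm (z0 - yc) <= tau.
Proof.
rewrite /inner_point /real_line addrC addKr -(@ler_pXn2r _ 2)// ?nnegrE ?enorm_ge0 ?(ltW taup)//.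
rewrite enorm_sqr sqnZ sqn_rc (bigD1 k0)//= big1 => [|k kk0].
  have -> : rc k0 (real_basis k0) = 1 :> R.
    have := rc_line k0 (0 : Cn) k0 (1 : R); rewrite /real_line add0r scale1r eqxx => ->.
    by rewrite -[X in rc _ X](subrr (0 : Cn)) rcB subrr add0r.
  by rewrite expr1n addr0 mulr1 sqrrN exprMn -[s ^+ 2]real_normK ?num_real// (chart_s Ch)
    expr1n mul1r.
have := rc_line k (0 : Cn) k0 (1 : R); rewrite /real_line add0r scale1r (negPf kk0) => ->.
by rewrite -[X in rc _ X](subrr (0 : Cn)) rcB subrr add0r expr0n.
Qed.

Let inner_dist z : enorm (z - z0) <= inner_radius -> enorm (z - yc) <= kap * lam.
Proof.
rewrite le_min => /andP[h _]; have := inner_point_dist.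
by have := enorm_triangle z z0 yc; lra.
Qed.

Let inner_ball z : enorm (z - z0) <= inner_radius -> enorm (z - yc) <= lam.
Proof.
move=> /inner_dist/le_trans; apply; rewrite -[leRHS]mul1r ler_wpM2r ?(ltW lamp)//.
by have := kap16; lra.
Qed.

Lemma inner_depth z : enorm (z - z0) <= inner_radius -> m0 * tau / 2 <= - rho z.
Proof.
move=> zz; have zl := inner_ball _ zz.
have z0l : enorm (z0 - yc) <= lam by apply: inner_ball; rewrite subrr enorm0 ltW// inner_radius_gt0.
have zb := cell_ball_inbox _ zl; have z0b := cell_ball_inbox _ z0l.
have h1 := chart_down _ _ _ _ _ _ _ Ch yc tau yc_inbox (ltW taup) z0b.
have h2 := inbox_lip _ _ zb z0b.
have h3 : M * N * enorm (z - z0) <= m0 * tau / 2.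
  have : enorm (z - z0) <= m0 * tau / (2 * (M * N)) by move: zz; rewrite le_min => /andP[].
  rewrite ler_pdivlMr ?mulr_gt0//; lra.
move: h1; rewrite yc_rho -/z0 => h1.
by have := ler_norm (rho z - rho z0); lra.
Qed.

Lemma inner_barrier z : enorm (z - z0) <= inner_radius -> 2 / lam ^+ 2 * brr z <= 1 / 8.
Proof.
move=> zz; have zk := inner_dist _ zz; have X1 := cdot_bound z; rewrite /barrier.
set X := cdot _ _ in X1 *.
have s2 : sqn (z - yc) <= (kap * lam) ^+ 2 by rewrite -enorm_le// ltW// mulr_gt0.
have X2 : - X <= gm * (kap * lam).
  apply: (@le_trans _ _ `|X|); first by rewrite -normrN ler_norm.
  by apply: (le_trans X1); rewrite ler_wpM2l// ltW.
have h1 : sqn (z - yc) - La * X ^+ 2 + La * gm * lam * (A * sqn (z - yc) - X) <=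
    3 / 2 * (kap * lam) ^+ 2 + La * gm * lam * (gm * (kap * lam)).
  have e1 : 0 <= La * X ^+ 2 by rewrite mulr_ge0 ?sqr_ge0// ltW.
  have e2 : La * gm * lam * - X <= La * gm * lam * (gm * (kap * lam)).
    by rewrite ler_wpM2l// ltW//; exact: mulr_gt0 (mulr_gt0 Lap gmp) lamp.
  have e3 : La * gm * lam * A * sqn (z - yc) <= 1 / 2 * (kap * lam) ^+ 2.
    apply: ler_pM; [|exact: sqn_ge0|exact: lam_small2|exact: s2].
    by apply: ltW; exact: mulr_gt0 (mulr_gt0 (mulr_gt0 Lap gmp) lamp) Ap.
  lra.
apply: (@le_trans _ _ (2 / lam ^+ 2 * (kap * lam ^+ 2 * (1 + La * gm ^+ 2)))).
  rewrite ler_wpM2l ?divr_ge0 ?sqr_ge0//; apply: (le_trans h1).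
  have -> : 3 / 2 * (kap * lam) ^+ 2 + La * gm * lam * (gm * (kap * lam)) =
    kap * lam ^+ 2 * (3 / 2 * kap + La * gm ^+ 2) by ring.
  apply: ler_wpM2l; first by rewrite mulr_ge0 ?sqr_ge0// ltW.
  by have := kap16; lra.
rewrite /inner_ratio le_eqVlt; apply/orP; left; apply/eqP.
have g1 : 1 + La * gm ^+ 2 != 0 by rewrite lt0r_neq0// ltr_wpDr// mulr_ge0 ?sqr_ge0// ltW.
have l1 : lam != 0 by exact: lt0r_neq0.
move: (1 + La * gm ^+ 2) lam g1 l1 => u v u0 v0; field.
by rewrite u0.
Qed.

(** Each kernel is O ((sigma lam)^(- d)) with weight eps^d, and at most eta 2^(i d) of them occur;
    since 2^i eps = 4 lam, the powers of lam cancel. *)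
Lemma inner_hbad z : enorm (z - z0) <= inner_radius -> hbad z <= c4 / 4.
Proof.
move=> zz; have tz := inner_depth _ zz; have zl := inner_ball _ zz.
have zb := cell_ball_inbox _ zl.
have rz : rho z < 0 by have := mulr_gt0 m0p taup; lra.
have slp : 0 < sigma * lam by rewrite mulr_gt0.
pose T := (A * (2 * N * r) + gm) / (sigma * lam) ^+ d.
have T1 w : hkernel A (grad rho (y w)) (z - y w) <= T.
  have wlo : sigma * lam <= enorm (z - y w).
    have := inbox_lip _ _ zb (y_inbox w); rewrite y_rho subr0 ltr0_norm// => h.
    have : m0 * tau / 2 <= M * N * enorm (z - y w) by lra.
    rewrite -ler_pdivrMl ?mulr_gt0// => /(le_trans _); apply.
    rewrite /pole_ratio le_eqVlt; apply/orP; left; apply/eqP.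
    move: (lt0r_neq0 Mp) (lt0r_neq0 Np); move: kap lam (M) N => u v a b a0 b0; field.
    by rewrite a0 b0.
  have w0 : 0 < enorm (z - y w) by exact: lt_le_trans wlo.
  have whi : enorm (z - y w) <= 2 * N * r.
    apply: (le_trans (enorm_le_nl1 _)); apply: (@le_trans _ _ (\sum_(k < n + n) 2 * r)).
      apply: ler_sum => k _; rewrite rcB; have := zb k; have := y_inbox w k.
      have -> : rc k z - rc k (y w) = (rc k z - rc k P0) - (rc k (y w) - rc k P0) by ring.
      by have := ler_normB (rc k z - rc k P0) (rc k (y w) - rc k P0); lra.
    by rewrite sumr_const card_ord -[(_ *+ _)%R]mulr_natl; lra.
  have Xw : - cdot (grad rho (y w)) (z - y w) <= gm * enorm (z - y w).
    have h1 := cdot_le (grad rho (y w)) (z - y w).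
    have h2 := ler_wpM2r (enorm_ge0 (z - y w)) (chart_grad_le _ _ _ _ _ _ _ Ch _ (y_inbox w)).
    have := ler_norm (- cdot (grad rho (y w)) (z - y w)); rewrite normrN; lra.
  rewrite /hkernel -enorm_sqr; move: (enorm (z - y w)) Xw whi wlo w0 => e Xw whi wlo w0.
  apply: (@le_trans _ _ ((A * (2 * N * r) + gm) * e * (e ^+ 2)^-1 ^+ n)).
    rewrite ler_wpM2r ?exprn_ge0 ?invr_ge0 ?sqr_ge0//.
    have := ler_wpM2r (ltW w0) (ler_wpM2l (ltW Ap) whi); rewrite expr2 => h; lra.
  have -> : (A * (2 * N * r) + gm) * e * (e ^+ 2)^-1 ^+ n = (A * (2 * N * r) + gm) / e ^+ d.
    rewrite exprVn -exprM; have -> : (2 * n)%N = ((2 * n).-1).+1 by rewrite prednK// muln_gt0.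
    by rewrite succnK exprS; field; rewrite expf_neq0 lt0r_neq0.
  rewrite ler_wpM2l//; first by rewrite addr_ge0// ?mulr_ge0// ltW.
  by rewrite lef_pV2 ?posrE ?exprn_gt0// lerXn2r// nnegrE ltW.
apply: (@le_trans _ _ (\sum_(w | bad w) eps ^+ d * T)).
  by apply: ler_sum => w _; rewrite ler_wpM2l// exprn_ge0// ltW.
rewrite sumr_const -[(_ *+ _)%R]mulr_natl.
have T0 : 0 <= T.
  by rewrite divr_ge0 ?exprn_ge0 ?(ltW slp)// addr_ge0// ?mulr_ge0// ltW.
apply: (@le_trans _ _ (eta * (2 ^+ i) ^+ d * (eps ^+ d * T))).
  by rewrite ler_wpM2r// mulr_ge0// exprn_ge0// ltW.
have -> : eta * (2 ^+ i) ^+ d * (eps ^+ d * T) =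
    eta * (4 ^+ d * (A * (2 * N * r) + gm)) / sigma ^+ d.
  have gen (a b c e : R) : c * a ^+ d * (b ^+ d * e) = c * ((a * b) ^+ d * e).
    by rewrite exprMn; ring.
  rewrite gen -ellE; have -> : ell = 4 * lam by field.
  rewrite /T [(4 * lam) ^+ _]exprMn [(sigma * lam) ^+ _]exprMn.
  have l1 : lam ^+ d != 0 by rewrite expf_neq0// lt0r_neq0.
  have s1 : sigma ^+ d != 0 by rewrite expf_neq0// lt0r_neq0.
  move: (lam ^+ d) (sigma ^+ d) l1 s1 => u v u0 v0; field.
  by rewrite v0 u0.
rewrite ler_pdivrMr ?exprn_gt0//; apply: (le_trans eta_small).
by rewrite mulrAC.
Qed.

(** The smallness of [hbad] is used twice: through [hbad_lower] it forces z into a good cone, and in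
    the majorant it leaves at most 1 / 4 + 1 / 8 - 1 < - 1 / 2. *)
Lemma inner_bound z : enorm (z - z0) <= inner_radius ->
  rho z < 0 /\ normc (f z) <= expR (- (L / 2)).
Proof.
move=> zz; have tz := inner_depth _ zz; have zl := inner_ball _ zz.
have rz : rho z < 0 by have := mulr_gt0 m0p taup; lra.
have hb := inner_hbad _ zz; have br := inner_barrier _ zz; have c4p := kernel_lb_gt0.
have e1 : (1 + theta^-1) * eps <= - rho z by have := eps_small; lra.
have e0 := eps_gt0; have te0 : 0 < theta^-1 * eps by rewrite mulr_gt0// invr_gt0.
split=> //; have [far|] := pselect (forall w, ~~ bad w -> - rho z <= beta * enorm (z - Pt w)).
  exfalso; have : c4 <= hbad z.
    by apply: hbad_lower => //; rewrite -ler_pdivrMl//; lra.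
  lra.
move=> /existsNP[w /not_implyP[gw /negP]]; rewrite -ltNge => wt.
have Gz : good_region z.
  by split=> //; split; [lra|exists w => //; exact: ltW].
apply: (le_trans (majorant_bound _ Gz)); rewrite ler_expR /majorant.
have -> : - (L / 2) = L * - (1 / 2) by ring.
rewrite ler_wpM2l ?(ltW L_gt0)//.
have : c4^-1 * hbad z <= 1 / 4 by rewrite ler_pdivrMl//; lra.
lra.
Qed.

End chart_cell.

(** * Vanishing near an inner point *)

Lemma code_divX {I : finType} k i (v : I -> nat) :
  (code (k + i) v %/ @nchild I ^ i)%N = code k (fun l => v l %/ 2 ^ i)%N.
Proof.
elim: i v => [|i IH] v.
  by rewrite addn0 divn1; congr code; apply/funext => l; rewrite divn1.
rewrite addnS expnS divnMA code_div IH; congr code; apply/funext => l.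
by rewrite -divn2 -divnMA -expnS.
Qed.

Section local_uniqueness.
Context {R : realType} {n : nat}.
Local Notation Cn := 'rV[R[i]]_n.
Variables (rho : Cn -> R) (P0 : Cn) (r M m0 s : R) (k0 : 'I_(n + n)).
Hypothesis Ch : chart rho P0 r M m0 s k0.
Implicit Types (x y z P : Cn).
Local Notation I := (free_coord k0).
Local Notation N := ((n + n)%:R : R).
Local Notation sc := (@chart_scale R n r M m0).
Local Notation theta := (@chart_theta R n M).
Local Notation beta := (@chart_beta R n M m0).
Local Notation A := (@chartA R n M).
Local Notation idx := (@idx R n P0 r M m0 k0).
Local Notation La := (@barrier_La R n m0).
Local Notation d := (2 * n).-1.
Local Notation cube_code := (@cube_code R n P0 r M m0 k0).

Let thp : 0 < theta. Proof. exact: theta_gt0 Ch. Qed.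
Let scp : 0 < sc. Proof. exact: scale_gt0 Ch. Qed.
Let rp : 0 < r. Proof. exact: chart_r Ch. Qed.
Let Mp : 0 < M. Proof. exact: chart_M Ch. Qed.
Let m0p : 0 < m0. Proof. exact: chart_m0 Ch. Qed.
Let np : (0 < n)%N. Proof. exact: dim_gt0 k0. Qed.
Let Np : 0 < N. Proof. by rewrite ltr0n addn_gt0 np. Qed.
Let bp : 0 < beta. Proof. exact: beta_gt0 Ch. Qed.
Let Lap : 0 < La. Proof. exact: barrier_La_gt0 Ch. Qed.

Lemma cube_code_divX k i P : (cube_code (k + i) P %/ @nchild I ^ i)%N = cube_code k P.
Proof.
elim: i => [|i IH]; first by rewrite addn0 divn1.
by rewrite addnS expnS divnMA cube_code_div.
Qed.

Lemma graph_point (u : I -> R) : (forall l, `|u l - rc (val l) P0| <= sc / 2) ->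
  exists y, [/\ inbox P0 r y, rho y = 0, forall l : I, rc (val l) y = u l &
    forall k, `|rc k y - rc k P0| <= r / 2].
Proof.
(* The default 0 occurs only at [k0], where the value is not read. *)
move=> hu; pose v k := if insub k is Some l then u l else 0.
have vE (l : I) : v (val l) = u l by rewrite /v valK.
have sr : sc / 2 <= r / 2 by rewrite ler_pM2r// scale_le_r.
have [||||y [yb y0 yv yk]] := chart_graph _ _ _ _ _ _ _ Ch (sc / 2) v.
- by rewrite divr_ge0// ltW.
- exact: scale_le Ch.
- exact: sr.
- by move=> k kk0; have := hu (exist _ k kk0); rewrite -vE.
exists y; split=> // [l|k]; first by rewrite yv ?vE//; exact: valP l.
have [->//|kk0] := eqVneq k k0; rewrite yv//; apply: le_trans sr.
by have := hu (exist _ k kk0); rewrite -vE.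
Qed.

Variables (Omega : set Cn) (f : Cn -> R[i]) (S : set Cn) (delta : R).
Hypothesis OmegaE : Omega = [set z | rho z < 0].
Hypothesis hf : holomorphic Omega f.
Hypothesis rho_bd : forall P, boundary Omega P -> rho P = 0.

(** At depth t the distance to the boundary is at least t / (M N), while the cone gives |z - P| <= t
    / beta = alpha t / (M N). *)
Definition chart_aperture : R := M * N / beta.
Local Notation alpha := chart_aperture.

Lemma approach_cone kq yc z P : rho yc = 0 -> (forall k, `|rc k yc - rc k P0| <= r / 2) ->
  enorm (z - yc) <= @cell_size R n r M m0 kq / 4 -> rho z < 0 -> boundary Omega P ->
  beta * enorm (z - P) <= - rho z -> approach_region Omega alpha P z.
Proof.
move=> yc0 ycb zy z0 bP hz; split; first by rewrite OmegaE.
have MN : 0 < M * N by rewrite mulr_gt0.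
have t0 : 0 < - rho z by rewrite oppr_gt0.
have hd : - rho z / (M * N) <= dist_to z (boundary Omega).
  apply: lb_le_inf; first by exists (enorm (z - P)), P.
  move=> _ [w bw <-]; rewrite ler_pdivrMr// mulrC.
  have [wb|] := pselect (inbox P0 r w).
    have := inbox_lip _ _ _ _ _ _ _ Ch z w (cell_ball_inbox _ _ _ _ _ _ _ Ch kq yc ycb z zy) wb.
    by rewrite (rho_bd _ bw) subr0 ltr0_norm.
  (* A boundary point outside the box is at distance at least r / 4 >= lam, and t / (M N) <= lam. *)
  move=> /existsNP[k /negP]; rewrite -leNgt => wk.
  have h1 := cell_ball_box _ _ _ _ _ _ _ Ch kq yc ycb z k zy.
  have h2 := rc_le_enorm k (z - w).
  have h3 := cell_ball_rho _ _ _ _ _ _ _ Ch kq yc yc0 ycb z zy.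
  rewrite ltr0_norm// in h3; apply: (le_trans h3); rewrite ler_pM2l//.
  have h4 := cell_size_le _ _ _ _ _ _ _ Ch kq.
  have : `|rc k w - rc k P0| <= `|rc k z - rc k w| + `|rc k z - rc k P0|.
    have -> : rc k w - rc k P0 = (rc k z - rc k P0) - (rc k z - rc k w) by ring.
    by rewrite [leRHS]addrC ler_normB.
  by rewrite rcB in h2; lra.
have h1 : enorm (z - P) <= - rho z / beta by rewrite ler_pdivlMr// mulrC.
have a0 : 0 < 1 + alpha by rewrite ltr_wpDr// divr_ge0 ?ltW.
have := ler_wpM2l (ltW a0) hd; apply: lt_le_trans.
apply: (le_lt_trans h1); rewrite mulrDl mul1r.
have -> : alpha * (- rho z / (M * N)) = - rho z / beta.
  rewrite /chart_aperture; move: (lt0r_neq0 Mp) (lt0r_neq0 Np) (lt0r_neq0 bp).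
  move: beta (M) N => b u v u0 v0 b0; field.
  by rewrite u0 v0 b0.
by rewrite ltrDr divr_gt0.
Qed.

Hypothesis S_bd : S `<=` boundary Omega.
Hypothesis S_box : S `<=` small_box rho P0 r M m0.
Hypothesis S_pos : (0 < area_outer R n S)%E.
Hypothesis delta_gt0 : 0 < delta.
Hypothesis f_le1 : forall P z, S P -> approach_region Omega alpha P z ->
  enorm (z - P) < delta -> normc (f z) <= 1.
Hypothesis f_lim : forall P, S P -> forall e : R, 0 < e -> exists2 h, 0 < h &
  forall z, approach_region Omega alpha P z -> enorm (z - P) < h -> normc (f z) <= e.

(** In the bottom layer the depth is at most (1 + 1 / theta) eps, so the distance to the apex is at
    most that over beta; the factor 2 makes the inequality strict. *)
Let A1 := 2 * (1 + theta^-1) / beta.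

(** L is a natural number so that the set formed on the line is a countable intersection. *)
Let decay_cell (L k : nat) : set nat := [set c | exists P, [/\ S P, cube_code k P = c &
  forall z, approach_region Omega alpha P z -> enorm (z - P) < A1 * sc / 2 ^+ k ->
    normc (f z) <= expR (- L%:R)]].

Let idx_lt2 k P l : S P -> (idx k P l < 2 ^ k)%N.
Proof.
move=> SP; apply: idx_lt; apply: (unit_coord_itv _ _ _ _ _ _ _ Ch).
exact: (S_box _ SP).2.
Qed.

Let decay_eventually P : S P ->
  forall L, exists j, forall k, (j <= k)%N -> decay_cell L k (cube_code k P).
Proof.
move=> SP L; have [h h0 hz] := f_lim _ SP _ (expR_gt0 (- L%:R)).
have [j hj] := divr_exp2_small (A1 * sc) h h0; exists j => k jk.
exists P; split=> // z az zP; apply: hz => //.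
by apply: lt_trans zP _; exact: hj.
Qed.

Let K := @nchild I.

Let KE : K = (2 ^ d)%N.
Proof. by rewrite /K nchildE card_free_coord. Qed.

Let d_gt0 : (0 < d)%N.
Proof. by rewrite -ltnS prednK ?muln_gt0// mul2n -addnn (leq_add np np). Qed.

Let lo (l : I) : R := rc (val l) P0 - sc / 2.

Lemma local_uniqueness : exists z0, Omega z0 /\ nbhs z0 [set z | f z = 0].
Proof.
have MNp : 0 < M * N by rewrite mulr_gt0.
have Ap : 0 < A by rewrite /chartA mulr_gt0// exprn_gt0.
have c4p : 0 < @kernel_lb R n M m0 by exact: kernel_lb_gt0 Ch.
have sgp : 0 < @pole_ratio R n M m0 by exact: pole_ratio_gt0 Ch.
have kpp : 0 < @inner_ratio R n M m0 by exact: inner_ratio_gt0 Ch.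
have thV : 0 < 1 + theta^-1 by rewrite ltr_wpDr// invr_ge0 ltW.
pose W := 4 ^+ d * (A * (2 * N * r) + N * M).
have Wp : 0 < W by rewrite mulr_gt0 ?exprn_gt0// addr_gt0 ?mulr_gt0.
(* The bound 1 / 2 keeps eta below 1; the other one is the smallness condition of [inner_hbad]
   solved for eta. *)
pose eta := Num.min (1 / 2) (@kernel_lb R n M m0 * @pole_ratio R n M m0 ^+ d / 4 / W).
have eta01 : 0 < eta < 1.
  apply/andP; split; last by rewrite gt_min; apply/orP; left; lra.
  rewrite lt_min; apply/andP; split; first lra.
  by apply: divr_gt0 => //; apply: divr_gt0 => //; rewrite mulr_gt0// exprn_gt0.
have half : 0 < 1 / 2 :> R by lra.
(* Beyond these levels lam satisfies both conditions of the barrier, and cone points in the ball of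
   radius lam are within [delta] of their apex. *)
have [a1 ha1] := divr_exp2_small (La * A ^+ 2 * sc * (sc / 4)) _ half.
have [a2 ha2] := divr_exp2_small (La * (N * M) * A * (sc / 4)) _ half.
have [a3 ha3] := divr_exp2_small (M * N * (sc / 4) / beta) _ delta_gt0.
have K1 : (1 < K)%N by rewrite KE -{1}(expn0 2) ltn_exp2l.
have Kpos j : (0 < K ^ j)%N by rewrite expn_gt0 ltnW.
have C0_ge0 : 0 <= @chart_C3 R n M m0 * (sc / theta).
  by rewrite mulr_ge0 ?divr_ge0 ?(ltW scp) ?(ltW thp)// ltW//; exact: C3_gt0 Ch.
have diam k P P' SP SP' := cube_code_diam _ _ _ _ _ _ _ Ch k P P' (S_box _ SP) (S_box _ SP').
have [kq [c0 [Kkq dens]]] := density_cell K S cube_code _ K1 KE (fun=> erefl)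
  (@cube_code_div R n P0 r M m0 k0) C0_ge0 diam
  decay_cell eta (maxn a1 (maxn a2 a3)) S_pos eta01 decay_eventually.
(* As eta < 1, some subcell is good, already for L = 0; its point of S has code [c0] at level [kq]
   and provides the integer coordinates of the cube. *)
have [P1 SP1 P1c] : exists2 P, S P & cube_code kq P = c0.
  have [k [_ kqk]] := dens 0%N 0%N; set bad := [pred i | _] => bad_le.
  have [j gj] : exists j, ~~ bad j.
    apply/existsP; apply: contraPT bad_le => /existsPn h; apply/negP; rewrite -ltNge.
    have -> : #|bad| = (K ^ (k - kq))%N.
      rewrite -[RHS]card_ord; apply: eq_card => j; rewrite !inE.
      by have := h j; rewrite negbK.
    rewrite natrX gtr_pMl ?exprn_gt0 ?ltr0n ?(ltnW K1)//; case/andP: eta01.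
    by rewrite gt_min => _ _; apply/orP; left; lra.
  move: gj; rewrite negbK => /asboolP[P [SP Pc _]]; exists P => //.
  have := cube_code_divX kq (k - kq) P; rewrite subnKC// Pc => <-.
  by rewrite divnMDl// divn_small ?addn0.
pose q := idx kq P1; have qlt l : (q l < 2 ^ kq)%N by exact: idx_lt2.
pose ell : R := @cell_size R n r M m0 kq; pose lam := ell / 4.
have ellp : 0 < ell by exact: cell_size_gt0 Ch kq.
have lamp : 0 < lam by rewrite divr_gt0.
have pk (k : nat) : 0 < 2 ^+ k :> R by rewrite exprn_gt0.
have [yc [ycb yc0 ycl yck]] : exists y, [/\ inbox P0 r y, rho y = 0,
    forall l : I, rc (val l) y = lo l + (q l)%:R * ell + ell / 2 &
    forall k, `|rc k y - rc k P0| <= r / 2].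
  apply: graph_point => l; rewrite /lo.
  have h1 : ((q l)%:R + 1) * ell <= sc.
    have -> : sc = 2 ^+ kq * ell by rewrite /ell /cell_size mulrC divfK// lt0r_neq0.
    by rewrite ler_pM2r// natr1 -natrX ler_nat.
  have h2 : 0 <= (q l)%:R * ell by rewrite mulr_ge0// ltW.
  by rewrite ler_norml; apply/andP; split; lra.
have lamE : lam = sc / 4 / 2 ^+ kq by rewrite /lam /ell /cell_size mulrAC.
have lam1 : La * A ^+ 2 * lam ^+ 2 <= 1 / 2.
  have lsc : lam <= sc.
    have p1 : 1 <= 2 ^+ kq :> R by rewrite exprn_ege1// ler1n.
    by rewrite lamE ler_pdivrMr//; have := ler_wpM2l (ltW scp) p1; have := scp; lra.
  have : La * A ^+ 2 * sc * (sc / 4) / 2 ^+ kq <= 1 / 2.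
    by apply/ltW/ha1; rewrite (leq_trans (leq_maxl _ _) Kkq).
  rewrite -mulrA -lamE; apply: le_trans; rewrite [lam ^+ 2]expr2 mulrA ler_wpM2r ?(ltW lamp)//.
  by rewrite ler_wpM2l// mulr_ge0 ?sqr_ge0// ltW.
have lam2 : La * (N * M) * lam * A <= 1 / 2.
  rewrite lamE mulrAC [_ * (_ / _)]mulrA; apply/ltW/ha2.
  by apply: leq_trans Kkq; rewrite !leq_max leqnn orbT.
have lam3 : M * N * lam / beta < delta.
  have -> : M * N * lam / beta = M * N * (sc / 4) / beta / 2 ^+ kq by rewrite lamE mulrA mulrAC.
  by apply: ha3; apply: leq_trans Kkq; rewrite !leq_max leqnn !orbT.
(* The inner point and radius depend on [kq] alone; the level, the bad subcubes and the poles are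
   chosen anew for each L. *)
have decay_near L : (0 < L)%N -> forall z, enorm (z - inner_point r M m0 s k0 kq yc) <=
    @inner_radius R n r M m0 kq -> normc (f z) <= expR (- (L%:R / 2)).
  move=> L0.
  have e0 : 0 < m0 * @inner_ratio R n M m0 * lam / 4 by rewrite divr_gt0// !mulr_gt0.
  have [K2 hK2] := divr_exp2_small ((1 + theta^-1) * sc) _ e0.
  have [k [K2k kqk bad_le]] := dens L K2.
  have [i kE] : exists i, k = (kq + i)%N by exists (k - kq)%N; rewrite subnKC.
  subst k; rewrite addKn in bad_le; pose eps : R := sc / 2 ^+ (kq + i).
  have epsp : 0 < eps by rewrite divr_gt0.
  pose ai := @abs_idx n k0 i q.
  have ai_lt w l : (ai w l < 2 ^ (kq + i))%N.
    rewrite /ai /abs_idx expnD (@leq_trans ((q l).+1 * 2 ^ i))//.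
      by rewrite mulSn addnC ltn_add2r.
    by rewrite leq_mul2r qlt orbT.
  have ai_div w l : (ai w l %/ 2 ^ i)%N = q l.
    by rewrite /ai /abs_idx divnMDl ?expn_gt0// divn_small ?addn0.
  pose bad : pred {ffun I -> 'I_(2 ^ i)} :=
    fun w => ~~ `[< decay_cell L (kq + i) (code (kq + i) (ai w)) >].
  have /choice[y hy] : forall w, exists y, [/\ inbox P0 r y, rho y = 0,
      forall l : I, rc (val l) y = lo l + (ai w l)%:R * eps &
      forall k, `|rc k y - rc k P0| <= r / 2].
    move=> w; apply: graph_point => l; rewrite /lo.
    have h1 : (ai w l)%:R * eps <= sc.
      have -> : sc = 2 ^+ (kq + i) * eps by rewrite /eps mulrC divfK// lt0r_neq0.
      by rewrite ler_pM2r// -natrX ler_nat ltnW.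
    have h2 : 0 <= (ai w l)%:R * eps by rewrite mulr_ge0// ltW.
    by rewrite ler_norml; apply/andP; split; lra.
  have /choice[Pt hPt] : forall w, exists P, ~~ bad w -> [/\ S P,
      cube_code (kq + i) P = code (kq + i) (ai w) &
      forall z, approach_region Omega alpha P z -> enorm (z - P) < A1 * sc / 2 ^+ (kq + i) ->
        normc (f z) <= expR (- L%:R)].
    move=> w; have [bw|] := boolP (bad w); first by exists P0.
    by rewrite negbK => /asboolP[P hP]; exists P.
  (* All subcubes have codes in the block of [c0], and the offset in the block is injective, so the
     count of bad offsets bounds that of bad subcubes. *)
  have card_bad : #|bad|%:R <= eta * (2 ^+ i) ^+ d.
    have hlt w : (code (kq + i) (ai w) %% K ^ i < K ^ i)%N by rewrite ltn_pmod.
    pose h w : 'I_(K ^ i) := Ordinal (hlt w).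
    have codeE w : code (kq + i) (ai w) = (c0 * K ^ i + h w)%N.
      rewrite {1}(divn_eq (code (kq + i) (ai w)) (K ^ i)) code_divX -P1c; congr (_ * _ + _)%N.
      by congr code; apply/funext => l; exact: ai_div.
    have h_inj : injective h.
      move=> w w' E; have : code (kq + i) (ai w) = code (kq + i) (ai w') by rewrite !codeE E.
      move=> /(code_inj _ _ _ (ai_lt w) (ai_lt w')) E'; apply/ffunP => l; apply: ord_inj.
      by have := E' l; rewrite /ai /abs_idx => /addnI.
    have -> : (2 ^+ i) ^+ d = K%:R ^+ i :> R by rewrite KE natrX -!exprM mulnC.
    apply: le_trans bad_le; rewrite ler_nat -(fintype.card_image h_inj).
    apply: subset_leq_card; apply/fintype.subsetP => _ /fintype.imageP[w wb ->].
    by rewrite inE -codeE.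
  have tb w z : ~~ bad w -> beta * enorm (z - Pt w) <= - rho z ->
      enorm (z - Pt w) <= - rho z / beta by rewrite ler_pdivlMr// mulrC.
  have appr w z : ~~ bad w -> rho z < 0 -> enorm (z - yc) <= lam ->
      beta * enorm (z - Pt w) <= - rho z -> approach_region Omega alpha (Pt w) z.
    move=> gw z0 zy zw; have [SP _ _] := hPt _ gw.
    by apply: (approach_cone kq yc) => //; exact: S_bd.
  move=> z zz; apply: (inner_bound _ _ _ _ _ _ _ Ch kq i q yc yc0 yck ycl bad y Pt _ _ _ _ _
    lam1 lam2 Omega f L%:R OmegaE hf _ _ _ eta card_bad _ _ z zz).2.
  - by move=> w; have [] := hy w.
  - by move=> w; have [] := hy w.
  - by move=> w; have [] := hy w.
  - by move=> w /hPt[/S_box].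
  - move=> w /hPt[SP Pc _]; apply: code_inj Pc => l; first exact: idx_lt2.
    exact: ai_lt.
  - by rewrite ltr0n.
  - move=> w x gw x0 xy xw; have [SP _ _] := hPt _ gw.
    apply: f_le1 SP (appr _ _ gw x0 xy xw) _; apply: le_lt_trans (tb _ _ gw xw) _.
    have bV : 0 < beta^-1 by rewrite invr_gt0; exact: bp.
    apply: le_lt_trans lam3; rewrite (ler_pM2r bV).
    by have := cell_ball_rho _ _ _ _ _ _ _ Ch kq yc yc0 yck x xy; rewrite ltr0_norm.
  - move=> w x gw x0 xy xw xe; have [SP _ hP] := hPt _ gw.
    apply: hP (appr _ _ gw x0 xy xw) _; apply: le_lt_trans (tb _ _ gw xw) _.
    rewrite ltr_pdivrMr//; apply: (le_lt_trans xe).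
    have -> : A1 * sc / 2 ^+ (kq + i) * beta = 2 * ((1 + theta^-1) * (sc / 2 ^+ (kq + i))).
      rewrite /A1; move: (lt0r_neq0 bp) (lt0r_neq0 (pk (kq + i)%N)).
      move: (1 + theta^-1) beta (2 ^+ (kq + i)) sc => u v p t v0 p0; field.
      by rewrite p0 v0.
    by have := mulr_gt0 thV epsp; rewrite -/eps; lra.
  - have : eta <= @kernel_lb R n M m0 * @pole_ratio R n M m0 ^+ d / 4 / W.
      by rewrite ge_min lexx orbT.
    by rewrite ler_pdivlMr.
  - by have := ltW (hK2 _ K2k); rewrite -[X in X <= _]mulrA.
have rpos : 0 < @inner_radius R n r M m0 kq by exact: inner_radius_gt0 Ch kq.
exists (inner_point r M m0 s k0 kq yc); split.
  rewrite OmegaE /=.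
  have := inner_depth _ _ _ _ _ _ _ Ch kq yc yc0 yck (inner_point r M m0 s k0 kq yc).
  rewrite subrr enorm0 => /(_ (ltW rpos)).
  have : 0 < m0 * (@inner_ratio R n M m0 * lam / 2) / 2 by rewrite divr_gt0// mulr_gt0//
    divr_gt0// mulr_gt0.
  rewrite -/lam; lra.
apply/nbhs_enormP; exists (@inner_radius R n r M m0 kq) => // z zz /=.
apply: eq0_normc; apply/eqP; rewrite eq_le normc_ge0 andbT.
apply: (expR_decay _ 1 (1 / 2)) => // L L0; rewrite mul1r.
apply: (le_trans (decay_near (Num.truncn L).+1 isT z (ltW zz))).
rewrite ler_expR lerN2; have := truncnS_gt L; lra.
Qed.

End local_uniqueness.

(** * Boundary, traces and localization of outer area *)

Section boundary_facts.
Context {R : realType} {n : nat}.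
Local Notation Cn := 'rV[R[i]]_n.
Implicit Types (z P : Cn) (Omega : set Cn).

Lemma boundary_closed Omega : closed (boundary Omega).
Proof.
rewrite /boundary setDE; apply: closedI; first exact: closed_closure.
by apply: open_closedC; exact: open_interior.
Qed.

Lemma bounded_set_enorm Omega : bounded_set Omega ->
  exists M : R, forall z, Omega z -> enorm z <= M.
Proof.
move=> [M0 [rM0 hM0]].
have /hM0 h : M0 < M0 + 1 by rewrite ltrDl.
exists (\sum_(j < n) Re (M0 + 2)) => z Oz; apply: le_trans (enorm_le_sum z) _.
apply: ler_sum => j _; have : ball (0 : Cn) (M0 + 2) z.
  rewrite mx_norm_ball /ball_/= sub0r normrN; apply: le_lt_trans (h _ Oz) _.
  by rewrite ltrD2l (ltr_nat _ 1 2).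
case=> _ /(_ 0 j); rewrite /ball/= mxE sub0r normrN normCE ltcE /= => /andP[_].
exact: ltW.
Qed.

Lemma boundary_compact Omega : bounded_set Omega -> compact (boundary Omega).
Proof.
move=> /bounded_set_enorm[M hM]; apply: (@compact_Cn _ _ _ M (boundary_closed Omega)).
move=> z [cz _]; have cM : closed [set x : Cn | enorm x <= M].
  have -> : [set x : Cn | enorm x <= M] = [set x | enorm (x - 0) <= M].
    by apply/seteqP; split => x /=; rewrite subr0.
  by apply: closed_le_continuous; [exact: enorm_continuous|exact: cst_continuous].
by have := closureS hM; rewrite -((closure_id _).1 cM) => /(_ z cz).
Qed.

Lemma boundary_rho0 (rho : Cn -> R) Omega : continuous rho -> Omega = [set z | rho z < 0] ->
  forall P, boundary Omega P -> rho P = 0.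
Proof.
move=> crho OE P [cP nP]; apply/eqP; rewrite eq_le; apply/andP; split.
  have cM : closed [set x : Cn | rho x <= 0].
    by apply: closed_le_continuous => //; exact: cst_continuous.
  have OM : Omega `<=` [set x : Cn | rho x <= 0] by move=> x; rewrite OE /= => /ltW.
  by have := closureS OM; rewrite -((closure_id _).1 cM) => /(_ P cP).
rewrite leNgt; apply/negP => P0; apply: nP; rewrite /interior OE.
exact: (cvgr_lt _ (crho P) 0 P0).
Qed.

Lemma boundary_trace_le Omega (f : Cn -> R[i]) P (alpha : R) :
  boundary_trace Omega f P 0 -> 0 < alpha -> forall e : R, 0 < e ->
  exists2 h, 0 < h & forall z, approach_region Omega alpha P z -> enorm (z - P) < h ->
    normc (f z) <= e.
Proof.
move=> tr a0 e e0; have : nbhs (0 : R[i]) [set w | normc w <= e].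
  apply/nbhs_ballP; exists e%:C => /=; first by rewrite ltcR.
  by move=> w; rewrite /ball/= sub0r normrN normCE ltcR => /ltW.
move=> /(tr _ a0); rewrite /= => /nbhs_enormP[h h0 hz]; exists h => // z az zh.
exact: hz zh az.
Qed.

Lemma ball_open P (h : R) : open [set z | enorm (z - P) < h].
Proof.
rewrite openE => z zP; exact: (cvgr_lt _ (enorm_continuous P z) h zP).
Qed.

(** Otherwise every point of K has a ball meeting B in a null set, and finitely many of these balls
    cover K. *)
Lemma outer_null_compact (mu : {outer_measure set Cn -> \bar R}) (B K : set Cn) :
  compact K -> B `<=` K -> (0 < mu B)%E ->
  exists2 P, K P & forall h : R, 0 < h -> (0 < mu (B `&` [set z | (enorm (z - P) < h)%R]))%E.
Proof.
move=> cK BK muB; apply/not_exists2P => H.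
pose D := [set p : Cn * R | mu (B `&` [set z | enorm (z - p.1) < p.2]) = 0%E].
move: cK; rewrite compact_cover => /(_ _ D (fun p => [set z | enorm (z - p.1) < p.2])).
case=> [p _||D' D'D cov]; first exact: ball_open.
  move=> z Kz; have [/(_ Kz)//|/existsNP[h /not_implyP[h0 /negP]]] := H z.
  rewrite -leNgt => mu0; exists (z, h) => /=; last by rewrite subrr enorm0.
  by apply/eqP; rewrite eq_le mu0 outer_measure_ge0.
have null (l : seq (Cn * R)) : {subset l <= D} ->
    mu (B `&` [set z | exists2 p, p \in l & enorm (z - p.1) < p.2]) = 0%E.
  elim: l => [_|p l IH lD].
    rewrite (_ : _ `&` _ = set0) ?outer_measure0//.
    by apply/seteqP; split => // x [_ []].
  apply/eqP; rewrite eq_le outer_measure_ge0 andbT.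
  have l0 := IH (fun u ul => lD u (@mem_behead _ (p :: l) u ul)).
  have p0 : mu (B `&` [set z | enorm (z - p.1) < p.2]) = 0%E.
    by have := lD p (mem_head p l); rewrite inE.
  rewrite -[leRHS](adde0 0%E) -{1}p0 -l0; apply: le_trans (outer_measureU2 _ _ _).
  apply: le_outer_measure => x [Bx [p' + xp]]; rewrite inE => /orP[/eqP <-|pl].
    by left.
  by right; split => //; exists p'.
move: muB; rewrite -(null (finmap.enum_fset D') D'D); apply/negP; rewrite -leNgt.
apply: le_outer_measure => x Bx; split => //.
by have [p pD xp] := cov _ (BK _ Bx); exists p.
Qed.

End boundary_facts.

(** * From the boundary to the whole domain *)

Theorem theorem5p2 (R : realType) (n : nat) (Omega : set 'rV[R[i]]_n)
    (p : \bar R) (f : 'rV[R[i]]_n -> R[i]) (E : set (area_space R n)) :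
  domain Omega -> bounded_set Omega -> C2_boundary Omega ->
  (0 < p)%E -> hardy p Omega f ->
  E `<=` boundary Omega -> measurable E -> (0 < area R n E)%E ->
  {ae area R n, forall P, E P -> boundary_trace Omega f P 0} ->
  forall z, Omega z -> f z = 0.
Proof.
move=> [oO cO] bO [rho [C2 OE nz]] _ [hf _] Eb _ E0 [Z [_ Z0 EZ]].
(* The part of [E] with vanishing trace has positive outer area because the exceptional points lie
   in the null set [Z]. *)
pose B : set 'rV[R[i]]_n := [set P | E P /\ boundary_trace Omega f P 0].
have B0 : (0 < area_outer R n B)%E.
  apply: (lt_le_trans E0); rewrite -[leRHS]adde0 -Z0.
  apply: le_trans (outer_measureU2 _ _ _); apply: le_outer_measure => P EP.
  have [tP|ntP] := pselect (boundary_trace Omega f P 0); [by left|right].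
  by apply: EZ => /(_ EP).
have crho : continuous rho by have [] := C2.
have rho_bd := boundary_rho0 rho Omega crho OE.
(* [B] has positive outer area at every scale around P0, so the chart can be fixed first and [S] cut
   to its size. *)
have [P0 bP0 hP0] := outer_null_compact (area_outer R n) B _ (boundary_compact _ bO)
  (fun P h => Eb P h.1) B0.
have [r [M [m0 [s [k0 Ch]]]]] := class_C2_chart rho P0 C2 (rho_bd _ bP0) (nz _ bP0).
have scp : 0 < @chart_scale R n r M m0 / 2 by rewrite divr_gt0// (scale_gt0 _ _ _ _ _ _ _ Ch).
pose S := B `&` [set z | enorm (z - P0) < @chart_scale R n r M m0 / 2].
have S0 : (0 < area_outer R n S)%E by exact: hP0.
pose alpha := @chart_aperture R n M m0.
have alpha_gt0 : 0 < alpha.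
  apply: divr_gt0; last exact: beta_gt0 Ch.
  by rewrite mulr_gt0 ?(chart_M Ch)// ltr0n addn_gt0 (dim_gt0 k0).
(* These sets exhaust [S], so by countable subadditivity one of them is not null; it has a common
   scale below which |f| <= 1 in the approach regions. *)
pose Sj (j : nat) := S `&` [set P | forall z, approach_region Omega alpha P z ->
  enorm (z - P) < j.+1%:R^-1 -> normc (f z) <= 1].
have [j Sj0] : exists j, (0 < area_outer R n (Sj j))%E.
  apply/not_existsP => H; move: S0; apply/negP; rewrite -leNgt.
  apply: (@le_trans _ _ (area_outer R n (\bigcup_j Sj j))).
    apply: le_outer_measure => P SP.
    have [h h0 hz] := boundary_trace_le _ _ _ _ SP.1.2 alpha_gt0 1 ltr01.
    exists (Num.truncn h^-1) => //; split => // z az zh; apply: hz => //.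
    apply: lt_trans zh _; rewrite invf_plt ?posrE//; exact: truncnS_gt.
  apply: le_trans (outer_measure_sigma_subadditive _ _) _.
  rewrite eseries0// => j _ _; apply/eqP; rewrite eq_le outer_measure_ge0 andbT leNgt.
  exact/negP/H.
have [||||||z0 [Oz0 fz0]] := local_uniqueness _ _ _ _ _ _ _ Ch Omega f (Sj j) j.+1%:R^-1 OE hf
  rho_bd.
- by move=> P [[[/Eb]]].
- move=> P [[[/Eb/rho_bd rP _] /= Ph] _]; split=> // k.
  by rewrite -rcB (le_lt_trans (rc_le_enorm k _)).
- exact: Sj0.
- by rewrite invr_gt0.
- by move=> P z [_ h]; exact: h.
- move=> P [[[_ tr] _] _] e e0; exact: boundary_trace_le tr alpha_gt0 e e0.
exact: identity_theorem oO cO hf Oz0 fz0.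
Qed.
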